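(* Let $0<s<1$, and let $q$ satisfy $\max\{2,s^{-1}\}<q\le\infty$ if $0<s\le\frac12$ and $\frac2{2s-1}<q\le+\infty$ if $\frac12<s<1$. Let $0\le\zeta_0\in L^q(D)$ with $0<|\mathrm{spt}(\zeta_0)|<\infty$ and let $\mathcal W>0$ be given. Suppose that the set $\tilde\Sigma_{\zeta_0,\mathcal W}$ of maximizers of $\tilde E_{\mathcal W}=E-\mathcal W I$ over $\overline{\mathcal R(\zeta_0)^w}$ satisfies $$\emptyset\ne\tilde\Sigma_{\zeta_0,\mathcal W}\subset\mathcal R(\zeta_0),$$ and that all elements of $\tilde\Sigma_{\zeta_0,\mathcal W}$ are admissible. Then $\tilde\Sigma_{\zeta_0,\mathcal W}$ is orbitally stable in the following sense. For arbitrary $\eta>0$ and $M>0$ there exists $\delta>0$ such that if there exists an $L^\infty$-regular solution $\xi(t)$ in $(0,T)$ with non-negative initial data $\xi_0$, $\|\xi_0\|_\infty\le M$ and $$\inf_{\zeta\in\tilde\Sigma_{\zeta_0,\mathcal W}}\{\|\xi_0-\zeta\|_1+\|\xi_0-\zeta\|_2+|I(\xi_0-\zeta)|\}\le\delta,$$ then for all $t\in(0,T)$ $$\inf_{\zeta\in\tilde\Sigma_{\zeta_0,\mathcal W}}\{\|\xi(t)-\zeta\|_1+\|\xi(t)-\zeta\|_2\}\le\eta.$$ If in addition $I(\zeta_1)=I(\zeta_2)$ for all $\zeta_1,\zeta_2\in\tilde\Sigma_{\zeta_0,\mathcal W}$, then for arbitrary $\eta>0$ and $M>0$ there exists $\delta>0$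 such that if there exists an $L^\infty$-regular solution $\xi(t)$ in $(0,T)$ with non-negative initial data $\xi_0$, $\|\xi_0\|_\infty\le M$ and $$\inf_{\zeta\in\tilde\Sigma_{\zeta_0,\mathcal W}}\{\|\xi_0-\zeta\|_1+\|\xi_0-\zeta\|_2+|I(\xi_0-\zeta)|\}\le\delta,$$ then for all $t\in(0,T)$ $$\inf_{\zeta\in\tilde\Sigma_{\zeta_0,\mathcal W}}\{\|\xi(t)-\zeta\|_1+\|\xi(t)-\zeta\|_2+I(|\xi(t)-\zeta|)\}\le\eta.$$
   Context: **Notation.** $(a_1,a_2)^\perp=(a_2,-a_1)$, $c_s=\frac{\Gamma(1-s)}{2^{2s}\pi\Gamma(s)}$, $\mathbb R^2_+=\{x_1>0\}$, $\bar x=(-x_1,x_2)$, $\mathcal G_s\omega(x)=\int_{\mathbb R^2}\frac{c_s}{|x-y|^{2-2s}}\omega(y)dy$, $G_s^+(x,y)=\frac{c_s}{|x-y|^{2-2s}}-\frac{c_s}{|x-\bar y|^{2-2s}}$, $\mathcal G_s^+\omega(x)=\int_{\mathbb R^2_+}G_s^+(x,y)\omega(y)dy$. $D=\mathbb R^2_+$ if $s>\frac12$ and $D=\{x_1\ge1\}$ if $0<s\le\frac12$; functions on $D$ are extended by $0$, and $\|\cdot\|_p$ is the $L^p$ norm. The gSQG equation is $\partial_t\theta+\mathbf u\cdot\nabla\theta=0$, $\mathbf u=\nabla^\perp\mathcal G_s\theta$ in $\mathbb R^2\times(0,T)$. **Functionals.** $E(\zeta)=\frac12\int_D\zeta\,\mathcal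 G_s^+\zeta\,dx$, $I(\zeta)=\int_Dx_1\zeta\,dx$, $\tilde E_{\mathcal W}=E-\mathcal WI$. **Rearrangements.** For non-negative integrable $\xi$: $\mathcal R(\xi)=\{0\le\zeta\in L^1(D): |\{\zeta>\tau\}|=|\{\xi>\tau\}|\ \forall\tau>0\}$ and $$\overline{\mathcal R(\xi)^w}=\Big\{\zeta\ge0\text{ measurable on }D:\ \int_D(\zeta-\alpha)_+dx\le\int_D(\xi-\alpha)_+dx\ \ \forall\alpha>0\Big\}.$$ **$L^\infty$-regular solutions.** Given $\xi_0\in L^1\cap L^\infty(\mathbb R^2_+)$, a function $\xi\in L^\infty_{loc}([0,T),L^1(\mathbb R^2_+))\cap L^\infty_{loc}([0,T),L^\infty(\mathbb R^2_+))$ is an $L^\infty$-regular solution in $(0,T)$ with initial data $\xi_0$ if: (i) $\xi(x,t)-\xi(\bar x,t)$ (with $\xi$ extended by $0$ to $\mathbb R^2$) satisfies the gSQG equation in the sense of distributions with initial data $\xi_0(x)-\xi_0(\bar x)$; (ii) $E(\xi(t,\cdot))$ and $I(\xi(t,\cdot))$ are constant and $\xi(t)\in\mathcal R(\xi_0)$ for $t\in[0,T)$; (iii) $\xi$ is non-negative for $t\in(0,T)$ if $\xi_0$ is non-negative; (iv) for $0<s\le\frac12$, $\xi$ is supported in $D$ for $t\in(0,T)$ if $\xi_0$ is supported in $D$. **Admissible.** $\xi_0$ is admissible if it is non-negative, supported in $D$ if $0<s\le\frac12$, and there exists an $L^\infty$-regular solution with initial data $\xi_0$ for $T=+\infty$.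 *)

(* Defs.v *)
From HB Require Import structures.
From mathcomp Require Import all_boot all_order all_algebra.
From mathcomp Require Import all_classical all_reals all_analysis.

Set Implicit Arguments.
Unset Strict Implicit.
Unset Printing Implicit Defensive.

Import Order.TTheory GRing.Theory Num.Theory.
Import numFieldNormedType.Exports.

Local Open Scope classical_set_scope.
Local Open Scope ring_scope.

(* Functions on a subset A of the plane are represented by functions on the
   whole plane that vanish almost everywhere outside A (extension by 0).  All
   predicates below are stable under modification on a null set. *)

Definition plane (R : realType) : Type := (measurableTypeR R * measurableTypeR R)%type.

Section Plane.
Context {R : realType}.
Implicit Types (x y z : plane R) (f : plane R -> R) (A : set (plane R)).

Definition leb2 : {measure set (measurableTypeR R * measurableTypeR R) -> \bar R} :=
  (lebesgue_measure \x lebesgue_measure)%E.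

(* The library norm on a product is the sup norm. *)
Definition eucl z : R := Num.sqrt (z.1 ^+ 2 + z.2 ^+ 2).

Definition edist x y : R := eucl (x.1 - y.1, x.2 - y.2).

Definition half_plane : set (plane R) := [set x | 0 < x.1].

Definition reflect1 x : plane R := (- x.1, x.2).

Definition ae_nonneg f : Prop := {ae leb2, forall x, 0 <= f x}.

Definition ae_supported A f : Prop := {ae leb2, forall x, ~ A x -> f x = 0}.

Definition normp (p : \bar R) f : \bar R := 'N[leb2]_p[EFin \o f]%E.

Definition in_Lp A (p : \bar R) f : Prop :=
  [/\ measurable_fun setT f, ae_supported A f & (normp p f < +oo)%E].

(* The support of an element of L^p: complement of the largest open set on
   which it vanishes almost everywhere. *)
Definition spt f : set (plane R) :=
  ~` (\bigcup_(U in [set U : set (plane R) |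
         open U /\ {ae leb2, forall x, U x -> f x = 0}]) U).

End Plane.

Section Operators.
Context {R : realType}.
Implicit Types (s a : R) (x y : plane R) (f zeta : plane R -> R).

(* Euler's integral, used for a > 0 only. *)
Definition Gamma a : R :=
  \int[lebesgue_measure]_(t in [set t : R | 0 < t]) (t `^ (a - 1) * expR (- t)).

Definition c_ s : R := Gamma (1 - s) / (2 `^ (2 * s) * pi * Gamma s).

Definition Gker s x y : R := c_ s / edist x y `^ (2 - 2 * s).

Definition Gker_plus s x y : R := Gker s x y - Gker s x (reflect1 y).

Definition Gs s f x : R := \int[leb2]_y (Gker s x y * f y).

Definition Gs_plus s f x : \bar R :=
  (\int[leb2]_(y in half_plane) (Gker_plus s x y * f y)%:E)%E.

Definition Dom s : set (plane R) :=
  if 2^-1 < s then half_plane else [set x | 1 <= x.1].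

(* E and I take values in \bar R: on the weak closure of a rearrangement class
   the impulse I may be +oo (the penalised energy is then -oo). *)
Definition energy s zeta : \bar R :=
  ((2^-1)%:E * \int[leb2]_(x in Dom s) ((zeta x)%:E * Gs_plus s zeta x))%E.

Definition impulse s zeta : \bar R :=
  (\int[leb2]_(x in Dom s) (x.1 * zeta x)%:E)%E.

Definition energyW s (W : R) zeta : \bar R :=
  (energy s zeta - W%:E * impulse s zeta)%E.

Definition rearr s f : set (plane R -> R) :=
  [set zeta | [/\ in_Lp (Dom s) 1%E zeta, ae_nonneg zeta &
    forall tau : R, 0 < tau ->
      leb2 [set x | tau < zeta x] = leb2 [set x | tau < f x]]].

Definition rearr_wclosure s f : set (plane R -> R) :=
  [set zeta | [/\ measurable_fun setT zeta, ae_supported (Dom s) zeta,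
    ae_nonneg zeta &
    forall alpha : R, 0 < alpha ->
      (\int[leb2]_(x in Dom s) (Num.max (zeta x - alpha) 0)%:E
       <= \int[leb2]_(x in Dom s) (Num.max (f x - alpha) 0)%:E)%E]].

Definition maximizers s (W : R) f : set (plane R -> R) :=
  [set zeta | rearr_wclosure s f zeta /\
    forall zeta', rearr_wclosure s f zeta' ->
      (energyW s W zeta' <= energyW s W zeta)%E].

End Operators.

Section Equation.
Context {R : realType}.
Implicit Types (s : R) (T : \bar R) (f theta : plane R -> R).

Fixpoint Ck (V : normedModType R) (n : nat) (g : V -> R) : Prop :=
  continuous g /\
  if n is n'.+1 then
    forall v : V, (forall x, derivable g x v) /\ Ck n' (fun x => 'D_v g x)
  else True.

Definition smooth (V : normedModType R) (g : V -> R) : Prop :=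
  forall n, Ck n g.

Definition spacetime : normedModType R := (R * R * R)%type.

(* C_c^oo(R^2 x [0, T)), as restrictions of smooth functions on R^2 x R with
   compact support in R^2 x (-oo, T). *)
Definition test_function T (phi : spacetime -> R) : Prop :=
  smooth phi /\
  exists K : set spacetime,
    [/\ compact K, (forall z, K z -> (z.2%:E < T)%E) &
        forall z, ~ K z -> phi z = 0].

Definition d1 (g : plane R -> R) (x : plane R) : R :=
  'D_((1, 0) : R * R) (g : R * R -> R) x.
Definition d2 (g : plane R -> R) (x : plane R) : R :=
  'D_((0, 1) : R * R) (g : R * R -> R) x.

Definition velocity s theta (x : plane R) : plane R :=
  (d2 (Gs s theta) x, - d1 (Gs s theta) x).

(* Perpendicular gradient (d2, - d1) in x of c_s |x - y|^(2s-2), as a function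
   of z = x - y. *)
Definition vel_kernel s (z : plane R) : plane R :=
  let k := - (2 - 2 * s) * c_ s / eucl z `^ (4 - 2 * s) in
  (k * z.2, k * - z.1).

(* The pairing of div(theta u) with - psi, i.e. the integral of
   theta u . grad psi.  If s > 1/2, u is a bounded function.  If s <= 1/2, u is
   only a distribution when theta is merely in L^1 and L^oo; the product
   theta u is given its usual meaning, obtained by symmetrising the double
   integral of theta(x) theta(y) K(x - y) . grad psi(x) with the help of the
   oddness of K, which makes it absolutely convergent. *)
Definition flux s theta (psi : plane R -> R) : R :=
  if 2^-1 < s then
    \int[leb2]_x (theta x * ((velocity s theta x).1 * d1 psi x
                             + (velocity s theta x).2 * d2 psi x))
  else
    2^-1 * \int[leb2]_x \int[leb2]_y
      (theta x * theta y *
       let k := vel_kernel s (x.1 - y.1, x.2 - y.2) in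
       k.1 * (d1 psi x - d1 psi y) + k.2 * (d2 psi x - d2 psi y)).

Definition gSQG_weak s T (theta0 : plane R -> R) (theta : R -> plane R -> R) :
    Prop :=
  forall phi : spacetime -> R, test_function T phi ->
    \int[lebesgue_measure]_(t in [set t : R | 0 <= t /\ (t%:E < T)%E])
      (\int[leb2]_x (theta t x * 'D_((0, 0, 1) : spacetime) phi (x, t))
       + flux s (theta t) (fun x => phi (x, t)))
    + \int[leb2]_x (theta0 x * phi (x, 0)) = 0.

Definition odd_ext f (x : plane R) : R :=
  (f \_ half_plane) x - (f \_ half_plane) (reflect1 x).

Definition Linfty_loc T (p : \bar R) (xi : R -> plane R -> R) : Prop :=
  forall tau : R, 0 <= tau -> (tau%:E < T)%E ->
    exists C : R, {ae lebesgue_measure, forall t : R, 0 <= t <= tau ->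
      in_Lp half_plane p (xi t) /\ (normp p (xi t) <= C%:E)%E}.

(* E, I and the rearrangement class R(xi0) are those of functions on D, hence
   Linf_rearr also makes xi t vanish outside D.
   Linf_init fixes the representative at time 0, so that "constant on [0, T)"
   means equal to the value for xi0. *)
Record Linfty_regular s T (xi0 : plane R -> R) (xi : R -> plane R -> R) :
    Prop := {
  Linf_data1 : in_Lp half_plane 1%E xi0;
  Linf_dataoo : in_Lp half_plane +oo%E xi0;
  Linf_meas : measurable_fun
    ([set t : measurableTypeR R | 0 <= t /\ (t%:E < T)%E] `*`
     [set: (measurableTypeR R * measurableTypeR R)%type])
    (fun z => xi z.1 z.2);
  Linf_loc1 : Linfty_loc T 1%E xi;
  Linf_locoo : Linfty_loc T +oo%E xi;
  Linf_init : {ae leb2, forall x, xi 0 x = xi0 x};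
  Linf_weak : gSQG_weak s T (odd_ext xi0) (fun t => odd_ext (xi t));
  Linf_energy : forall t t' : R, 0 <= t -> (t%:E < T)%E ->
    0 <= t' -> (t'%:E < T)%E -> energy s (xi t) = energy s (xi t');
  Linf_impulse : forall t t' : R, 0 <= t -> (t%:E < T)%E ->
    0 <= t' -> (t'%:E < T)%E -> impulse s (xi t) = impulse s (xi t');
  Linf_rearr : forall t : R, 0 <= t -> (t%:E < T)%E -> rearr s xi0 (xi t);
  Linf_nonneg : ae_nonneg xi0 ->
    forall t : R, 0 < t -> (t%:E < T)%E -> ae_nonneg (xi t);
  Linf_supp : s <= 2^-1 -> ae_supported (Dom s) xi0 ->
    forall t : R, 0 < t -> (t%:E < T)%E -> ae_supported (Dom s) (xi t)
}.

Definition admissible s (xi0 : plane R -> R) : Prop :=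
  [/\ ae_nonneg xi0, (s <= 2^-1 -> ae_supported (Dom s) xi0) &
      exists xi, Linfty_regular s +oo%E xi0 xi].

End Equation.

(* Main.v *)
(** The equation enters only through the conservation of the energy E, of the
    impulse I and of the distribution function.  If stability failed there would be
    solutions, starting closer and closer to the set of maximizers, with
    xi_n(t_n) staying away from it.  A slight truncation of xi_n(t_n) lies in the
    weak closure of the rearrangement class and gives a sequence f_n maximizing
    E - W I.  Its translates in x2 have a non-zero weak limit a along an
    ultrafilter, because a positive energy forces mass into a bounded window.

    If a were not a maximizer, the part of f_n in |x2| > R_n, for some R_n tending
    to infinity, would carry a definite amount of energy and have a second
    non-zero weak limit d after translation.  Restricting a and d to the bounded
    sets where the potential is at least W x1 does not decrease E - W I, and moving
    the two restrictions next to each other gains a positive interaction energy,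
    which contradicts maximality.

    So a is a maximizer, hence a rearrangement of zeta0; its L^2 norm bounds those of
    the f_n, the weak convergence is strong in L^2 and then in L^1, and the impulse
    controls the weighted norm. *)
From HB Require Import structures.
From Pilot Require Import Defs.
From mathcomp Require Import all_boot all_order all_algebra ring lra zify.
From mathcomp Require Import all_classical all_reals all_analysis.
From mathcomp Require Import measurable_realfun.

Import Order.TTheory GRing.Theory Num.Theory.
Import numFieldNormedType.Exports.

Set Implicit Arguments.
Unset Strict Implicit.
Unset Printing Implicit Defensive.

Local Open Scope classical_set_scope.
Local Open Scope ring_scope.

(** The constraint is carried by the functions t -> int (f - t)_+. They decrease under restriction,
    are invariant under translation in x2, add up over disjoint supports, are lower semicontinuous
    for weak limits, and bound the L^1 norm and every L^p norm with p >= 2. Hence no rearrangement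
    inequality is used.

    Compactness fails only along x2: in x1 the mass beyond X is at most I / X. The exponent p is
    such that, once the factor x1 is split off the kernel, its conjugate power is still locally
    integrable. The singular part is then negligible uniformly on the class, and potentials are
    o(x1) at infinity.

    The competitor is cut out of f_n itself and not out of the weak limits, so that it satisfies the
    constraint exactly; the limits enter only through the convergence of energies on bounded sets.

    Strong convergence controls x1 (a - xi)_+ but not the excess x1 (xi - a)_+. The excess is
    recovered from the conservation of impulse as soon as I takes a single value on all maximizers,
    which is where the additional hypothesis of the second half enters. *)

Local Notation edist := Pilot.Defs.edist.

(** * Translation, reflection and primitives on the line *)

Section Line.
Context {R : realType}.
Local Notation leb := (@lebesgue_measure R).
Local Open Scope ereal_scope.

Lemma lebesgue_measure_shift (c : R) (A : set R) : measurable A ->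
  pushforward leb ((fun x => (x + c)%R) : _ -> measurableTypeR R) A = leb A.
Proof.
have mc : measurable_fun [set: measurableTypeR R]
   ((fun x => (x + c)%R) : _ -> measurableTypeR R).
  by apply: measurable_realfun.measurable_funD => //; exact: measurable_id.
move=> mA; apply/esym/lebesgue_measure_unique => //= _ [[a b]] _ <-.
rewrite /pushforward /=.
have -> : (fun x => (x + c)%R) @^-1` `]a, b]%classic = `](a - c)%R, (b - c)%R]%classic.
  by apply/seteqP; split => x /=; rewrite !in_itv/= ltrBlDr lerBrDr.
rewrite !lebesgue_measure_itv/= !lte_fin ltrD2r -!EFinB.
by case: ifP => // _; congr EFin; ring.
Qed.

Lemma ge0_integral_shift (c : R) (f : R -> \bar R) :
  measurable_fun [set: R] f -> (forall x, 0 <= f x) ->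
  \int[leb]_x f (x + c)%R = \int[leb]_x f x.
Proof.
move=> mf f0.
have mc : measurable_fun [set: measurableTypeR R]
   ((fun x => (x + c)%R) : _ -> measurableTypeR R) by by apply: measurable_realfun.measurable_funD => //; exact: measurable_id.
transitivity (\int[pushforward leb ((fun x => (x + c)%R) : _ -> measurableTypeR R)]_y f y).
  by rewrite (@ge0_integral_pushforward _ _ _ _ _ _ mc)// preimage_setT.
apply: eq_measure_integral => A mA _; exact: lebesgue_measure_shift.
Qed.

Lemma ge0_integral_opp (f : R -> \bar R) :
  measurable_fun [set: R] f -> (forall x, 0 <= f x) ->
  \int[leb]_x f (- x)%R = \int[leb]_x f x.
Proof.
move=> mf f0.
have mc : measurable_fun [set: measurableTypeR R] (-%R : _ -> measurableTypeR R).
  exact: measurable_funN.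
transitivity (\int[pushforward leb (-%R : _ -> measurableTypeR R)]_y f y).
  by rewrite (@ge0_integral_pushforward _ _ _ _ _ _ mc)// preimage_setT.
apply: eq_measure_integral => A mA _; exact: lebesgue_measureN.
Qed.

(** [f] may blow up at 0. The fundamental theorem applies on [b/(n+2), b]; monotone convergence on
    one side and the limit of [F] at 0 on the other yield the whole of (0, b]. *)
Lemma ge0_FTC_right0 (f F : R -> R) (b : R) : (0 < b)%R ->
  (forall x : R, 0 < x -> x <= b -> 0 <= f x)%R ->
  measurable_fun [set: R] f ->
  (forall x : R, 0 < x -> {for x, continuous f})%R ->
  (forall x : R, 0 < x -> derivable F x 1)%R ->
  (forall x : R, 0 < x -> derive1 F x = f x)%R ->
  F x @[x --> 0%R^'+] --> 0%R ->
  \int[leb]_(x in `]0%R, b]) (f x)%:E = (F b)%:E.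
Proof.
move=> b0 f0 mf cf dF dFE F0.
(* [n.+2] rather than [n.+1] keeps the left endpoint strictly below [b] already for n = 0. *)
pose S n := `[(b / n.+2%:R)%R, b]%classic.
have bn n : (0 < b / n.+2%:R)%R by rewrite divr_gt0.
have US : \bigcup_n S n = `]0%R, b]%classic.
  apply/seteqP; split => [x [n _]|x]; rewrite /S /= !in_itv/=.
    by move=> /andP[h ->]; rewrite (lt_le_trans (bn n) h).
  move=> /andP[x0 xb]; exists (Num.truncn (b / x)) => //=; rewrite in_itv/= xb andbT.
  rewrite ler_pdivrMr// mulrC -ler_pdivrMr//.
  apply: (le_trans (ltW (truncnS_gt _))); by rewrite ler_nat.
have ndS : nondecreasing_seq S.
  move=> n m nm; apply/subsetPset; apply: subset_itvr; rewrite bnd_simp.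
  by rewrite ler_wpM2l ?(ltW b0)// lef_pV2 ?posrE// ler_nat !ltnS.
have H : \int[leb]_(x in S i) (EFin \o f) x @[i --> \oo] -->
    \int[leb]_(x in `]0%R, b]) (f x)%:E.
  rewrite -US; apply: ge0_nondecreasing_set_cvg_integral => //.
  - by move=> n; rewrite /S.
  - by move=> n; apply/measurable_EFinP; exact: measurable_funTS.
  - by move=> n x; rewrite /S /= in_itv/= => /andP[h1 h2]; rewrite lee_fin f0// (lt_le_trans (bn n) h1).
have E n : \int[leb]_(x in S n) (EFin \o f) x = (F b - F (b / n.+2%:R))%:E.
  rewrite EFinB; apply: continuous_FTC2.
  - by rewrite ltr_pdivrMr// ltr_pMr// ltr1n.
  - apply: continuous_in_subspaceT => x; rewrite inE/= in_itv/= => /andP[h _].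
    by apply: cf; rewrite (lt_le_trans (bn n) h).
  - have cF x : (0 < x)%R -> {for x, continuous F}.
      by move=> x0; apply: differentiable_continuous; apply/derivable1_diffP; exact: dF.
    split.
    + by move=> x; rewrite in_itv/= => /andP[h _]; apply: dF; rewrite (lt_trans (bn n) h).
    + by apply: cvg_at_right_filter; apply: cF.
    + by apply: cvg_at_left_filter; apply: cF.
  - by move=> x; rewrite in_itv/= => /andP[h _]; apply: dFE; rewrite (lt_trans (bn n) h).
have : (F b - F (b / n.+2%:R))%:E @[n --> \oo] --> (F b - 0)%:E.
  apply: cvg_EFin; first exact: nearW.
  apply: cvgB; first exact: cvg_cst.
  have : (b / n.+2%:R)%R @[n --> \oo] --> 0%R^'+.
    move=> A; rewrite /at_right /within /= => -[e /= e0 eA].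
    exists (Num.truncn (b / e)) => // n /= hn; apply: eA => //=.
    rewrite sub0r normrN gtr0_norm// ltr_pdivrMr// mulrC -ltr_pdivrMr//.
    by apply: (lt_le_trans (truncnS_gt _)); rewrite ler_nat !ltnS leqW// ltnW.
  by move=> h; exact: (cvg_comp _ _ h F0).
rewrite subr0 => H2.
rewrite -(cvg_lim _ H)//; under eq_fun do rewrite E.
exact: cvg_lim.
Qed.

End Line.

(** * Truncated negative powers on the line *)

Section Kernel.
Context {R : realType}.
Local Notation leb := (@lebesgue_measure R).
Local Notation mu2 := (@leb2 R).

Definition cutpow (c r : R) (t : R) : R :=
  if `|t| < r then (`|t| `^ c)^-1 else 0.

Lemma cutpow_ge0 c r t : 0 <= cutpow c r t.
Proof. by rewrite /cutpow; case: ifP => // _; rewrite invr_ge0 powR_ge0. Qed.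

Lemma measurable_cutpow c r : measurable_fun [set: R] (cutpow c r).
Proof.
apply: measurable_fun_if => //.
- by apply: measurable_fun_ltr => //; exact: normr_measurable.
- apply: measurable_funTS; under eq_fun do rewrite -powRN.
  exact: (measurableT_comp (measurable_powR (- c)) (@normr_measurable R setT)).
Qed.

Lemma integral_powR_right0 (c r : R) : 0 < c < 1 -> 0 < r ->
  (\int[leb]_(x in `]0%R, r]) (x `^ (- c))%:E = (r `^ (1 - c) / (1 - c))%:E)%E.
Proof.
move=> /andP[c0 c1] r0.
have c1' : 0 < 1 - c by rewrite subr_gt0.
apply: (@ge0_FTC_right0 _ (fun x => x `^ (- c)) (fun x => x `^ (1 - c) / (1 - c))) => //.
- by move=> x _ _; exact: powR_ge0.
- move=> x x0; apply: differentiable_continuous; apply/derivable1_diffP.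
  by apply: derivable_powR; rewrite in_itv/= x0.
- by move=> x x0; apply: derivableM => //; apply: derivable_powR; rewrite in_itv/= x0.
- move=> x x0; rewrite derive1E deriveM//; last first.
    by apply: derivable_powR; rewrite in_itv/= x0.
  rewrite derive_cst scaler0 add0r -derive1E powR_derive1 ?in_itv/= ?x0//.
  rewrite /GRing.scale/= mulrA mulVf ?gt_eqF// mul1r; congr (_ `^ _); lra.
- have h := @powR_cvg0 R (1 - c) c1'.
  have := cvgM h (@cvg_cst _ ((1 - c)^-1) _ (0 : R)^'+ _); rewrite mul0r; exact.
Qed.

Lemma integral_cutpow_le (c r x : R) : 0 < c < 1 -> 0 < r ->
  (\int[leb]_t (cutpow c r (x - t))%:E <= (2 * (r `^ (1 - c) / (1 - c)))%:E)%E.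
Proof.
move=> c01 r0.
have mcut : measurable_fun [set: R] (EFin \o cutpow c r).
  by apply/measurable_EFinP; exact: measurable_cutpow.
have cut0 t : (0 <= (EFin \o cutpow c r) t)%E by rewrite lee_fin cutpow_ge0.
have -> : (\int[leb]_t (cutpow c r (x - t))%:E = \int[leb]_t (EFin \o cutpow c r) t)%E.
  rewrite -(ge0_integral_opp mcut cut0) -(@ge0_integral_shift _ (- x) (EFin \o cutpow c r \o -%R)).
  - by apply: eq_integral => t _ /=; rewrite opprD opprK addrC.
  - by apply: measurableT_comp => //; exact: oppr_measurable.
  - by move=> t; exact: cut0.
pose g t := ((fun u : R => u `^ (- c)) \_ `]0%R, r]) t.
have mg : measurable_fun [set: R] (EFin \o g).
  apply/measurable_EFinP; apply/(measurable_restrictT _ _).1 => //.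
  by apply: measurable_funTS; exact: (measurable_powR (- c)).
have gr0 t : 0 <= g t by rewrite /g patchE; case: ifP => // _; exact: powR_ge0.
have g0 t : (0 <= (EFin \o g) t)%E by rewrite lee_fin.
have cE t : ((EFin \o cutpow c r) t <= (EFin \o g) t + (EFin \o g) (- t)%R)%E.
  rewrite -EFinD lee_fin /cutpow; case: ifPn => tr; last by rewrite addr_ge0.
  have [t0|t0|->] := ltgtP t 0.
  + rewrite ler_wpDl//.
    rewrite /g patchE mem_set; first by rewrite ltr0_norm// powRN.
    by rewrite /= in_itv/= oppr_gt0 t0 -(ltr0_norm t0) ltW.
  + rewrite ler_wpDr//.
    rewrite /g patchE mem_set; first by rewrite gtr0_norm// powRN.
    by rewrite /= in_itv/= t0 -(gtr0_norm t0) ltW.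
  (* A positive power of 0 is 0 and the inverse of 0 is 0, so [cutpow] vanishes at its
     singularity. *)
  + by rewrite normr0 powR0 ?gt_eqF ?(andP c01).1// invr0 addr_ge0.
apply: (@le_trans _ _ (\int[leb]_t ((EFin \o g) t + (EFin \o g) (- t)%R))%E).
  apply: ge0_le_integral => //.
  by apply: emeasurable_funD => //; apply: (measurableT_comp mg); exact: oppr_measurable.

rewrite ge0_integralD//; last by apply: (measurableT_comp mg); exact: oppr_measurable.
rewrite (ge0_integral_opp mg g0).
have -> : (\int[leb]_t (EFin \o g) t = (r `^ (1 - c) / (1 - c))%:E)%E.
  by rewrite -integral_powR_right0// [RHS]integral_mkcond restrict_EFin.
by rewrite -EFinD lee_fin mulr_natl mulr2n.
Qed.

End Kernel.

(** * Euclidean distance, reflection and vertical translation *)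

Section Euclid.
Context {R : realType}.
Implicit Types x y z : plane R.

Lemma eucl_ge0 z : 0 <= eucl z.
Proof. exact: sqrtr_ge0. Qed.

Lemma eucl_sqr z : eucl z ^+ 2 = z.1 ^+ 2 + z.2 ^+ 2.
Proof. by rewrite sqr_sqrtr// addr_ge0// sqr_ge0. Qed.

Lemma norm1_le_eucl z : `|z.1| <= eucl z.
Proof.
rewrite -ler_sqr ?nnegrE ?eucl_ge0// eucl_sqr real_normK ?num_real//.
by rewrite lerDl sqr_ge0.
Qed.

Lemma norm2_le_eucl z : `|z.2| <= eucl z.
Proof.
rewrite -ler_sqr ?nnegrE ?eucl_ge0// eucl_sqr real_normK ?num_real//.
by rewrite lerDr sqr_ge0.
Qed.

Lemma eucl_le_norm z : eucl z <= `|z.1| + `|z.2|.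
Proof.
rewrite -ler_sqr ?nnegrE ?eucl_ge0 ?addr_ge0// eucl_sqr.
rewrite -(real_normK (num_real z.1)) -(real_normK (num_real z.2)).
have := mulr_ge0 (normr_ge0 z.1) (normr_ge0 z.2); lra.
Qed.

Lemma edist_ge0 x y : 0 <= edist x y. Proof. exact: eucl_ge0. Qed.

Lemma edistC x y : edist x y = edist y x.
Proof. by rewrite /edist /eucl /= -(sqrrN (x.1 - _)) -(sqrrN (x.2 - _)) !opprB. Qed.

Lemma edist_sqr x y : edist x y ^+ 2 = (x.1 - y.1) ^+ 2 + (x.2 - y.2) ^+ 2.
Proof. exact: eucl_sqr. Qed.

Lemma edist_triangle y x z : edist x z <= edist x y + edist y z.
Proof.
rewrite -ler_sqr ?nnegrE ?addr_ge0 ?edist_ge0// sqrrD !edist_sqr.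
have : (x.1 - y.1) * (y.1 - z.1) + (x.2 - y.2) * (y.2 - z.2) <= edist x y * edist y z.
  apply: le_trans (ler_norm _) _.
  rewrite -ler_sqr ?nnegrE ?mulr_ge0 ?edist_ge0// exprMn !edist_sqr real_normK ?num_real//.
  set a := x.1 - _; set b := y.1 - _; set c := x.2 - _; set d := y.2 - _.
  (* Lagrange's identity: this square is the defect in the Cauchy-Schwarz inequality. *)
  have := sqr_ge0 (a * d - c * b); lra.
have : (x.1 - z.1) = (x.1 - y.1) + (y.1 - z.1) by ring.
have : (x.2 - z.2) = (x.2 - y.2) + (y.2 - z.2) by ring.
move=> -> ->.
set a := x.1 - _; set b := y.1 - _; set c := x.2 - _; set d := y.2 - _.
lra.
Qed.

Lemma edist_gt0 x y : x <> y -> 0 < edist x y.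
Proof.
move=> xy; rewrite lt_def edist_ge0 andbT; apply/eqP => d0; apply: xy.
have := norm1_le_eucl (x.1 - y.1, x.2 - y.2).
have := norm2_le_eucl (x.1 - y.1, x.2 - y.2).
rewrite -/(edist x y) d0 /= !normr_le0 !subr_eq0.
by case: x y {d0} => [a b] [c d] /= /eqP -> /eqP ->.
Qed.

Lemma edist_xx x : edist x x = 0.
Proof. by rewrite /edist /eucl /= !subrr expr0n/= addr0 sqrtr0. Qed.

Lemma edist_reflect x y : edist x (reflect1 y) = edist (reflect1 x) y.
Proof.
by rewrite /edist /eucl /= opprK -(sqrrN (- x.1 - _)) opprB opprK (addrC y.1).
Qed.

(** The source of the positivity of the half-plane kernel: seen from a point of the half-plane, the
    mirror image of another one is strictly farther than the original. *)
Lemma edist_reflect_sqr x y :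
  edist x (reflect1 y) ^+ 2 = edist x y ^+ 2 + 4 * x.1 * y.1.
Proof. by rewrite !edist_sqr /=; ring. Qed.

Lemma edist_le_reflect x y : 0 <= x.1 -> 0 <= y.1 -> edist x y <= edist x (reflect1 y).
Proof.
move=> x0 y0; rewrite -ler_sqr ?nnegrE ?edist_ge0// edist_reflect_sqr lerDl.
by rewrite !mulr_ge0.
Qed.

Lemma edist_lt_reflect x y : 0 < x.1 -> 0 < y.1 -> edist x y < edist x (reflect1 y).
Proof.
move=> x0 y0; rewrite -ltr_sqr ?nnegrE ?edist_ge0// edist_reflect_sqr ltrDl.
by rewrite !mulr_gt0.
Qed.

Lemma edist_reflect_le x y : 0 <= x.1 -> edist x (reflect1 y) <= edist x y + 2 * x.1.
Proof.
move=> x0; rewrite edist_reflect addrC; apply: (le_trans (edist_triangle x _ _)).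
rewrite lerD2r /edist/= subrr; apply: (le_trans (eucl_le_norm _)) => /=.
by rewrite normr0 addr0 -opprD normrN ger0_norm ?addr_ge0// mulr_natl mulr2n.
Qed.

Definition shift2 (c : R) x : plane R := (x.1, x.2 + c).

Lemma edist_shift2 c x y : edist (shift2 c x) (shift2 c y) = edist x y.
Proof. by rewrite /edist /shift2 /=; congr (eucl (_, _)); ring. Qed.

Lemma reflect1_shift2 c x : reflect1 (shift2 c x) = shift2 c (reflect1 x).
Proof. by []. Qed.

Lemma measurable_edist d (T : measurableType d) (f g : T -> plane R) :
  measurable_fun setT f -> measurable_fun setT g ->
  measurable_fun setT (fun t => edist (f t) (g t)).
Proof.
move=> mf mg; apply: (@measurableT_comp _ _ _ _ _ _ (@Num.sqrt R)).
  by apply: continuous_measurable_fun; exact: sqrt_continuous.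
have m1 : measurable_fun setT (fun t => (f t).1) by exact: measurableT_comp measurable_fst mf.
have m2 : measurable_fun setT (fun t => (f t).2) by exact: measurableT_comp measurable_snd mf.
have m3 : measurable_fun setT (fun t => (g t).1) by exact: measurableT_comp measurable_fst mg.
have m4 : measurable_fun setT (fun t => (g t).2) by exact: measurableT_comp measurable_snd mg.
by apply: measurable_funD => /=; apply: measurable_funX; exact: measurable_funB.
Qed.

Lemma measurable_reflect1 : measurable_fun setT (@reflect1 R).
Proof.
apply/measurable_fun_pairP; split => /=.
  exact: measurable_funN measurable_fst.
exact: measurable_snd.
Qed.

Lemma measurable_shift2 c : measurable_fun setT (shift2 c).
Proof.
apply/measurable_fun_pairP; split => /=; first exact: measurable_fst.
by apply: measurable_funD => //; exact: measurable_snd.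
Qed.

End Euclid.

(** * Riesz kernels in the plane *)

Section Newton.
Context {R : realType}.
Implicit Types x y z : plane R.
Local Notation leb := (@lebesgue_measure R).
Local Notation mu2 := (@leb2 R).

Definition nk (b : R) x y : R := (edist x y `^ b)^-1.

Lemma nk_ge0 b x y : 0 <= nk b x y.
Proof. by rewrite invr_ge0 powR_ge0. Qed.

Lemma measurable_nk d (T : measurableType d) (f g : T -> plane R) b :
  measurable_fun setT f -> measurable_fun setT g ->
  measurable_fun setT (fun t => nk b (f t) (g t)).
Proof.
move=> mf mg; rewrite /nk; under eq_fun do rewrite -powRN.
by apply: (measurableT_comp (measurable_powR (- b))); exact: measurable_edist.
Qed.

Definition nkc (b r : R) x y : R := if edist x y < r then nk b x y else 0.

Lemma nkc_ge0 b r x y : 0 <= nkc b r x y.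
Proof. by rewrite /nkc; case: ifP => // _; exact: nk_ge0. Qed.

Lemma measurable_nkc d (T : measurableType d) (f g : T -> plane R) b r :
  measurable_fun setT f -> measurable_fun setT g ->
  measurable_fun setT (fun t => nkc b r (f t) (g t)).
Proof.
move=> mf mg; apply: measurable_fun_if => //.
- by apply: measurable_fun_ltr => //; exact: measurable_edist.
- by apply: measurable_funTS; exact: measurable_nk.
Qed.

Lemma leb2_tonelli (f : plane R -> \bar R) :
  measurable_fun setT f -> (forall x, 0 <= f x)%E ->
  (\int[mu2]_x f x = \int[leb]_a \int[leb]_b f (a, b))%E.
Proof. by move=> mf f0; exact: (@fubini_tonelli1 _ _ _ _ _ leb leb f mf f0). Qed.

Lemma leb2_vline (a : R) : mu2 [set y | y.1 = a] = 0%E.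
Proof.
have -> : [set y : plane R | y.1 = a] = [set a] `*` setT.
  by apply/seteqP; split => y /=; [move=> ->|case].
rewrite [LHS](@product_measure1E _ _ _ _ _ leb leb)//.
by apply: etrans (mul0e _); congr mule; exact: lebesgue_measure_set1.
Qed.

Lemma leb2_hline (a : R) : mu2 [set y | y.2 = a] = 0%E.
Proof.
have -> : [set y : plane R | y.2 = a] = setT `*` [set a].
  by apply/seteqP; split => y /=; [move=> ->|case].
rewrite [LHS](@product_measure1E _ _ _ _ _ leb leb)//.
by apply: etrans (mule0 _); congr mule; exact: lebesgue_measure_set1.
Qed.

(** The product bound by [cutpow] breaks down on the two lines through [x] parallel to the axes,
    where one factor takes its default value 0; they form a null set. *)
Lemma ae_off_axes x : {ae mu2, forall y, x.1 - y.1 != 0 /\ x.2 - y.2 != 0}.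
Proof.
have h1 : mu2.-negligible [set y : plane R | y.1 = x.1].
  exists [set y : plane R | y.1 = x.1]; split => //; last exact: leb2_vline.
  rewrite -[X in measurable X]setTI -[X in _ `&` X]/(fst @^-1` [set x.1]).
  exact: measurable_fst.
have h2 : mu2.-negligible [set y : plane R | y.2 = x.2].
  exists [set y : plane R | y.2 = x.2]; split => //; last exact: leb2_hline.
  rewrite -[X in measurable X]setTI -[X in _ `&` X]/(snd @^-1` [set x.2]).
  exact: measurable_snd.
apply: negligibleS (negligibleU h1 h2) => y /= /not_andP[] /negP; rewrite negbK subr_eq0 => /eqP ->; [by left|by right].
Qed.

Lemma nkc_le_cutpow b r x y : 0 < b -> x.1 - y.1 != 0 -> x.2 - y.2 != 0 ->
  nkc b r x y <= cutpow (b / 2) r (x.1 - y.1) * cutpow (b / 2) r (x.2 - y.2).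
Proof.
move=> b0 xy1 xy2; rewrite /nkc; case: ifPn => dr; last by rewrite mulr_ge0// cutpow_ge0.
have n1 := norm1_le_eucl (x.1 - y.1, x.2 - y.2).
have n2 := norm2_le_eucl (x.1 - y.1, x.2 - y.2).
rewrite -/(edist x y) /= in n1 n2.
rewrite /cutpow (le_lt_trans n1 dr) (le_lt_trans n2 dr) -invfM /nk.
rewrite lef_pV2 ?posrE; last 2 first.
- by rewrite powR_gt0// (lt_le_trans _ n1)// normr_gt0.
- by rewrite mulr_gt0// powR_gt0// normr_gt0.
rewrite [X in _ <= _ `^ X](splitr b) powRD; last first.
  by apply/implyP => _; rewrite gt_eqF// (lt_le_trans _ n1)// normr_gt0.
by apply: ler_pM; rewrite ?powR_ge0//; apply: ge0_ler_powR; rewrite ?nnegrE ?edist_ge0// divr_ge0// ltW.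
Qed.

Definition Kc (b r : R) : R := (2 * (r `^ (1 - b / 2) / (1 - b / 2))) ^+ 2.

(* [|z| >= |z.1|^(1/2) |z.2|^(1/2)] reduces the integral to a product of two
   one-dimensional ones; [Kc] is their product. *)
Lemma integral_nkc_le b r x : 0 < b < 2 -> 0 < r ->
  (\int[mu2]_y (nkc b r x y)%:E <= (Kc b r)%:E)%E.
Proof.
move=> /andP[b0 b2] r0.
have b2' : 0 < b / 2 < 1 by rewrite divr_gt0//= ltr_pdivrMr// mul1r.
have mc (i : R) : measurable_fun [set: R] (fun t => cutpow (b / 2) r (i - t)).
  apply: (measurableT_comp (measurable_cutpow _ _)).
  by apply: measurable_funB => //; exact: measurable_id.
pose G (y : plane R) := (cutpow (b / 2) r (x.1 - y.1) * cutpow (b / 2) r (x.2 - y.2))%:E.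
have mG : measurable_fun setT G.
  apply/measurable_EFinP; apply: measurable_funM.
    exact: (measurableT_comp (mc _) measurable_fst).
  exact: (measurableT_comp (mc _) measurable_snd).
have G0 y : (0 <= G y)%E by rewrite lee_fin mulr_ge0// cutpow_ge0.
apply: (@le_trans _ _ (\int[mu2]_y G y)%E).
  apply: ae_ge0_le_integral => //.
  - by move=> y _; rewrite lee_fin nkc_ge0.
  - by apply/measurable_EFinP; apply: measurable_nkc => //; exact: measurable_id.
  - have := ae_off_axes x; apply: filterS => y [y1 y2] _.
    by rewrite lee_fin nkc_le_cutpow.
rewrite leb2_tonelli//.
have E a : (\int[leb]_y G (a, y) = (cutpow (b / 2) r (x.1 - a))%:E *
    \int[leb]_y (cutpow (b / 2) r (x.2 - y))%:E)%E.
  rewrite -ge0_integralZl//.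
  - by apply/measurable_EFinP; exact: mc.
  - by move=> y ?; rewrite lee_fin cutpow_ge0.
  - by rewrite lee_fin cutpow_ge0.
under eq_integral do rewrite E.
rewrite ge0_integralZr//; last 3 first.
- by apply/measurable_EFinP; exact: mc.
- by move=> y ?; rewrite lee_fin cutpow_ge0.
- by apply: integral_ge0 => y _; rewrite lee_fin cutpow_ge0.
rewrite /Kc expr2 EFinM; apply: lee_pmul; try exact: integral_cutpow_le.
  by apply: integral_ge0 => y _; rewrite lee_fin cutpow_ge0.
by apply: integral_ge0 => y _; rewrite lee_fin cutpow_ge0.
Qed.

Lemma Kc_ge0 b r : 0 <= Kc b r. Proof. exact: sqr_ge0. Qed.

Lemma Kc_cvg0 b e : 0 < b < 2 -> 0 < e -> exists2 r, 0 < r & Kc b r <= e.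
Proof.
move=> /andP[b0 b2] e0.
have b1 : 0 < 1 - b / 2 by rewrite subr_gt0 ltr_pdivrMr// mul1r.
have : Kc b r @[r --> 0^'+] --> 0.
  rewrite /Kc; have h := @powR_cvg0 R _ b1.
  have h2 : 2 * (r `^ (1 - b / 2) / (1 - b / 2)) @[r --> 0^'+] --> 0.
    have E : 0 = 2 * (0 * (1 - b / 2)^-1) by rewrite mul0r mulr0.
    rewrite [X in _ --> X]E.
    by apply: cvgM; [exact: cvg_cst|apply: cvgM; [exact: h|exact: cvg_cst]].
  have := cvgM h2 h2; rewrite mulr0 => /(_ _ _)/=; apply.
move=> /cvgrPdist_le /(_ _ e0) H.
have [r [/= r0 hr]] : exists r : R, 0 < r /\ `|0 - Kc b r| <= e.
  have : \forall r \near (0 : R)^'+, 0 < r /\ `|0 - Kc b r| <= e.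
    by near=> r; split; [near: r; exact: nbhs_right_gt|near: r].
  by move=> /filter_ex.
exists r => //; apply: le_trans hr; rewrite sub0r normrN; exact: ler_norm.
Unshelve. all: by end_near. Qed.

(** Young's inequality for a / l and l b with exponents p / (p - 1) and p, the two constants being
    bounded by 1. The free weight [l] decides which of the two terms is made small. *)
Lemma young_le (p a b l : R) : 1 < p -> 0 <= a -> 0 <= b -> 0 < l ->
  a * b <= l `^ (- (p / (p - 1))) * a `^ (p / (p - 1)) + l `^ p * b `^ p.
Proof.
move=> p1 a0 b0 l0.
have p0 : 0 < p by lra.
have p10 : 0 < p - 1 by lra.
have -> : a * b = (l^-1 * a) * (l * b) by rewrite mulrACA mulVf ?gt_eqF// mul1r.
apply: (le_trans (@conjugate_powR _ (l^-1 * a) (l * b) (p / (p - 1)) p _ _ _ _ _)).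
- by rewrite mulr_ge0// invr_ge0 ltW.
- by rewrite mulr_ge0// ltW.
- by rewrite divr_gt0.
- by [].
- by field; rewrite !gt_eqF.
have l0' : 0 <= l^-1 by rewrite invr_ge0 ltW.
rewrite !powRM ?(ltW l0)// -powR_inv1 ?(ltW l0)// -powRrM mulN1r.
have A1 : 0 <= l `^ (- (p / (p - 1))) * a `^ (p / (p - 1)) by rewrite mulr_ge0// powR_ge0.
have A2 : 0 <= l `^ p * b `^ p by rewrite mulr_ge0// powR_ge0.
apply: lerD.
  rewrite ler_piMr// invf_le1 ?divr_gt0// ler_pdivlMr//; lra.
by rewrite ler_piMr// invf_le1// ltW.
Qed.

(** Young under the integral takes the place of Hoelder: the conjugate power of the kernel has
    exponent g p / (p - 1) < 2 and is locally integrable. The L^p mass stays localised in the ball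
    of radius [r], which later gives the decay at infinity. *)
Lemma integral_nkc_young g p r l x (f : plane R -> R) :
  0 < g -> 1 < p -> g * (p / (p - 1)) < 2 -> 0 < r -> 0 < l ->
  measurable_fun setT f -> (forall y, 0 <= f y) ->
  (\int[mu2]_y (nkc g r x y * f y)%:E <=
   (l `^ (- (p / (p - 1))) * Kc (g * (p / (p - 1))) r)%:E +
   (l `^ p)%:E * \int[mu2]_y ((if edist x y < r then f y else 0) `^ p)%:E)%E.
Proof.
move=> g0 p1 gp r0 l0 mf f0.
have p0 : 0 < p by lra.
have q0 : 0 < p / (p - 1) by rewrite divr_gt0//; lra.
have gq0 : 0 < g * (p / (p - 1)) by rewrite mulr_gt0.
have mf' : measurable_fun setT (fun y => (if edist x y < r then f y else 0) `^ p).
  apply: (measurableT_comp (measurable_powR p)); apply: measurable_fun_if => //.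
    by apply: measurable_fun_ltr => //; apply: measurable_edist => //; exact: measurable_id.
  exact: measurable_funTS.
have mk b : measurable_fun setT (fun y => nkc b r x y).
  by apply: measurable_nkc => //; exact: measurable_id.
apply: (@le_trans _ _ (\int[mu2]_y ((l `^ (- (p / (p - 1))))%:E * (nkc (g * (p / (p - 1))) r x y)%:E
    + (l `^ p)%:E * ((if edist x y < r then f y else 0) `^ p)%:E))%E).
  apply: ge0_le_integral => //.
  - by move=> y _; rewrite lee_fin mulr_ge0// nkc_ge0.
  - by apply/measurable_EFinP; apply: measurable_funM.
  - by apply: emeasurable_funD; apply/measurable_EFinP; apply: measurable_funM.
  - move=> y _; rewrite -!EFinM -EFinD lee_fin /nkc; case: ifPn => dr; last first.
      by rewrite mul0r mulr0 add0r mulr_ge0// powR_ge0.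
    apply: (le_trans (young_le p1 (nk_ge0 g x y) (f0 y) l0)).
    rewrite lerD2r ler_wpM2l ?powR_ge0// /nk le_eqVlt; apply/orP; left; apply/eqP.
    by rewrite -!powRN -powRrM mulNr.
rewrite ge0_integralD//; last 4 first.
- by move=> y _; rewrite -EFinM lee_fin mulr_ge0 ?powR_ge0 ?nkc_ge0.
- by apply/measurable_EFinP; apply: measurable_funM.
- by move=> y _; rewrite -EFinM lee_fin mulr_ge0 ?powR_ge0.
- by apply/measurable_EFinP; apply: measurable_funM.
rewrite !ge0_integralZl//; last 6 first.
- exact/measurable_EFinP.
- by move=> y _; rewrite lee_fin powR_ge0.
- by rewrite lee_fin powR_ge0.
- exact/measurable_EFinP.
- by move=> y _; rewrite lee_fin nkc_ge0.
- by rewrite lee_fin powR_ge0.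
rewrite leeD2r// EFinM lee_wpmul2l ?lee_fin ?powR_ge0//.
by apply: integral_nkc_le => //; rewrite gq0.
Qed.

Lemma ge0_integral_shift2 (c : R) (f : plane R -> \bar R) :
  measurable_fun setT f -> (forall x, 0 <= f x)%E ->
  (\int[mu2]_x f (shift2 c x) = \int[mu2]_x f x)%E.
Proof.
move=> mf f0.
have mfc : measurable_fun setT (f \o shift2 c).
  by apply: measurableT_comp => //; exact: measurable_shift2.
apply: (etrans (leb2_tonelli mfc (fun x => f0 _))).
apply: (etrans _ (esym (leb2_tonelli mf f0))).
apply: eq_integral => a _.
apply: (@ge0_integral_shift _ c (fun y : R => f (a, y))) => //.
exact: measurableT_comp.
Qed.

End Newton.

(** * Hinge integrals and the layer-cake formula *)

Section LayerCake.
Context {R : realType} d (T : measurableType d).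
Variable mu : {sigma_finite_measure set T -> \bar R}.
Local Notation leb := (@lebesgue_measure R).
Implicit Types f g : T -> R.

Definition hinge (a t : R) : R := Num.max (t - a) 0.

Lemma hinge_ge0 a t : 0 <= hinge a t.
Proof. by rewrite /hinge le_max lexx orbT. Qed.

Lemma hinge_le a t : 0 <= a -> 0 <= t -> hinge a t <= t.
Proof. by move=> a0 t0; rewrite /hinge ge_max t0 andbT gerBl. Qed.

Lemma le_hinge a t u : t <= u -> hinge a t <= hinge a u.
Proof. by move=> tu; rewrite /hinge ge_max !le_max lerD2r tu lexx orbT. Qed.

Lemma measurable_hinge a f : measurable_fun setT f ->
  measurable_fun setT (fun x => hinge a (f x)).
Proof. by move=> mf; apply: measurable_maxr => //; exact: measurable_funB. Qed.

(** Writes t^p as a superposition of the hinges (t - a)_+ with weight a^(p-2); the constant p (p -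
    1) comes from the second derivative of t^p. *)
Lemma integral_hinge_powR (p t : R) : 2 <= p -> 0 <= t ->
  (\int[leb]_(a in `]0%R, +oo[) (a `^ (p - 2) * hinge a t)%:E =
   (t `^ p / (p * (p - 1)))%:E)%E.
Proof.
move=> p2; have p0 : p != 0 by apply/eqP; lra.
have p10 : p - 1 != 0 by apply/eqP; lra.
rewrite le_eqVlt => /predU1P[<-|t0].
  rewrite powR0// mul0r integral0_eq// => a /=; rewrite in_itv/= andbT => a0.
  by rewrite /hinge max_r ?mulr0// sub0r oppr_le0 ltW.
have mh : measurable_fun [set: R] (fun a => a `^ (p - 2) * hinge a t).
  apply: measurable_funM; first exact: (measurable_powR (p - 2)).
  by apply: measurable_maxr => //; apply: measurable_funB => //; exact: measurable_id.
rewrite -[RHS](_ : (\int[leb]_(a in `]0%R, t]) (a `^ (p - 2) * hinge a t)%:E)%E = _).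
  rewrite [LHS]integral_mkcond [RHS]integral_mkcond; apply: eq_integral => a _.
  rewrite !patchE !mem_setE !in_itv/= andbT.
  case: ltP => //= a0; case: leP => // ta.
  by rewrite /hinge max_r ?mulr0// subr_le0 ltW.
(* The primitive of a^(p-2) (t - a) that tends to 0 at 0. *)
pose F a := t * (a `^ (p - 1) / (p - 1)) - a `^ p / p.
have -> : t `^ p / (p * (p - 1)) = F t.
  rewrite /F -(mulr_powRB1 (ltW t0)); last by lra.
  by field; rewrite p0 p10.
have -> : (\int[leb]_(a in `]0%R, t]) (a `^ (p - 2) * hinge a t)%:E =
   \int[leb]_(a in `]0%R, t]) (a `^ (p - 2) * (t - a))%:E)%E.
  apply: eq_integral => a; rewrite inE/= in_itv/= => /andP[a0 a1].
  by rewrite /hinge max_l// subr_ge0.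
apply: (@ge0_FTC_right0 _ (fun a => a `^ (p - 2) * (t - a)) F).
- exact: t0.
- by move=> x x0 xt; rewrite mulr_ge0 ?powR_ge0 ?subr_ge0.
- apply: measurable_funM; first exact: (measurable_powR (p - 2)).
  by apply: measurable_funB => //; exact: measurable_id.
- move=> x x0.
  have cp : {for x, continuous (fun a : R => a `^ (p - 2))}.
    apply: differentiable_continuous; apply/derivable1_diffP.
    by apply: derivable_powR; rewrite in_itv/= x0.
  by apply: cvgM; [exact: cp|apply: cvgB; [exact: cvg_cst|exact: cvg_id]].
- move=> x x0; apply: derivableB.
    apply: derivableM => //; apply: derivableM => //.
    by apply: derivable_powR; rewrite in_itv/= x0.
  by apply: derivableM => //; apply: derivable_powR; rewrite in_itv/= x0.
- move=> x x0.
  have d1 (q : R) : is_derive x 1 (fun a : R => a `^ q) (q * x `^ (q - 1)).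
    apply: DeriveDef; first by apply: derivable_powR; rewrite in_itv/= x0.
    by rewrite -derive1E powR_derive1 ?in_itv/= ?x0.
  have h1 := d1 (p - 1); have h2 := d1 p.
  rewrite derive1E /F derive_val /GRing.scale /=.
  have -> : p - 1 - 1 = p - 2 by ring.
  have -> : x `^ (p - 1) = x * x `^ (p - 2).
    by rewrite (_ : p - 2 = (p - 1) - 1) ?mulr_powRB1 ?(ltW x0)//; [lra|ring].
  by rewrite !mulr0 !add0r !mulKf//; ring.
- have c (q : R) : 0 < q -> a `^ q / q @[a --> 0^'+] --> 0.
    move=> q0; rewrite -[X in _ --> X](mul0r q^-1).
    by apply: cvgM; [exact: powR_cvg0|exact: cvg_cst].
  have E : 0 = t * 0 - 0 by rewrite mulr0 subr0.
  rewrite [X in _ --> X]E.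
  by apply: cvgB; [apply: cvgM; [exact: cvg_cst|apply: c; lra]|apply: c; lra].
Qed.

Definition Phi f (a : R) : \bar R := (\int[mu]_x (hinge a (f x))%:E)%E.

Lemma Phi_ge0 f a : (0 <= Phi f a)%E.
Proof. by apply: integral_ge0 => x _; rewrite lee_fin hinge_ge0. Qed.

(* Membership in the weak closure of a rearrangement class bounds [Phi] pointwise,
   hence every L^p norm with p >= 2. *)
Lemma integral_powR_Phi (p : R) f : 2 <= p -> measurable_fun setT f ->
  (forall x, 0 <= f x) ->
  (\int[mu]_x (f x `^ p)%:E =
   (p * (p - 1))%:E * \int[leb]_(a in `]0%R, +oo[) ((a `^ (p - 2))%:E * Phi f a))%E.
Proof.
move=> p2 mf f0.
pose K (z : T * R) : \bar R :=
  ((if 0 < z.2 then z.2 `^ (p - 2) else 0) * hinge z.2 (f z.1))%:E.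
have K0 z : (0 <= K z)%E.
  by rewrite lee_fin mulr_ge0 ?hinge_ge0//; case: ifP => // _; exact: powR_ge0.
have mK : measurable_fun setT K.
  apply/measurable_EFinP; apply: measurable_funM.
    apply: (@measurableT_comp _ _ _ _ _ _ (fun a : R => if 0 < a then a `^ (p - 2) else 0)) => //.
    apply: measurable_fun_if => //.
      by apply: measurable_fun_ltr => //; exact: measurable_id.
    by apply: measurable_funTS; exact: (measurable_powR (p - 2)).
  apply: measurable_maxr => //; apply: measurable_funB => //.
  exact: measurableT_comp mf measurable_fst.
have pp : 0 < p * (p - 1) by rewrite mulr_gt0//; lra.
have E1 x : (\int[leb]_a K (x, a) = (f x `^ p / (p * (p - 1)))%:E)%E.
  rewrite -integral_hinge_powR// [RHS]integral_mkcond; apply: eq_integral => a _.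
  rewrite patchE /K/=; case: ifPn => a0; case: ifPn => //.
  + by rewrite notin_setE/= in_itv/= a0.
  + by rewrite inE/= in_itv/= andbT (negbTE a0).
  + by rewrite mul0r.
have E2 a : (\int[mu]_x K (x, a) = ((if 0 < a then a `^ (p - 2) else 0)%:E * Phi f a))%E.
  rewrite /Phi -ge0_integralZl//.
  - by apply/measurable_EFinP; exact: measurable_hinge.
  - by move=> x _; rewrite lee_fin hinge_ge0.
  - by rewrite lee_fin; case: ifP => // _; exact: powR_ge0.
have := fubini_tonelli (m1 := mu) (m2 := leb) K mK K0.
under eq_integral do rewrite E1.
under [X in _ = X -> _]eq_integral do rewrite E2.
move=> E.
have -> : (\int[leb]_(a in `]0%R, +oo[) ((a `^ (p - 2))%:E * Phi f a) =
  \int[leb]_a ((if 0 < a then a `^ (p - 2) else 0)%:E * Phi f a))%E.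
  rewrite [LHS]integral_mkcond; apply: eq_integral => a _.
  rewrite patchE; case: ifPn; rewrite ?inE ?notin_setE/= in_itv/= andbT => h.
    by rewrite h.
  by rewrite (negbTE (introN idP h)) mul0e.
rewrite -E -ge0_integralZl//; last 3 first.
- by apply/measurable_EFinP; apply: measurable_funM => //; apply: (measurableT_comp (measurable_powR p)).
- by move=> x _; rewrite lee_fin divr_ge0 ?powR_ge0// ltW.
- by rewrite lee_fin ltW.
apply: eq_integral => x _; rewrite -EFinM mulrC divfK// gt_eqF//.
Qed.

Lemma measurable_Phi f : measurable_fun setT f -> measurable_fun [set: R] (Phi f).
Proof.
move=> mf; pose K (z : T * R) : \bar R := (hinge z.2 (f z.1))%:E.
have := @measurable_fun_fubini_tonelli_G _ _ T R R mu K; apply.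
  apply/measurable_EFinP; apply: measurable_maxr => //; apply: measurable_funB => //.
  exact: measurableT_comp mf measurable_fst.
by move=> z; rewrite lee_fin hinge_ge0.
Qed.

Lemma le_integral_powR_Phi (p : R) f g : 2 <= p -> measurable_fun setT f ->
  (forall x, 0 <= f x) -> measurable_fun setT g -> (forall x, 0 <= g x) ->
  (forall a, 0 < a -> (Phi f a <= Phi g a)%E) ->
  (\int[mu]_x (f x `^ p)%:E <= \int[mu]_x (g x `^ p)%:E)%E.
Proof.
move=> p2 mf f0 mg g0 fg; rewrite (integral_powR_Phi p2 mf f0) (integral_powR_Phi p2 mg g0).
apply: lee_wpmul2l; first by rewrite lee_fin mulr_ge0//; lra.
have mm (h : T -> R) : measurable_fun setT h ->
    measurable_fun (`]0%R, +oo[%classic : set R) (fun a : R => ((a `^ (p - 2))%:E * Phi h a)%E).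
  move=> mh; apply: measurable_funTS; apply: emeasurable_funM; last exact: measurable_Phi.
  by apply/measurable_EFinP; exact: (measurable_powR (p - 2)).
apply: ge0_le_integral => //.
- by move=> a _; rewrite mule_ge0 ?lee_fin ?powR_ge0// Phi_ge0.
- exact: mm.
- exact: mm.
- move=> a; rewrite /= in_itv/= andbT => a0; rewrite lee_wpmul2l ?lee_fin ?powR_ge0//.
  exact: fg.
Qed.

Lemma integral_Phi0 f : (forall x, 0 <= f x) -> (\int[mu]_x (f x)%:E = Phi f 0)%E.
Proof.
by move=> f0; apply: eq_integral => x _; rewrite /hinge subr0 max_l.
Qed.

(** Tonelli on the region a < t < f x. Since only the distribution function of [f] appears on the
    right, rearrangements share the same [Phi]. *)
Lemma Phi_distr f a : measurable_fun setT f -> 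
  Phi f a = (\int[leb]_(t in `]a, +oo[) mu [set x | (t < f x)%R])%E.
Proof.
move=> mf.
pose K (z : T * R) : \bar R := (if (a < z.2) && (z.2 < f z.1) then 1 else 0)%:E.
have K0 z : (0 <= K z)%E by rewrite lee_fin; case: ifP.
have mK : measurable_fun setT K.
  apply/measurable_EFinP; apply: measurable_fun_if => //; apply: measurable_and.
    by apply: measurable_fun_ltr => //; exact: measurable_snd.
  apply: measurable_fun_ltr; first exact: measurable_snd.
  exact: measurableT_comp mf measurable_fst.
have E1 x : (\int[leb]_t K (x, t) = (hinge a (f x))%:E)%E.
  transitivity (\int[leb]_(t in `]a, f x[) 1%:E)%E.
    rewrite [RHS]integral_mkcond; apply: eq_integral => t _.
    rewrite patchE /K /=; case: ifPn => h; case: ifPn => //.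
      by rewrite notin_setE/= in_itv/= h.
    by rewrite inE/= in_itv/= (negbTE h).
  rewrite integral_cst// mul1e.
  apply: etrans (lebesgue_measure_itv _) _ => /=.
  rewrite lte_fin /hinge; case: ltP => h.
    by rewrite -EFinB max_l// subr_ge0 ltW.
  by rewrite max_r// subr_le0.
have E2 t : (\int[mu]_x K (x, t) = if (a < t)%R then mu [set x | (t < f x)%R] else 0)%E.
  rewrite /K/=; case: ifPn => at_ /=; last by rewrite integral0_eq.
  transitivity (\int[mu]_(x in [set x | (t < f x)%R]) 1%:E)%E.
    rewrite [RHS]integral_mkcond; apply: eq_integral => x _.
    rewrite patchE /=; case: ifPn => h; case: ifPn => //.
      by rewrite notin_setE/= h.
    by rewrite inE/= (negbTE h).
  rewrite integral_cst ?mul1e//.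
  rewrite -[X in measurable X]setTI.
  by apply: (measurable_fun_ltr (measurable_cst t) mf) => //.
have := fubini_tonelli (m1 := mu) (m2 := leb) K mK K0.
under eq_integral do rewrite E1.
under [X in _ = X -> _]eq_integral do rewrite E2.
rewrite -/(Phi f a) => ->.
rewrite [RHS]integral_mkcond; apply: eq_integral => t _; rewrite patchE.
by rewrite mem_setE in_itv/= andbT.
Qed.

Lemma eq_Phi f g a : measurable_fun setT f -> measurable_fun setT g -> 0 <= a ->
  (forall t, 0 < t -> mu [set x | t < f x] = mu [set x | t < g x]) ->
  Phi f a = Phi g a.
Proof.
move=> mf mg a0 fg; rewrite !Phi_distr//; apply: eq_integral => t.
by rewrite inE/= in_itv/= andbT => at_; rewrite fg// (le_lt_trans a0).
Qed.

(** The L^1 norm is [Phi] at 0, where no inequality is assumed; it is reached by monotone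
    convergence along a = 1/(n+1). *)
Lemma le_integral_Phi f g : measurable_fun setT f ->
  (forall x, 0 <= f x) -> measurable_fun setT g -> (forall x, 0 <= g x) ->
  (forall a, 0 < a -> (Phi f a <= Phi g a)%E) ->
  (\int[mu]_x (f x)%:E <= \int[mu]_x (g x)%:E)%E.
Proof.
move=> mf f0 mg g0 fg.
have Pg n : (Phi f n.+1%:R^-1 <= \int[mu]_x (g x)%:E)%E.
  apply: (le_trans (fg _ _)); first by rewrite invr_gt0.
  apply: ge0_le_integral => //.
  - by move=> x _; rewrite lee_fin hinge_ge0.
  - by apply/measurable_EFinP; exact: measurable_hinge.
  - exact/measurable_EFinP.
  - by move=> x _; rewrite lee_fin hinge_le.
have : (Phi f n.+1%:R^-1 @[n --> \oo] --> \int[mu]_x (f x)%:E)%E.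
  have -> : (\int[mu]_x (f x)%:E = \int[mu]_x (limn (fun n => (hinge n.+1%:R^-1 (f x))%:E)))%E.
    apply: eq_integral => x _; apply/esym/cvg_lim => //.
    apply: cvg_EFin; first exact: nearW.
    have h : (f x - n.+1%:R^-1) @[n --> \oo] --> f x.
      rewrite -[X in _ --> X]subr0.
      apply: cvgB; [exact: cvg_cst|exact: cvg_harmonic].
    apply: (squeeze_cvgr _ h (cvg_cst (f x))).
    by apply: nearW => n /=; rewrite hinge_le// andbT /hinge le_max lexx.
  apply: cvg_monotone_convergence => //.
  - by move=> n; apply/measurable_EFinP; exact: measurable_hinge.
  - by move=> n x _; rewrite lee_fin hinge_ge0.
  - move=> x _ n m nm; rewrite lee_fin /hinge ge_max !le_max lexx orbT andbT.
    by rewrite lerD2l lerN2 lef_pV2 ?posrE// ler_nat ltnS nm.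
move=> h; apply: (cvge_le _ h) => //; exact: nearW.
Qed.

End LayerCake.

(** * Real-valued integrals of integrable functions *)

Section RealIntegral.
Context {R : realType} d (T : measurableType d).
Variable mu : {measure set T -> \bar R}.
Implicit Types f g : T -> R.

Definition integ f := mu.-integrable setT (EFin \o f).
Local Notation Rint f := (\int[mu]_x f x).

Lemma integ_meas f : integ f -> measurable_fun setT f.
Proof. by move=> /integrableP[/measurable_EFinP]. Qed.

Lemma ge0_integ f : measurable_fun setT f -> (forall x, 0 <= f x) ->
  (\int[mu]_x (f x)%:E < +oo)%E -> integ f.
Proof.
move=> mf f0 h; apply/integrableP; split; first exact/measurable_EFinP.
by under eq_integral do rewrite /= ger0_norm//.
Qed.

Lemma integ_lty f : integ f -> (forall x, 0 <= f x) -> (\int[mu]_x (f x)%:E < +oo)%E.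
Proof.
move=> /integrableP[_ h] f0.
by under eq_integral do rewrite -(ger0_norm (f0 _)).
Qed.

Lemma EFin_Rint f : integ f -> (\int[mu]_x (f x)%:E = (Rint f)%:E)%E.
Proof. by move=> h; rewrite /Rintegral fineK//; exact: integrable_fin_num. Qed.

Lemma Rint_le_EFin f (M : R) : (forall x, 0 <= f x) -> (\int[mu]_x (f x)%:E <= M%:E)%E -> Rint f <= M.
Proof.
move=> f0 h; rewrite -lee_fin /Rintegral fineK//.
rewrite ge0_fin_numE; first exact: le_lt_trans h (ltry _).
by apply: integral_ge0 => x _; rewrite lee_fin.
Qed.

Lemma integ_le f g : measurable_fun setT f -> integ g ->
  (forall x, `|f x| <= g x) -> integ f.
Proof.
move=> mf ig fg; apply: (@le_integrable _ _ _ mu setT measurableT _ (EFin \o g)) => //.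
  exact/measurable_EFinP.
move=> x _ /=; rewrite lee_fin; apply: (le_trans (fg x)); exact: ler_norm.
Qed.

Lemma ge0_integ_le f g : measurable_fun setT f -> integ g -> (forall x, 0 <= f x) ->
  (forall x, f x <= g x) -> integ f.
Proof. by move=> mf ig f0 fg; apply: (integ_le mf ig) => x; rewrite ger0_norm. Qed.

Lemma integD f g : integ f -> integ g -> integ (fun x => f x + g x).
Proof. by move=> hf hg; exact: (integrableD measurableT hf hg). Qed.

Lemma integB f g : integ f -> integ g -> integ (fun x => f x - g x).
Proof. by move=> hf hg; exact: (integrableB measurableT hf hg). Qed.

Lemma integZ (c : R) f : integ f -> integ (fun x => c * f x).
Proof. by move=> hf; exact: (integrableZl measurableT c hf). Qed.

Lemma integ0 : integ (fun=> 0).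
Proof. exact: integrable0. Qed.

Lemma integ_norm f : integ f -> integ (fun x => `|f x|).
Proof. by move=> hf; exact: integrable_norm. Qed.

Lemma RintD f g : integ f -> integ g -> \int[mu]_x (f x + g x) = Rint f + Rint g.
Proof. by move=> hf hg; rewrite RintegralD. Qed.

Lemma RintB f g : integ f -> integ g -> \int[mu]_x (f x - g x) = Rint f - Rint g.
Proof. by move=> hf hg; rewrite RintegralB. Qed.

Lemma RintZ (c : R) f : integ f -> \int[mu]_x (c * f x) = c * Rint f.
Proof. by move=> hf; rewrite RintegralZl. Qed.

Lemma Rint_ge0 f : (forall x, 0 <= f x) -> 0 <= Rint f.
Proof. by move=> f0; apply: Rintegral_ge0. Qed.

Lemma le_Rint f g : integ f -> integ g -> (forall x, f x <= g x) -> Rint f <= Rint g.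
Proof. by move=> hf hg fg; apply: le_Rintegral. Qed.

Lemma ge0_le_Rint f g : measurable_fun setT f -> integ g -> (forall x, 0 <= f x) ->
  (forall x, f x <= g x) -> Rint f <= Rint g.
Proof. by move=> mf ig f0 fg; apply: le_Rint => //; exact: ge0_integ_le fg. Qed.

Lemma eq_Rint f g : f =1 g -> Rint f = Rint g.
Proof. by move=> fg; apply: eq_Rintegral => x _. Qed.

Lemma Rint_cst0 : \int[mu]_x (0 : R) = 0.
Proof. by rewrite /Rintegral integral0. Qed.

Lemma Rint_dct (F : nat -> T -> R) f g : (forall n, measurable_fun setT (F n)) ->
  integ g -> (forall n x, `|F n x| <= g x) ->
  (forall x, F n x @[n --> \oo] --> f x) ->
  integ f /\ Rint (F n) @[n --> \oo] --> Rint f.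
Proof.
move=> mF ig Fg Ff.
have mf : measurable_fun setT f.
  by apply: (measurable_fun_cvg mF) => x _; exact: Ff.
have iF n : integ (F n) by exact: integ_le ig _.
have if_ : integ f.
  apply: (integ_le mf ig) => x.
  by apply: (cvgr_to_le (cvg_norm (Ff x))); apply: nearW => n; exact: Fg.
split => //.
have H : (\int[mu]_x (F n x)%:E @[n --> \oo] --> \int[mu]_x (f x)%:E)%E.
  apply: (@dominated_cvg _ _ _ mu setT measurableT (fun n => EFin \o F n) (EFin \o f) (EFin \o g)) => //.
  - by move=> n; exact/measurable_EFinP.
  - by move=> x _; apply: cvg_EFin; [exact: nearW|exact: Ff].
  - by move=> n x _; rewrite lee_fin.
by apply: fine_cvg; move: H; rewrite [X in _ --> X -> _]EFin_Rint.
Qed.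

Lemma integ_sum (I : Type) (s : seq I) (F : I -> T -> R) :
  (forall i, integ (F i)) -> integ (fun x => \sum_(i <- s) F i x).
Proof.
move=> h; elim: s => [|i s IH].
  by rewrite (_ : (fun x => _) = (fun=> 0)); [exact: integ0|apply/funext => x; rewrite big_nil].
rewrite (_ : (fun x => _) = (fun x => F i x + \sum_(j <- s) F j x)); first exact: integD.
by apply/funext => x; rewrite big_cons.
Qed.

Lemma Rint_sum (I : Type) (s : seq I) (F : I -> T -> R) :
  (forall i, integ (F i)) ->
  \int[mu]_x (\sum_(i <- s) F i x) = \sum_(i <- s) Rint (F i).
Proof.
move=> h; elim: s => [|i s IH].
  by rewrite big_nil -[RHS]Rint_cst0; apply: eq_Rint => x; rewrite big_nil.
rewrite big_cons -IH -RintD//; last exact: integ_sum.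
by apply: eq_Rint => x; rewrite big_cons.
Qed.

End RealIntegral.

(** * Limits along an ultrafilter and staircase approximation *)

Section UltraLimit.
Context {R : realType} (I : Type) (U : set_system I) {UU : UltraFilter U}.

(** Compactness of [0, M] gives a cluster point. The ultrafilter contains the preimage of a
    neighbourhood of it or the complement of that preimage, and clustering excludes the
    complement. *)
Lemma ultra_bounded_cvg (x : I -> R) (M : R) : (forall i, 0 <= x i <= M) ->
  exists l : R, x i @[i --> U] --> l.
Proof.
move=> xM.
have : [set` `[0, M]] `&` cluster (x i @[i --> U]) !=set0.
  have h : U (x @^-1` [set` `[0, M]]).
    by apply: filterS (@filterT _ U _) => i _ /=; rewrite in_itv/=.
  by apply: segment_compact; exact: h.
move=> [l [_ cl]]; exists l => A nA.
have [//|UA] := in_ultra_setVsetC (x @^-1` A) UU.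
have [y [h1 h2]] := cl (~` A) A UA nA; by [].
Qed.

End UltraLimit.

(** For e > 0 and t >= 0, the largest multiple of [e] below [t], capped at N e. It approximates a
    bounded function by a combination of indicators of the level sets k e <= t, on which the limit
    set function of the next section is known. *)
Fixpoint stair {R : realType} (N : nat) (e t : R) : R :=
  if N is N'.+1 then (if e <= t then e else 0) + stair N' e (t - e) else 0.

Lemma stair_bounds {R : realType} N (e t : R) : 0 < e -> 0 <= t <= N%:R * e ->
  stair N e t <= t <= stair N e t + e.
Proof.
move=> e0; elim: N t => [|N IH] t /=.
  by rewrite mul0r; lra.
move=> /andP[t0 t1]; case: (leP e t) => et.
  have /IH : 0 <= t - e <= N%:R * e.
    rewrite subr_ge0 et/= lerBlDr; apply: (le_trans t1); rewrite -natr1 mulrDl mul1r//.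
  lra.
have -> : stair N e (t - e) = 0.
  have : t - e < 0 by rewrite subr_lt0.
  elim: N {IH t1} (t - e) => //= N IH u u0.
  by rewrite leNgt (lt_trans u0 e0)/= add0r IH// subr_lt0 (lt_trans u0).
by rewrite !add0r t0 ltW.
Qed.

Lemma stairE {R : realType} N (e t : R) : 0 < e ->
  stair N e t = \sum_(k <- iota 1 N) e * (if k%:R * e <= t then 1 else 0).
Proof.
move=> e0; elim: N t => [|N IH] t; first by rewrite /= big_nil.
rewrite [iota 1 N.+1]/= big_cons [LHS]/= IH mul1r; congr (_ + _).
  by case: ifP; rewrite ?mulr1 ?mulr0.
rewrite -[iota 2 N]/(iota (1 + 1) N) iotaDl big_map; apply: eq_bigr => k _.
by rewrite natrD mulrDl mul1r lerBrDl.
Qed.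

(** * Weak limits along an ultrafilter *)

Section WeakLimit.
Context {R : realType} d (T : measurableType d).
Variable mu : {sigma_finite_measure set T -> \bar R}.
Variable w : T -> R.
Hypothesis mw : measurable_fun setT w.
Hypothesis w0 : forall x, 0 < w x.
Hypothesis w1 : forall x, w x <= 1.
Hypothesis iw2 : integ mu (fun x => w x ^+ 2).
Local Notation Rint f := (\int[mu]_x f x).

(** Domination by the weight means g = w u with [u] bounded, so that the integral of f g is that of
    [u] against the finite measure of density f w. *)
Definition wtest (g : T -> R) : Prop :=
  measurable_fun setT g /\ exists C : R, forall x, 0 <= g x <= C * w x.

Variables (U : set_system nat) (UU : UltraFilter U) (f : nat -> T -> R) (M1 M2 : R).
Hypothesis mf : forall n, measurable_fun setT (f n).
Hypothesis f0 : forall n x, 0 <= f n x.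
Hypothesis if1 : forall n, integ mu (f n).
Hypothesis f1 : forall n, Rint (f n) <= M1.
Hypothesis if2 : forall n, integ mu (fun x => f n x ^+ 2).
Hypothesis f2 : forall n, \int[mu]_x (f n x ^+ 2) <= M2.

Let nun n (B : set T) : R := \int[mu]_x (f n x * w x * \1_B x).

Let mfw n : measurable_fun setT (fun x => f n x * w x).
Proof. exact: measurable_funM. Qed.

Let fw0 n x : 0 <= f n x * w x. Proof. by rewrite mulr_ge0// ltW. Qed.

Let ifw n : integ mu (fun x => f n x * w x).
Proof. by apply: (ge0_integ_le _ (if1 n)) => // x; rewrite ler_piMr. Qed.

Let mB (B : set T) : measurable B -> measurable_fun setT (\1_B : T -> R).
Proof. by move=> h; exact: measurable_indic. Qed.

Let ifwB n B : measurable B -> integ mu (fun x => f n x * w x * \1_B x).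
Proof.
move=> hB; apply: (ge0_integ_le _ (ifw n)).
- by apply: measurable_funM => //; exact: mB.
- by move=> x; rewrite mulr_ge0.
- by move=> x; rewrite ler_piMr// indicE; case: (_ \in _).
Qed.

Let nun_ge0 n B : 0 <= nun n B.
Proof. by apply: Rint_ge0 => x; rewrite mulr_ge0. Qed.

Let nun_le n B : measurable B -> nun n B <= M1.
Proof.
move=> hB; apply: le_trans (f1 n); apply: le_Rint => //; first exact: ifwB.
by move=> x; rewrite -mulrA ler_piMr// mulr_ile1//; exact: ltW.
Qed.

Let lam (B : set T) : R := \int[mu]_x (w x ^+ 2 * \1_B x).

Let ilam B : measurable B -> integ mu (fun x => w x ^+ 2 * \1_B x).
Proof.
move=> hB; apply: (ge0_integ_le _ iw2).
- by apply: measurable_funM; [exact: measurable_funX|exact: mB].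
- by move=> x; rewrite mulr_ge0// sqr_ge0.
- by move=> x; rewrite ler_piMr ?sqr_ge0// indicE; case: (_ \in _).
Qed.

(** From f w <= t f^2 + w^2 / t. With [t] chosen first and then [lam B] small, the L^2 bound makes
    the set functions [nun n] absolutely continuous with respect to [lam], uniformly in n; this is
    what survives in the limit. *)
Let nun_lam n B t : 0 < t -> measurable B -> nun n B <= t * M2 + t^-1 * lam B.
Proof.
move=> t0 hB.
have M20 : 0 <= M2 by apply: le_trans (f2 n); apply: Rint_ge0 => x; exact: sqr_ge0.
apply: (@le_trans _ _ (t * \int[mu]_x (f n x ^+ 2) + t^-1 * lam B)); last first.
  by rewrite lerD2r ler_wpM2l// ltW.
rewrite -!RintZ//; last exact: ilam.
rewrite -RintD; last 2 first.
- exact: integZ.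
- by apply: integZ; exact: ilam.
apply: le_Rint; first exact: ifwB.
  by apply: integD; apply: integZ => //; exact: ilam.
move=> x; rewrite indicE; case: (_ \in _); rewrite ?mulr1 ?mulr0; last first.
  by rewrite addr0 mulr_ge0 ?sqr_ge0// ltW.
have -> : f n x * w x = (t * f n x) * w x * t^-1 by field; rewrite gt_eqF.
have -> : t * f n x ^+ 2 + t^-1 * w x ^+ 2 = ((t * f n x) ^+ 2 + w x ^+ 2) * t^-1.
  by field; rewrite gt_eqF.
rewrite ler_pM2r ?invr_gt0//.
have := sqr_ge0 (t * f n x - w x); have := sqr_ge0 (t * f n x); have := sqr_ge0 (w x); nra.
Qed.

Let nun_ex B : exists l : R, measurable B -> nun n B @[n --> U] --> l.
Proof.
have [hB|hB] := pselect (measurable B); last by exists 0.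
have [l hl] := @ultra_bounded_cvg R nat U UU (fun n => nun n B) M1
  (fun n => introT andP (conj (nun_ge0 n B) (nun_le n hB))).
by exists l.
Qed.

Let nur (B : set T) : R := if pselect (measurable B) is left _ then sval (cid (nun_ex B)) else 0.

Let nurP B : measurable B -> nun n B @[n --> U] --> nur B.
Proof. by move=> hB; rewrite /nur; case: pselect => // ?; case: cid => /= l; exact. Qed.

Let nur_ge0 B : 0 <= nur B.
Proof.
have [hB|hB] := pselect (measurable B); last by rewrite /nur; case: pselect.
by apply: (cvgr_to_ge (@nurP B hB)); apply: nearW => n; exact: nun_ge0.
Qed.

Let nur_le B : measurable B -> nur B <= M1.
Proof. by move=> hB; apply: (cvgr_to_le (nurP hB)); apply: nearW => n; exact: nun_le. Qed.

Let nur_lam B t : 0 < t -> measurable B -> nur B <= t * M2 + t^-1 * lam B.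
Proof. by move=> t0 hB; apply: (cvgr_to_le (nurP hB)); apply: nearW => n; exact: nun_lam. Qed.

Let nurU A B : measurable A -> measurable B -> A `&` B = set0 -> nur (A `|` B) = nur A + nur B.
Proof.
move=> hA hB AB; have hAB := measurableU _ _ hA hB.
apply: (cvg_unique _ (nurP hAB)); first exact: norm_hausdorff.
have E n : nun n (A `|` B) = nun n A + nun n B.
  rewrite /nun -RintD; [|exact: ifwB|exact: ifwB].
  apply: eq_Rint => x; rewrite !indicE in_setU -mulrDr; congr (_ * _).
  have [xA|xA] := boolP (x \in A); have [xB|xB] := boolP (x \in B); rewrite ?addr0 ?add0r//.
  by move: AB => /seteqP[+ _] => /(_ x); case; split; exact: set_mem.
rewrite /= (_ : (fun n => nun n (A `|` B)) = (fun n => nun n A + nun n B)); last exact/funext.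
by apply: cvgD; exact: nurP.
Qed.

Let nur0 : nur set0 = 0.
Proof.
apply: (cvg_unique _ (nurP measurable0)); first exact: norm_hausdorff.
have E n : nun n set0 = 0 by rewrite /nun -[RHS](Rint_cst0 mu); apply: eq_Rint => x; rewrite indic0 mulr0.
rewrite /= (_ : (fun n => nun n set0) = (fun=> 0)); last exact/funext.
exact: cvg_cst.
Qed.

Let V (F : nat -> set T) n := \bigcup_i F i `\` \big[setU/set0]_(i < n) F i.

Let lam_cvg0 (F : nat -> set T) : (forall i, measurable (F i)) ->
  lam (V F n) @[n --> \oo] --> 0.
Proof.
move=> hF.
have hV n : measurable (V F n).
  by apply: measurableD; [exact: bigcupT_measurable|exact: bigsetU_measurable].
have [||||] := @Rint_dct R _ T mu (fun n x => w x ^+ 2 * \1_(V F n) x) (fun=> 0) (fun x => w x ^+ 2).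
- by move=> n; apply: measurable_funM; [exact: measurable_funX|exact: mB].
- exact: iw2.
- move=> n x; rewrite ger0_norm; last by rewrite mulr_ge0// sqr_ge0.
  by rewrite ler_piMr ?sqr_ge0// indicE; case: (_ \in _).
- move=> x; have [[k _ Fkx]|nF] := pselect ((\bigcup_i F i) x).
    apply: cvg_near_cst; exists k.+1 => // n /= kn.
    rewrite indicE memNset ?mulr0// => -[_]; apply.
    by rewrite -bigcup_mkord; exists k.
  apply: cvg_near_cst; apply: nearW => n.
  by rewrite indicE memNset ?mulr0// => -[].
by move=> _; rewrite Rint_cst0.
Qed.

Definition weak_meas (B : set T) : \bar R := (nur B)%:E.

Let weak_meas0 : weak_meas set0 = 0%E. Proof. by rewrite /weak_meas nur0. Qed.

Let weak_meas_ge0 B : (0 <= weak_meas B)%E. Proof. by rewrite lee_fin. Qed.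

(** A limit of measures along an ultrafilter is in general only finitely additive. Countable
    additivity holds because [nur_lam] makes the mass of the tails [V F n] tend to 0. *)
Let weak_meas_sigma : semi_sigma_additive weak_meas.
Proof.
move=> F hF tF hUF; rewrite /weak_meas.
have hb n : measurable (\big[setU/set0]_(i < n) F i) by exact: bigsetU_measurable.
have hV n : measurable (V F n) by exact: measurableD.
have Efin n : nur (\big[setU/set0]_(i < n) F i) = \sum_(i < n) nur (F i).
  elim: n => [|n IH]; first by rewrite !big_ord0 nur0.
  rewrite !big_ord_recr/= nurU ?IH//; [exact: hb|].
  rewrite -subset0 => x [].
  rewrite -bigcup_mkord => -[i /= lin Fix] Fnx.
  by move/trivIsetP : tF => /(_ i n Logic.I Logic.I); rewrite ltn_eqF// => /(_ isT)/seteqP[+ _] => /(_ x); apply; split.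
have E n : \sum_(0 <= i < n) nur (F i) = nur (\bigcup_i F i) - nur (V F n).
  rewrite big_mkord -Efin.
  have -> : \bigcup_i F i = \big[setU/set0]_(i < n) F i `|` V F n.
    rewrite setDUK// -bigcup_mkord => x [i _ Fix]; by exists i.
  rewrite nurU ?addrK//.
  by rewrite /V -subset0 => x [] h [].
under eq_fun do rewrite sumEFin E.
apply: cvg_EFin; first exact: nearW.
rewrite -[X in _ --> X]subr0; apply: cvgB; first exact: cvg_cst.
apply/cvgrPdist_le => e e0.
have M20 : 0 <= M2 by apply: le_trans (f2 0); apply: Rint_ge0 => x; exact: sqr_ge0.
(* [t] is fixed by the L^2 term of [nur_lam]; the tail index then makes the other term small. *)
pose t := e / 2 / (M2 + 1).
have t0 : 0 < t by rewrite !divr_gt0// ltr_wpDl.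
have te : 0 < t * (e / 2) by rewrite mulr_gt0// divr_gt0.
have /cvgrPdist_le /(_ _ te) := lam_cvg0 hF.
apply: filterS => n /=; rewrite !sub0r !normrN => h.
rewrite ger0_norm//; apply: (le_trans (nur_lam t0 (hV n))).
have h1 : t^-1 * lam (V F n) <= e / 2.
  by rewrite ler_pdivrMl//; apply: le_trans h; exact: ler_norm.
have h2 : t * M2 <= e / 2.
  rewrite /t -mulrA mulrC ger_pMl ?divr_gt0// mulrC ler_pdivrMr ?mul1r; lra.
lra.
Qed.

HB.instance Definition _ := isMeasure.Build _ _ _ weak_meas
  weak_meas0 weak_meas_ge0 weak_meas_sigma.

Let weak_meas_fin : fin_num_fun weak_meas. Proof. by []. Qed.

HB.instance Definition _ := Measure_isFinite.Build _ _ _ weak_meas weak_meas_fin.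

Let weak_meas_dom : (weak_meas : {finite_measure set T -> \bar R}) `<< mu.
Proof.
apply/null_content_dominatesP => A hA A0.
have lamA : lam A = 0.
  rewrite /lam /Rintegral (ae_eq_integral (cst 0%E)) ?integral0//.
  - by apply/measurable_EFinP; apply: measurable_funM; [exact: measurable_funX|exact: mB].
  - exists A; split => // x /=; apply: contra_notP => nA _.
    by rewrite indicE memNset// mulr0.
suff h : nur A = 0 by exact: (congr1 EFin h).
apply/eqP; rewrite eq_le nur_ge0 andbT.
apply/ler_addgt0Pl => e e0; rewrite addr0.
have M20 : 0 <= M2 by apply: le_trans (f2 0); apply: Rint_ge0 => x; exact: sqr_ge0.
have t0 : 0 < e / (M2 + 1) by rewrite divr_gt0// ltr_wpDl.
apply: (le_trans (nur_lam t0 hA)); rewrite lamA mulr0 addr0.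
rewrite -mulrA ger_pMr// mulrC ler_pdivrMr ?mul1r; lra.
Qed.

(* [B |-> lim_U int_B f_n w] is a finite measure, absolutely continuous thanks to
   the L^2 bound; the limit is its Radon-Nikodym density divided by [w]. *)
Lemma weak_limit_exists : exists a : T -> R,
  [/\ measurable_fun setT a, forall x, 0 <= a x &
   forall g, wtest g -> integ mu (fun x => a x * g x) /\
     \int[mu]_x (f n x * g x) @[n --> U] --> \int[mu]_x (a x * g x)].
Proof.
have [h [h0 hfin ih hE]] := radon_nikodym_sigma_finite weak_meas_dom.
have mh : measurable_fun setT (fine \o h).
  by apply: measurableT_comp => //; exact: measurable_int ih.
have ifh : integ mu (fine \o h).
  by apply: eq_integrable ih => // x _ /=; rewrite fineK.
have fh0 x : 0 <= fine (h x) by exact: fine_ge0.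
have hB B : measurable B -> nur B = \int[mu]_x (fine (h x) * \1_B x).
  move=> hB; apply: EFin_inj; apply: (etrans (hE B hB)); rewrite -EFin_Rint; last first.
    apply: (ge0_integ_le _ ifh) => //.
    - by apply: measurable_funM => //; exact: mB.
    - by move=> x; rewrite mulr_ge0.
    - by move=> x; rewrite ler_piMr// indicE; case: (_ \in _).
  rewrite [LHS]integral_mkcond; apply: eq_integral => x _.
  by rewrite patchE indicE; case: (_ \in _); rewrite ?mulr1 ?mulr0// fineK.
pose a x := fine (h x) / w x.
have wn0 x : w x != 0 by rewrite gt_eqF.
have mwV : measurable_fun setT (fun x => (w x)^-1).
  under eq_fun do rewrite -powR_inv1 ?(ltW (w0 _))//.
  exact: (measurableT_comp (measurable_powR (-1)) mw).
exists a; split.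
- exact: measurable_funM.
- by move=> x; rewrite divr_ge0// ltW.
move=> g [mg [C0 gC]].
pose C := `|C0| + 1.
have Cp : 0 < C by rewrite ltr_wpDl.
pose u x := g x / w x.
have u0C x : 0 <= u x <= C.
  have /andP[g0 g1] := gC x; rewrite /u divr_ge0 ?(ltW (w0 x))//= ler_pdivrMr//.
  apply: (le_trans g1); rewrite ler_wpM2r ?(ltW (w0 x))//.
  by apply: (le_trans (ler_norm _)); rewrite lerDl.
have mu_ : measurable_fun setT u by exact: measurable_funM.
have Ea x : a x * g x = fine (h x) * u x by rewrite /a /u mulrAC mulrA.
have Ef n x : f n x * g x = f n x * w x * u x.
  by rewrite /u -mulrA (mulrC (w x)) divfK.
have ihu : integ mu (fun x => fine (h x) * u x).
  apply: (ge0_integ_le _ (integZ C ifh)).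
  - exact: measurable_funM.
  - by move=> x; rewrite mulr_ge0// (andP (u0C x)).1.
  - by move=> x; rewrite mulrC ler_wpM2r// (andP (u0C x)).2.
have ifu n : integ mu (fun x => f n x * w x * u x).
  apply: (ge0_integ_le _ (integZ C (ifw n))).
  - exact: measurable_funM.
  - by move=> x; rewrite mulr_ge0// (andP (u0C x)).1.
  - by move=> x; rewrite mulrC ler_wpM2r// (andP (u0C x)).2.
split; first by rewrite (_ : (fun x => _) = (fun x => fine (h x) * u x))//; exact/funext.
rewrite [X in _ --> X](eq_Rint _ Ea).
under eq_fun do rewrite (eq_Rint _ (Ef _)).
apply/cvgrPdist_le => e e0.
have M10 : 0 <= M1 by apply: le_trans (f1 0); apply: Rint_ge0.
(* step functions with N steps of height C / N *)
pose N := (Num.truncn (4 * C * (M1 + 1) / e)).+1.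
pose b := C / N%:R.
have N0 : 0 < N%:R :> R by rewrite ltr0n.
have b0 : 0 < b by rewrite divr_gt0.
have be : b * M1 <= e / 4.
  rewrite /b mulrAC ler_pdivrMr//.
  have : 4 * C * (M1 + 1) / e < N%:R by exact: truncnS_gt.
  rewrite ltr_pdivrMr// => H.
  have := mulr_ge0 (ltW Cp) M10; lra.
pose B k := [set x | k%:R * b <= u x].
have hBk k : measurable (B k).
  rewrite -[X in measurable X]setTI.
  by apply: (measurable_fun_ler (measurable_cst (k%:R * b)) mu_).
have st x : stair N b (u x) = \sum_(k <- iota 1 N) b * \1_(B k) x.
  rewrite stairE//; apply: eq_bigr => k _; rewrite indicE; congr (_ * _).
  by case: ifPn => h1; [rewrite mem_set|rewrite memNset//; apply/negP].
have stb x : stair N b (u x) <= u x <= stair N b (u x) + b.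
  apply: stair_bounds => //; have /andP[-> u1] := u0C x; rewrite /b mulrC divfK ?gt_eqF//.
(* [L k] is the integral of k u with [u] replaced by its staircase. The error is at most the step
   [b] times the mass of [k], uniformly over the densities concerned, and [L] itself passes to the
   limit term by term. *)
pose L (k : T -> R) := \sum_(i <- iota 1 N) b * \int[mu]_x (k x * \1_(B i) x).
have key (k : T -> R) : measurable_fun setT k -> (forall x, 0 <= k x) -> integ mu k ->
    Rint k <= M1 -> `|\int[mu]_x (k x * u x) - L k| <= e / 4.
  move=> mk k0 ik kM.
  have ikB i : integ mu (fun x => k x * \1_(B i) x).
    apply: (ge0_integ_le _ ik) => //.
    - by apply: measurable_funM => //; exact: mB.
    - by move=> x; rewrite mulr_ge0.
    - by move=> x; rewrite ler_piMr// indicE; case: (_ \in _).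
  have iku : integ mu (fun x => k x * u x).
    apply: (ge0_integ_le _ (integZ C ik)).
    - exact: measurable_funM.
    - by move=> x; rewrite mulr_ge0// (andP (u0C x)).1.
    - by move=> x; rewrite mulrC ler_wpM2r// (andP (u0C x)).2.
  have ikBb i : integ mu (fun x => b * (k x * \1_(B i) x)) by exact: integZ.
  have LE : L k = \int[mu]_x (k x * stair N b (u x)).
    rewrite /L; under eq_bigr do rewrite -RintZ//.
    rewrite -Rint_sum//; apply: eq_Rint => x.
    by rewrite st mulr_sumr; apply: eq_bigr => i _; rewrite mulrCA.
  have iks : integ mu (fun x => k x * stair N b (u x)).
    rewrite (_ : (fun x => _) = (fun x => \sum_(i <- iota 1 N) b * (k x * \1_(B i) x))).
      exact: integ_sum.
    apply/funext => x; by rewrite st mulr_sumr; apply: eq_bigr => i _; rewrite mulrCA.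
  rewrite LE -RintB//; rewrite ger0_norm; last first.
    by apply: Rint_ge0 => x; rewrite -mulrBr mulr_ge0// subr_ge0 (andP (stb x)).1.
  apply: le_trans be; apply: (@le_trans _ _ (b * Rint k)); last by rewrite ler_wpM2l// ltW.
  rewrite -RintZ//; apply: le_Rint; [exact: integB|exact: integZ|].
  move=> x; rewrite -mulrBr mulrC ler_wpM2r// lerBlDl.
  by have /andP[] := stb x.
have hM : Rint (fine \o h) <= M1.
  have := nur_le measurableT; rewrite hB// (_ : \int[mu]_x _ = Rint (fine \o h))//.
  by apply: eq_Rint => x; rewrite indicT mulr1.
have fM n : \int[mu]_x (f n x * w x) <= M1.
  have := nun_le n measurableT; rewrite /nun (_ : \int[mu]_x _ = \int[mu]_x (f n x * w x))//.
  by apply: eq_Rint => x; rewrite indicT mulr1.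
have Lc : L (fun x => f n x * w x) @[n --> U] --> L (fine \o h).
  rewrite /L; elim: (iota 1 N) => [|i r IH].
    by rewrite big_nil; under eq_fun do rewrite big_nil; exact: cvg_cst.
  rewrite big_cons; under eq_fun do rewrite big_cons.
  apply: cvgD => //; apply: cvgM; first exact: cvg_cst.
  by rewrite -hB//; exact: nurP.
have e2 : 0 < e / 4 by rewrite divr_gt0.
have /cvgrPdist_le /(_ _ e2) := Lc.
apply: filterS => n hn.
have k1 := key (fine \o h) mh fh0 ifh hM.
have k2 := key (fun x => f n x * w x) (mfw n) (fw0 n) (ifw n) (fM n).
rewrite (_ : _ - _ = (\int[mu]_x (fine (h x) * u x) - L (fine \o h))
  + (L (fine \o h) - L (fun x => f n x * w x)) 
  - (\int[mu]_x (f n x * w x * u x) - L (fun x => f n x * w x))); last by ring.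
apply: (le_trans (ler_normB _ _)); apply: (le_trans (lerD (ler_normD _ _) (lexx _))).
apply: (le_trans (lerD (lerD k1 hn) k2)); lra.
Qed.

End WeakLimit.

(** * The half-plane kernel *)

Section HalfKernel.
Context {R : realType}.
Variable s : R.
Hypothesis s01 : 0 < s < 1.
Implicit Types x y z : plane R.

Lemma Gamma_ge0 (a : R) : 0 <= Gamma a.
Proof. by apply: Rintegral_ge0 => t _; rewrite mulr_ge0 ?powR_ge0 ?expR_ge0. Qed.

Lemma c_ge0 : 0 <= c_ s.
Proof. by rewrite divr_ge0 ?Gamma_ge0// !mulr_ge0 ?powR_ge0 ?pi_ge0 ?Gamma_ge0. Qed.

Lemma GkerE x y : Gker s x y = c_ s * nk (2 - 2 * s) x y.
Proof. by []. Qed.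

Lemma nkC b x y : nk b x y = nk b y x.
Proof. by rewrite /nk edistC. Qed.

Lemma nk_reflect b x y : nk b x (reflect1 y) = nk b y (reflect1 x).
Proof. by rewrite /nk edist_reflect edistC. Qed.

(* On the diagonal the first term of [Gker_plus] is [c_ s / 0 = 0], which makes
   [Gker_plus] negative there. *)
Definition kk x y : R := Num.max (Gker_plus s x y) 0.

Lemma kk_ge0 x y : 0 <= kk x y.
Proof. by rewrite /kk le_max lexx orbT. Qed.

Lemma kk_le x y : kk x y <= c_ s * nk (2 - 2 * s) x y.
Proof.
rewrite /kk ge_max mulr_ge0 ?c_ge0 ?nk_ge0// andbT /Gker_plus !GkerE gerBl.
by rewrite mulr_ge0 ?c_ge0 ?nk_ge0.
Qed.

Lemma kkC x y : kk x y = kk y x.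
Proof. by rewrite /kk /Gker_plus !GkerE nkC nk_reflect. Qed.

Lemma kk_shift2 c x y : kk (shift2 c x) (shift2 c y) = kk x y.
Proof. by rewrite /kk /Gker_plus !GkerE reflect1_shift2 /nk !edist_shift2. Qed.

Lemma measurable_kk d (T : measurableType d) (f g : T -> plane R) :
  measurable_fun setT f -> measurable_fun setT g ->
  measurable_fun setT (fun t => kk (f t) (g t)).
Proof.
move=> mf mg; apply: measurable_maxr => //; apply: measurable_funB.
  by apply: measurable_funM => //; exact: measurable_nk.
apply: measurable_funM => //; apply: measurable_nk => //.
exact: measurableT_comp measurable_reflect1 mg.
Qed.

Lemma powR_lt0 (a b e : R) : 0 < a -> a < b -> 0 < e -> (b `^ e)^-1 < (a `^ e)^-1.
Proof.
move=> a0 ab e0; rewrite ltf_pV2 ?posrE ?powR_gt0//; last exact: lt_trans ab.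
by apply: gt0_ltr_powR; rewrite ?nnegrE ?(ltW a0) ?(ltW (lt_trans a0 ab)).
Qed.

Lemma kkE x y : 0 < x.1 -> 0 < y.1 -> x <> y -> kk x y = Gker_plus s x y.
Proof.
move=> x0 y0 xy; rewrite /kk max_l// /Gker_plus !GkerE -mulrBr mulr_ge0 ?c_ge0//.
rewrite subr_ge0 ltW// powR_lt0 ?edist_gt0 ?edist_lt_reflect//; have := s01; lra.
Qed.

Lemma kk_gt0 x y : 0 < c_ s -> 0 < x.1 -> 0 < y.1 -> x <> y -> 0 < kk x y.
Proof.
move=> c0 x0 y0 xy; rewrite kkE// /Gker_plus !GkerE -mulrBr mulr_gt0//.
rewrite subr_gt0 powR_lt0 ?edist_gt0 ?edist_lt_reflect//; have := s01; lra.
Qed.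

(* The image charge trades one power of the distance for the factor [x.1]; for
   s <= 1/2 that power is not integrable, but then [x.1 >= 1] on the domain. *)
Definition gam : R := if 2^-1 < s then 3 - 2 * s else 2 - 2 * s.

Lemma Dom_gt0 x : Dom s x -> 0 < x.1.
Proof. by rewrite /Dom; case: ifP => _ //=; exact: lt_le_trans. Qed.

(** (1 + t)^-e = exp(- e ln(1 + t)) >= 1 - e ln(1 + t) >= 1 - e t. *)
Lemma powR_onem_le (t e : R) : 0 <= t -> 0 <= e -> 1 - ((1 + t) `^ e)^-1 <= e * t.
Proof.
move=> t0 e0; rewrite -powRN lerBlDr -lerBlDl.
have -> : (1 + t) `^ (- e) = expR (- e * ln (1 + t)) by rewrite /powR gt_eqF// ltr_pwDl.
apply: le_trans (expR_ge1Dx _); rewrite lerD2l mulNr lerN2 ler_wpM2l//.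
by apply: le_ln1Dx; apply: lt_le_trans t0; rewrite ltrN10.
Qed.

(** For s > 1/2 the charge and its image lie at distances r and at most r + 2 x1; [powR_onem_le]
    with t = 2 x1 / r bounds the difference of the two powers by r^-(2-2s) (2-2s) 2 x1 / r, whence
    the exponent 3 - 2s. For s <= 1/2 the bound merely inserts the factor 4 x1 >= 1. *)
Lemma kk_gam x y : Dom s x -> Dom s y -> kk x y <= 4 * c_ s * x.1 * nk gam x y.
Proof.
move=> Dx Dy; have x0 := Dom_gt0 Dx; have y0 := Dom_gt0 Dy.
have c0 := c_ge0; have hs := s01.
rewrite /gam; case: ifPn => s2; last first.
  apply: (le_trans (kk_le x y)); rewrite ler_wpM2r ?nk_ge0//.
  move: Dx; rewrite /Dom (negbTE s2) /= => x1.
  rewrite mulrAC -[leLHS]mul1r ler_wpM2r//; lra.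
have [<-|xy] := eqVneq x y.
  rewrite /kk max_r; first by apply: mulr_ge0 (nk_ge0 _ _ _); apply: mulr_ge0 (ltW x0); exact: mulr_ge0.
  have e1 : 2 - 2 * s != 0 by apply/eqP; lra.
  by rewrite /Gker_plus !GkerE {1}/nk edist_xx powR0// invr0 mulr0 sub0r oppr_le0 (mulr_ge0 c0 (nk_ge0 _ _ _)).
have {}xy : x <> y by exact/eqP.
rewrite kkE// /Gker_plus !GkerE -mulrBr.
have r0 := edist_gt0 xy.
set r := edist x y in r0 *.
have e0 : 0 < 2 - 2 * s by lra.
have h1 : nk (2 - 2 * s) x y - nk (2 - 2 * s) x (reflect1 y) <=
    (r `^ (2 - 2 * s))^-1 - ((r + 2 * x.1) `^ (2 - 2 * s))^-1.
  rewrite /nk -/r lerD2l lerN2 lef_pV2 ?posrE; last 2 first.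
  - by rewrite powR_gt0// ltr_pwDl// mulr_ge0// ltW.
  - by rewrite powR_gt0// (lt_trans r0)// edist_lt_reflect.
  apply: ge0_ler_powR; rewrite ?nnegrE ?edist_ge0 ?(ltW e0)//.
    by rewrite addr_ge0 ?(ltW r0)// mulr_ge0// ltW.
  by apply: edist_reflect_le; exact: ltW.
have t0 : 0 <= 2 * x.1 / r by rewrite divr_ge0 ?(ltW r0)// mulr_ge0// ltW.
have h2 : ((r + 2 * x.1) `^ (2 - 2 * s))^-1 =
    (r `^ (2 - 2 * s))^-1 * ((1 + 2 * x.1 / r) `^ (2 - 2 * s))^-1.
  rewrite -invfM -powRM ?(ltW r0)//; last by rewrite addr_ge0.
  by rewrite mulrDr mulr1 mulrCA divff ?mulr1// gt_eqF.
have h3 : (r `^ (2 - 2 * s))^-1 - ((r + 2 * x.1) `^ (2 - 2 * s))^-1 <=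
    (r `^ (2 - 2 * s))^-1 * ((2 - 2 * s) * (2 * x.1 / r)).
  rewrite h2 -{1}[(r `^ _)^-1]mulr1 -mulrBr ler_wpM2l ?invr_ge0 ?powR_ge0//.
  by apply: powR_onem_le => //; exact: ltW.
apply: (@le_trans _ _ (c_ s * ((r `^ (2 - 2 * s))^-1 * ((2 - 2 * s) * (2 * x.1 / r))))).
  by rewrite ler_wpM2l// (le_trans h1).
have -> : nk (3 - 2 * s) x y = (r `^ (2 - 2 * s))^-1 * r^-1.
  rewrite /nk -/r -invfM; congr (_^-1).
  rewrite -{3}[r]powRr1 ?(ltW r0)// -powRD; first by congr (_ `^ _); ring.
  by apply/implyP => _; rewrite gt_eqF.
have -> : c_ s * ((r `^ (2 - 2 * s))^-1 * ((2 - 2 * s) * (2 * x.1 / r))) =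
  (4 * c_ s * x.1 * ((r `^ (2 - 2 * s))^-1 * r^-1)) * (1 - s).
  by field; rewrite !gt_eqF ?powR_gt0.
rewrite ler_piMr; [by []| |lra].
apply: mulr_ge0; first by apply: mulr_ge0 (ltW x0); exact: mulr_ge0.
by rewrite mulr_ge0 ?invr_ge0 ?powR_ge0 ?(ltW r0).
Qed.

End HalfKernel.

Lemma powR_bounded_le {R : realType} (p u M : R) : 2 <= p -> 0 <= u -> u <= M -> u `^ p <= M `^ (p - 1) * u.
Proof.
move=> p2 u0 uM; have p1 : 0 < p - 1 by rewrite subr_gt0 (lt_le_trans _ p2)// ltr1n.
have -> : u `^ p = u `^ (p - 1) * u.
  rewrite -{3}[u]powRr1//; have [->|nz] := eqVneq u 0.
    by rewrite !powR0 ?mulr0// gt_eqF// (lt_le_trans _ p2).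
  by rewrite -powRD ?nz ?implybT// subrK.
by rewrite ler_wpM2r// ge0_ler_powR ?(ltW p1)// nnegrE// (le_trans u0).
Qed.

(** * Integrability and decay of Riesz potentials *)

Section Potential.
Context {R : realType}.
Implicit Types x y z : plane R.
Local Notation mu2 := (@leb2 R).
Local Notation P := (plane R).
Local Notation Rint f := (\int[mu2]_x f x).
Variable p : R.
Hypothesis p2 : 2 <= p.
Implicit Types f g : P -> R.
Let p1 : 1 < p. Proof. by have := p2; lra. Qed.
Let p0 : 0 < p. Proof. by have := p2; lra. Qed.

(** The sign is imposed at every point; functions given almost everywhere are first replaced by a
    representative, see [version]. *)
Definition LP (f : P -> R) : Prop :=
  [/\ measurable_fun setT f, forall x, 0 <= f x, integ mu2 f & integ mu2 (fun x => f x `^ p)].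

Lemma LP_le f g : measurable_fun setT f -> LP g -> (forall x, 0 <= f x <= g x) -> LP f.
Proof.
move=> mf [mg g0 ig igp] fg.
have f0 x : 0 <= f x by case/andP : (fg x).
have fg' x : f x <= g x by case/andP : (fg x).
split => //; first exact: ge0_integ_le fg'.
apply: (ge0_integ_le _ igp).
- exact: (measurableT_comp (measurable_powR p)).
- by move=> x; exact: powR_ge0.
- by move=> x; apply: ge0_ler_powR; rewrite ?nnegrE ?(ltW p0).
Qed.

Lemma powRD_le (a b : R) : 0 <= a -> 0 <= b -> (a + b) `^ p <= 2 `^ p * (a `^ p + b `^ p).
Proof.
move=> a0 b0; wlog ab : a b a0 b0 / a <= b.
  move=> H; have [ab|/ltW ba] := leP a b; first exact: H.
  by rewrite addrC (addrC (a `^ p)); exact: H.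
apply: (@le_trans _ _ ((2 * b) `^ p)).
  apply: ge0_ler_powR; rewrite ?nnegrE ?(ltW p0) ?addr_ge0 ?mulr_ge0//; lra.
by rewrite powRM// ler_wpM2l ?powR_ge0// lerDr powR_ge0.
Qed.

Lemma LPD f g : LP f -> LP g -> LP (fun x => f x + g x).
Proof.
move=> [mf f0 if_ ifp] [mg g0 ig igp]; split.
- exact: measurable_funD.
- by move=> x; rewrite addr_ge0.
- exact: integD.
- apply: (ge0_integ_le _ (integZ (2 `^ p) (integD ifp igp))).
  + by apply: (measurableT_comp (measurable_powR p)); exact: measurable_funD.
  + by move=> x; exact: powR_ge0.
  + by move=> x; exact: powRD_le.
Qed.

Lemma integ_shift2 c f : measurable_fun setT f -> (forall x, 0 <= f x) -> integ mu2 f ->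
  integ mu2 (f \o shift2 c) /\ Rint (f \o shift2 c) = Rint f.
Proof.
move=> mf f0 if_.
have E : (\int[mu2]_x (f (shift2 c x))%:E = \int[mu2]_x (f x)%:E)%E.
  by apply: (@ge0_integral_shift2 _ c (EFin \o f)) => //; exact/measurable_EFinP.
split; last by rewrite /Rintegral E.
apply: ge0_integ => //.
- by apply: measurableT_comp => //; exact: measurable_shift2.
- by move=> x /=.
- by rewrite [X in (X < _)%E]E integ_lty.
Qed.

Lemma LP_shift2 c f : LP f -> LP (f \o shift2 c).
Proof.
move=> [mf f0 if_ ifp]; split.
- by apply: measurableT_comp => //; exact: measurable_shift2.
- by move=> x /=.
- exact: (integ_shift2 c mf f0 if_).1.
- have mfp : measurable_fun setT (fun x => f x `^ p).
    exact: (measurableT_comp (measurable_powR p)).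
  exact: (integ_shift2 c mfp (fun x => powR_ge0 _ _) ifp).1.
Qed.

Section Riesz.
Variable b : R.
Hypothesis b0 : 0 < b.
Hypothesis bp : b * (p / (p - 1)) < 2.
Let q := p / (p - 1).

Let mnk x : measurable_fun setT (nk b x).
Proof. by apply: measurable_nk => //; exact: measurable_id. Qed.

Let mnkc r x : measurable_fun setT (nkc b r x).
Proof. by apply: measurable_nkc => //; exact: measurable_id. Qed.

Definition ballp (r : R) x (f : P -> R) y : R := (if edist x y < r then f y else 0) `^ p.

Lemma integ_ballp r x f : LP f -> integ mu2 (ballp r x f).
Proof.
move=> [mf f0 _ ifp]; apply: (ge0_integ_le _ ifp).
- apply: (measurableT_comp (measurable_powR p)); apply: measurable_fun_if => //.
    by apply: measurable_fun_ltr => //; apply: measurable_edist => //; exact: measurable_id.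
  exact: measurable_funTS.
- by move=> y; exact: powR_ge0.
- move=> y; rewrite /ballp; case: ifP => // _.
  by rewrite powR0 ?powR_ge0// gt_eqF.
Qed.

Lemma ballp_le r x f y : (forall x, 0 <= f x) -> ballp r x f y <= f y `^ p.
Proof. by move=> f0; rewrite /ballp; case: ifP => // _; rewrite powR0 ?powR_ge0// gt_eqF. Qed.

Lemma nkc_young r l x f : 0 < r -> 0 < l -> LP f ->
  integ mu2 (fun y => nkc b r x y * f y) /\
  \int[mu2]_y (nkc b r x y * f y) <= l `^ (- q) * Kc (b * q) r + l `^ p * Rint (ballp r x f).
Proof.
move=> r0 l0 Lf; have ib := integ_ballp r x Lf; have [mf f0 if_ ifp] := Lf.
have := integral_nkc_young x b0 p1 bp r0 l0 mf f0.
rewrite -/(ballp r x f) (EFin_Rint ib) -EFinM -EFinD => H.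
have n0 y : 0 <= nkc b r x y * f y by rewrite mulr_ge0// nkc_ge0.
split; last exact: Rint_le_EFin.
by apply: ge0_integ => //; [exact: measurable_funM|exact: le_lt_trans H (ltry _)].
Qed.

Lemma nk_split r x y : 0 < r -> nk b x y <= nkc b r x y + r `^ (- b).
Proof.
move=> r0; rewrite /nkc; case: ltP => h; first by rewrite lerDl powR_ge0.
rewrite add0r powRN lef_pV2 ?posrE ?powR_gt0//; last exact: lt_le_trans h.
by apply: ge0_ler_powR => //; rewrite ?nnegrE ?edist_ge0 ?(ltW b0) ?(ltW r0).
Qed.

Lemma nk_young r l x f : 0 < r -> 0 < l -> LP f ->
  integ mu2 (fun y => nk b x y * f y) /\
  \int[mu2]_y (nk b x y * f y) <=
    l `^ (- q) * Kc (b * q) r + l `^ p * Rint (ballp r x f) + r `^ (- b) * Rint f.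
Proof.
move=> r0 l0 Lf; have [ic hc] := nkc_young x r0 l0 Lf; have [mf f0 if_ ifp] := Lf.
have ir := integZ (r `^ (- b)) if_.
have i2 := integD ic ir.
have le2 y : nk b x y * f y <= nkc b r x y * f y + r `^ (- b) * f y.
  by rewrite -mulrDl ler_wpM2r// nk_split.
have i1 : integ mu2 (fun y => nk b x y * f y).
  by apply: (ge0_integ_le _ i2) => //; [exact: measurable_funM|move=> y; rewrite mulr_ge0 ?nk_ge0].
split => //; apply: (le_trans (le_Rint i1 i2 le2)).
by rewrite RintD// RintZ// lerD2r.
Qed.

(** In the Young estimate [l] is fixed by the L^p bound and [r] afterwards, through [Kc] -> 0. The
    radius depends on the bound [M] only, so the singular part of the kernel is negligible uniformly
    in [f] and in the point [x]. *)
Lemma nkc_small M e : 0 < e -> exists2 r, 0 < r &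
  forall f x, LP f -> Rint (fun y => f y `^ p) <= M -> \int[mu2]_y (nkc b r x y * f y) <= e.
Proof.
move=> e0; pose M' := `|M| + 1.
have M'0 : 0 < M' by rewrite ltr_wpDl.
pose l := (e / 2 / M') `^ (p^-1).
have em : 0 < e / 2 / M' by rewrite !divr_gt0.
have l0 : 0 < l by exact: powR_gt0.
have lp : l `^ p = e / 2 / M' by rewrite /l -powRrM mulVf ?gt_eqF// powRr1// ltW.
have lq0 : 0 < l `^ (- q) by exact: powR_gt0.
have bq : 0 < b * q < 2.
  by rewrite bp andbT mulr_gt0// divr_gt0// subr_gt0.
have e1 : 0 < e / 2 / l `^ (- q) by rewrite !divr_gt0.
have [r r0 hr] := Kc_cvg0 bq e1.
exists r => // f x Lf fM.
have [_ h] := nkc_young x r0 l0 Lf; apply: (le_trans h).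
have h1 : l `^ (- q) * Kc (b * q) r <= e / 2.
  by rewrite mulrC -ler_pdivlMr.
have [mf f0 if_ ifp] := Lf.
have h2 : Rint (ballp r x f) <= M'.
  apply: (@le_trans _ _ M); last by apply: (le_trans (ler_norm _)); rewrite lerDl.
  apply: le_trans fM; apply: le_Rint => //; first exact: integ_ballp.
  by move=> y; exact: ballp_le.
have h3 : l `^ p * Rint (ballp r x f) <= e / 2.
  by rewrite lp mulrAC ler_pdivrMr// ler_wpM2l// ltW// divr_gt0.
by apply: (le_trans (lerD h1 h3)); rewrite -splitr.
Qed.

Lemma integ_tail f e : (forall x, 0 <= f x) -> integ mu2 f -> 0 < e ->
  exists B, 0 < B /\ \int[mu2]_y (if B < `|y.1| + `|y.2| then f y else 0) <= e.
Proof.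
move=> f0 if_ e0; have mf := integ_meas if_.
have [||||_ H] := @Rint_dct R _ _ mu2 (fun n y => if n.+1%:R < `|y.1| + `|y.2| then f y else 0) (fun=> 0) f.
- move=> n; apply: measurable_fun_if => //; last exact: measurable_funTS.
  apply: measurable_fun_ltr => //; apply: measurable_funD.
    by apply: measurableT_comp => //; exact: measurable_fst.
  by apply: measurableT_comp => //; exact: measurable_snd.
- by [].
- by move=> n x; case: ifP => _; rewrite ?normr0// ger0_norm.
- move=> x; apply: cvg_near_cst; exists (Num.truncn (`|x.1| + `|x.2|)) => // n /= hn.
  rewrite ifF//; apply/negP/negP; rewrite -leNgt.
  by apply: (le_trans (ltW (truncnS_gt _))); rewrite ler_nat ltnS.
move: H; rewrite Rint_cst0 => /cvgrPdist_le /(_ e e0) [n _ /(_ n (leqnn n))] /=.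
rewrite sub0r normrN => h; exists n.+1%:R; split => //.
by apply: le_trans h; exact: ler_norm.
Qed.

(** The three terms of [nk_young] are made small in turn: a large [r] for the L^1 term, then a large
    [l] for the [Kc] term at this [r], and finally [x] so far away that its ball of radius [r] meets
    only a tail of f^p, small enough to absorb l^p. *)
Lemma nk_decay f e : LP f -> 0 < e -> exists2 B, 0 < B &
  forall x, B < `|x.1| + `|x.2| -> \int[mu2]_y (nk b x y * f y) <= e.
Proof.
move=> Lf e0; have [mf f0 if_ ifp] := Lf.
have M0 : 0 <= Rint f by exact: Rint_ge0.
have e3 : 0 < e / 3 by rewrite divr_gt0.
have em : 0 < (Rint f + 1) / (e / 3) by rewrite divr_gt0// ltr_wpDl.
pose r := ((Rint f + 1) / (e / 3)) `^ (b^-1).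
have r0 : 0 < r by exact: powR_gt0.
have hr : r `^ (- b) * Rint f <= e / 3.
  rewrite powRN /r -powRrM mulVf ?gt_eqF// powRr1 ?(ltW em)// invf_div.
  by rewrite mulrAC ler_pdivrMr ?ltr_wpDl// ler_wpM2l ?(ltW e3)// lerDl.
have q0 : 0 < q by rewrite divr_gt0// subr_gt0.
pose K := Kc (b * q) r + 1.
have K0 : 0 < K by rewrite ltr_wpDl// Kc_ge0.
pose l := (K / (e / 3)) `^ (q^-1).
have l0 : 0 < l by rewrite powR_gt0// divr_gt0.
have Ke : 0 <= K / (e / 3) by rewrite divr_ge0// ltW.
have hl : l `^ (- q) * Kc (b * q) r <= e / 3.
  rewrite powRN /l -powRrM mulVf ?gt_eqF// powRr1// invf_div.
  by rewrite mulrAC ler_pdivrMr// ler_wpM2l ?(ltW e3)// lerDl.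
have ep : 0 < e / 3 / l `^ p by rewrite divr_gt0// powR_gt0.
have [B [B0 hB]] := integ_tail (fun x => powR_ge0 (f x) p) ifp ep.
(* A point within [r] of [x] has each coordinate within [r] of that of [x], so that its l^1 norm
   still exceeds [B]. *)
exists (B + 2 * r); first by rewrite addr_gt0// mulr_gt0.
move=> x xB.
have [_ h] := nk_young x r0 l0 Lf; apply: (le_trans h).
have : l `^ p * Rint (ballp r x f) <= e / 3.
  rewrite mulrC -ler_pdivlMr; last exact: powR_gt0.
  apply: (le_trans _ hB).
  apply: le_Rint; first exact: integ_ballp.
    apply: (ge0_integ_le _ ifp).
    + apply: measurable_fun_if => //; last by apply: measurable_funTS; exact: integ_meas ifp.
      apply: measurable_fun_ltr => //; apply: measurable_funD.
        by apply: measurableT_comp => //; exact: measurable_fst.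
      by apply: measurableT_comp => //; exact: measurable_snd.
    + by move=> y; case: ifP => // _; exact: powR_ge0.
    + by move=> y; case: ifP => // _; exact: powR_ge0.
  move=> y; rewrite /ballp; case: ltP => xy; last first.
    by rewrite powR0 ?gt_eqF//; case: ifP => // _; exact: powR_ge0.
  rewrite ifT//.
  have n1 := norm1_le_eucl (x.1 - y.1, x.2 - y.2).
  have n2 := norm2_le_eucl (x.1 - y.1, x.2 - y.2).
  rewrite -/(edist x y) /= in n1 n2.
  have t1 : `|x.1| <= `|x.1 - y.1| + `|y.1| by rewrite -{1}(subrK y.1 x.1) ler_normD.
  have t2 : `|x.2| <= `|x.2 - y.2| + `|y.2| by rewrite -{1}(subrK y.2 x.2) ler_normD.
  by clear -xB xy n1 n2 t1 t2; lra.
move=> h4; have -> : e = e / 3 + e / 3 + e / 3 by field.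
by apply: lerD => //; exact: lerD.
Qed.

End Riesz.

End Potential.

(** * Null functions and strict positivity of integrals *)

Section AeZero.
Context {R : realType} d (T : measurableType d) (mu : {measure set T -> \bar R}).
Implicit Types f g : T -> R.

Lemma Rint_eq0_ae f : integ mu f -> (forall x, 0 <= f x) -> \int[mu]_x f x = 0 ->
  {ae mu, forall x, f x = 0}.
Proof.
move=> if_ f0 h.
have h0 : (\int[mu]_(x in setT) `|(EFin \o f) x| = 0)%E.
  under eq_integral do rewrite /= ger0_norm//.
  by rewrite EFin_Rint// h.
have mf : measurable_fun setT (EFin \o f) by apply/measurable_EFinP; exact: integ_meas if_.
have /(ae_eq_integral_abs mu measurableT mf) := h0.
by apply: filterS => x /(_ Logic.I) [].
Qed.

Lemma ae0_Rint f : {ae mu, forall x, f x = 0} -> measurable_fun setT f -> \int[mu]_x f x = 0.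
Proof.
move=> f0 mf; rewrite /Rintegral (ae_eq_integral (cst 0%E)) ?integral0//.
  exact/measurable_EFinP.
by apply: filterS f0 => x /= -> _.
Qed.

Lemma eq_ae_Rint f g : measurable_fun setT f -> measurable_fun setT g ->
  {ae mu, forall x, f x = g x} -> \int[mu]_x f x = \int[mu]_x g x.
Proof.
move=> mf mg fg; rewrite /Rintegral (ae_eq_integral (EFin \o g))//.
- exact/measurable_EFinP.
- exact/measurable_EFinP.
by apply: filterS fg => x /= -> _.
Qed.

Lemma Rint_gt0 f : integ mu f -> (forall x, 0 <= f x) -> ~ {ae mu, forall x, f x = 0} ->
  0 < \int[mu]_x f x.
Proof.
move=> if_ f0 nf; rewrite lt_def Rint_ge0// andbT; apply/eqP => h.
by apply: nf; exact: Rint_eq0_ae.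
Qed.

Lemma Rint_mul_gt0 k f : integ mu (fun x => k x * f x) -> (forall x, 0 <= k x) ->
  (forall x, 0 <= f x) -> measurable_fun setT f ->
  {ae mu, forall x, f x != 0 -> 0 < k x} -> 0 < \int[mu]_x f x ->
  0 < \int[mu]_x (k x * f x).
Proof.
move=> ikf k0 f0 mf kf ff; apply: Rint_gt0 => //; first by move=> x; rewrite mulr_ge0.
move=> h; have : \int[mu]_x f x = 0.
  apply: ae0_Rint => //; apply: filterS2 h kf => x.
  move=> /eqP; rewrite mulf_eq0 => /orP[/eqP h1|/eqP//] h2.
  by apply/eqP; apply/negP => /negP /h2; rewrite h1 ltxx.
by move=> h1; rewrite h1 ltxx in ff.
Qed.

End AeZero.

(** * Sigma-finiteness of the plane measure *)

Section SigmaFinite.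
Context {R : realType}.
Local Notation leb := (@lebesgue_measure R).
Lemma leb2_sigma_finite : sigma_finite setT (@leb2 R).
Proof.
pose I (n : nat) : set (measurableTypeR R) := `]-(n%:R), n%:R[%classic.
have mI n : measurable (I n) by rewrite /I.
have inI (a : R) : exists n, forall m, (n <= m)%N -> I m a.
  exists (Num.truncn `|a|).+1 => m nm; rewrite /I /= in_itv/= -ltr_norml.
  by apply: (lt_le_trans (truncnS_gt _)); rewrite ler_nat.
exists (fun n => I n `*` I n).
  apply/seteqP; split => // -[a b] _.
  have [n hn] := inI a; have [m hm] := inI b.
  by exists (maxn n m) => //; split; [apply: hn|apply: hm]; rewrite ?leq_maxl ?leq_maxr.
move=> n; split; first exact: measurableX.
have fin : (leb (I n) < +oo)%E.
  have -> : leb (I n) = (if - n%:R < n%:R :> R then (n%:R - - n%:R)%:E else 0%E).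
    exact: (etrans (lebesgue_measure_itv _)).
  by case: ifP => _; rewrite ltry.
have : ((leb \x leb)%E (I n `*` I n) < +oo)%E.
  by rewrite (@product_measure1E _ _ _ _ _ leb leb)// lte_mul_pinfty// ge0_fin_numE.
by [].
Qed.

(** A renamed copy of [leb2] to carry the sigma-finite structure. Through [leb2s], Tonelli on pairs
    of points, [Phi] and the weak limits all refer to this measure. *)
Definition leb2f : set (measurableTypeR R * measurableTypeR R)%type -> \bar R := leb2.
HB.instance Definition _ := Measure.copy leb2f leb2.
HB.instance Definition _ := Measure_isSigmaFinite.Build _ _ _ leb2f leb2_sigma_finite.
Definition leb2s : {sigma_finite_measure set (measurableTypeR R * measurableTypeR R)%type -> \bar R} := leb2f.
Lemma leb2_exchange (K : plane R * plane R -> \bar R) :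
  measurable_fun setT K -> (forall x, 0 <= K x)%E ->
  (\int[leb2]_x \int[leb2]_y K (x, y) = \int[leb2]_y \int[leb2]_x K (x, y))%E.
Proof. by move=> mK K0; exact: (@fubini_tonelli _ _ _ _ R leb2s leb2s K mK K0). Qed.

Lemma measurable_leb2_integral (K : plane R * plane R -> \bar R) :
  measurable_fun setT K -> (forall x, 0 <= K x)%E ->
  measurable_fun setT (fun x => \int[leb2]_y K (x, y))%E.
Proof.
by move=> mK K0; exact: (@measurable_fun_fubini_tonelli_F _ _ _ _ R leb2s K mK K0).
Qed.

End SigmaFinite.

(** * Potential and interaction energy *)

Section Energy.
Context {R : realType}.
Implicit Types x y z : plane R.
Local Notation mu2 := (@leb2 R).
Local Notation P := (plane R).
Local Notation Rint f := (\int[mu2]_x f x).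
Variables s p : R.
Hypothesis s01 : 0 < s < 1.
Hypothesis p2 : 2 <= p.
Hypothesis gp : gam s * (p / (p - 1)) < 2.
Implicit Types f g h : P -> R.
Local Notation LP := (@LP R p).
Local Notation kk := (kk s).
Let e := 2 - 2 * s.

Let e0 : 0 < e. Proof. by rewrite /e; have := s01; lra. Qed.

Let gam_ge : e <= gam s.
Proof. by rewrite /gam /e; case: ifP => // _; rewrite lerD2r ler_nat. Qed.

Let gam0 : 0 < gam s. Proof. exact: lt_le_trans gam_ge. Qed.

Let q0 : 0 < p / (p - 1).
Proof. by have := p2 => h; rewrite divr_gt0 ?subr_gt0 ?(lt_le_trans _ h)// ?ltr1n ?ltr0n. Qed.

Let ep : e * (p / (p - 1)) < 2.
Proof. by apply: le_lt_trans gp; rewrite ler_wpM2r// ltW. Qed.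

Let c0 : 0 <= c_ s. Proof. exact: c_ge0. Qed.

Lemma LP_ge0 f x : LP f -> 0 <= f x. Proof. by case. Qed.
Lemma LP_meas f : LP f -> measurable_fun setT f. Proof. by case. Qed.
Lemma LP_integ f : LP f -> integ mu2 f. Proof. by case. Qed.
Lemma LP_integp f : LP f -> integ mu2 (fun x => f x `^ p). Proof. by case. Qed.

Lemma measurable_kk1 x : measurable_fun setT (kk x).
Proof. by apply: measurable_kk => //; exact: measurable_id. Qed.

Definition pot f x : R := \int[mu2]_y (kk x y * f y).

Lemma integ_nk f x : LP f -> integ mu2 (fun y => nk e x y * f y).
Proof. by move=> Lf; exact: (nk_young p2 e0 ep x ltr01 ltr01 Lf).1. Qed.

Lemma kk_mul_le f x y : LP f -> kk x y * f y <= c_ s * (nk e x y * f y).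
Proof. by move=> Lf; rewrite mulrA ler_wpM2r ?(LP_ge0 _ Lf)// kk_le. Qed.

Lemma integ_kk f x : LP f -> integ mu2 (fun y => kk x y * f y).
Proof.
move=> Lf; apply: (ge0_integ_le _ (integZ (c_ s) (integ_nk x Lf))).
- by apply: measurable_funM; [exact: measurable_kk1|exact: LP_meas].
- by move=> y; rewrite mulr_ge0 ?kk_ge0 ?(LP_ge0 _ Lf).
- by move=> y; exact: kk_mul_le.
Qed.

Lemma pot_ge0 f x : LP f -> 0 <= pot f x.
Proof. by move=> Lf; apply: Rint_ge0 => y; rewrite mulr_ge0 ?kk_ge0 ?(LP_ge0 _ Lf). Qed.

Lemma pot_le_nk f x : LP f -> pot f x <= c_ s * \int[mu2]_y (nk e x y * f y).
Proof.
move=> Lf; rewrite -RintZ; last exact: integ_nk.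
apply: le_Rint; [exact: integ_kk|by apply: integZ; exact: integ_nk|].
by move=> y; exact: kk_mul_le.
Qed.

(** [nk_young] with r = l = 1; the bound depends on the L^1 and L^p bounds only and is uniform in
    the point. *)
Lemma pot_ub M1 Mp : exists2 C, 0 < C & forall f x, LP f -> Rint f <= M1 ->
  Rint (fun y => f y `^ p) <= Mp -> pot f x <= C.
Proof.
exists (c_ s * (Kc (e * (p / (p - 1))) 1 + `|Mp| + `|M1|) + 1).
  by rewrite ltr_wpDl// mulr_ge0// !addr_ge0// Kc_ge0.
move=> f x Lf fM fMp; apply: (le_trans (pot_le_nk x Lf)).
rewrite ler_wpDr// ler_wpM2l//.
have [_] := nk_young p2 e0 ep x ltr01 ltr01 Lf.
rewrite !powR1 !mul1r => h; apply: (le_trans h).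
apply: lerD; last by apply: (le_trans fM); exact: ler_norm.
rewrite lerD2l; apply: (@le_trans _ _ Mp); last exact: ler_norm.
apply: le_trans fMp; apply: le_Rint; [exact: integ_ballp|exact: LP_integp|].
by move=> y; apply: ballp_le => // z; exact: LP_ge0 Lf.
Qed.

Lemma measurable_pot f : LP f -> measurable_fun setT (pot f).
Proof.
move=> Lf; rewrite /pot /Rintegral.
apply: (measurableT_comp (@fine_measurable R setT measurableT)).
pose K (v : P * P) : \bar R := (kk v.1 v.2 * f v.2)%:E.
have K0 v : (0 <= K v)%E by rewrite lee_fin mulr_ge0 ?kk_ge0 ?(LP_ge0 _ Lf).
have mK : measurable_fun setT K.
  apply/measurable_EFinP; apply: measurable_funM.
    exact: measurable_kk.
  exact: measurableT_comp (LP_meas Lf) measurable_snd.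
exact: measurable_leb2_integral mK K0.
Qed.

Lemma potD f g x : LP f -> LP g -> pot (fun y => f y + g y) x = pot f x + pot g x.
Proof.
move=> Lf Lg; rewrite /pot -RintD; [|exact: integ_kk|exact: integ_kk].
by apply: eq_Rint => y; rewrite mulrDr.
Qed.

Lemma le_pot f g x : LP f -> LP g -> (forall y, f y <= g y) -> pot f x <= pot g x.
Proof.
move=> Lf Lg fg; apply: le_Rint; [exact: integ_kk|exact: integ_kk|].
by move=> y; rewrite ler_wpM2l ?kk_ge0.
Qed.

Lemma pot_shift2 c f x : LP f -> pot (f \o shift2 c) x = pot f (shift2 c x).
Proof.
move=> Lf; rewrite /pot.
have i1 := integ_kk (shift2 c x) Lf.
have [_ <-] := integ_shift2 c (integ_meas i1) (fun y => mulr_ge0 (kk_ge0 s _ _) (LP_ge0 _ Lf)) i1.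
by apply: eq_Rint => y; rewrite /= kk_shift2.
Qed.

(** The exponent [gam] is used instead of 2 - 2s because it brings out the factor x1. The potential
    can then be compared with W x1, and the set where it dominates W x1 is bounded. *)
Lemma pot_decay f eps : LP f -> (forall x, ~ Dom s x -> f x = 0) -> 0 < eps ->
  exists2 B, 0 < B & forall x, Dom s x -> B < `|x.1| + `|x.2| -> pot f x <= eps * x.1.
Proof.
move=> Lf fD eps0.
have d0 : 0 < eps / (4 * c_ s + 1) by rewrite divr_gt0// ltr_wpDl// mulr_ge0.
have [B B0 hB] := nk_decay p2 gam0 gp Lf d0.
exists B => // x Dx Bx.
have x0 := Dom_gt0 Dx.
have ing : integ mu2 (fun y => nk (gam s) x y * f y) by exact: (nk_young p2 gam0 gp x ltr01 ltr01 Lf).1.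
have h : pot f x <= (4 * c_ s * x.1) * \int[mu2]_y (nk (gam s) x y * f y).
  rewrite -RintZ//; apply: le_Rint; [exact: integ_kk|exact: integZ|].
  move=> y; have [Dy|nDy] := pselect (Dom s y); last by rewrite fD// !mulr0.
  by rewrite mulrA ler_wpM2r ?(LP_ge0 _ Lf)// kk_gam.
apply: (le_trans h); have h2 := hB x Bx.
have h3 : 0 <= 4 * c_ s * x.1 by apply: mulr_ge0 (ltW x0); exact: mulr_ge0.
apply: (le_trans (ler_wpM2l h3 h2)).
rewrite mulrAC ler_wpM2r ?(ltW x0)// mulrCA ger_pMr// ler_pdivrMr ?mul1r ?lerDl//.
by rewrite ltr_wpDl// mulr_ge0.
Qed.

Lemma ae_neq x : {ae mu2, forall y, x <> y}.
Proof. by have := ae_off_axes x; apply: filterS => y [h _] xy; move: h; rewrite xy subrr eqxx. Qed.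

Lemma pot_gt0 f x : 0 < c_ s -> LP f -> (forall y, ~ Dom s y -> f y = 0) -> 0 < Rint f ->
  Dom s x -> 0 < pot f x.
Proof.
move=> cs0 Lf fD f0 Dx; apply: Rint_mul_gt0 => //.
- exact: integ_kk.
- by move=> y; exact: kk_ge0.
- by move=> y; exact: LP_ge0.
- exact: LP_meas.
- have := ae_neq x; apply: filterS => y xy fy.
  apply: kk_gt0 => //; first exact: Dom_gt0 Dx.
  by apply: (@Dom_gt0 _ s); apply: contrapT => /fD/eqP; rewrite (negbTE fy).
Qed.

(** The symmetric bilinear form of the energy: E is [ben f f / 2], and [ben f g] is the interaction
    of two pieces. *)
Definition ben f g : R := \int[mu2]_x (f x * pot g x).

Lemma pot_bounded g : LP g -> exists2 C, 0 < C & forall x, pot g x <= C.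
Proof.
move=> Lg; have [C C0 hC] := pot_ub (Rint g) (Rint (fun y => g y `^ p)).
by exists C => // x; exact: hC.
Qed.

Lemma integ_ben f g : LP f -> LP g -> integ mu2 (fun x => f x * pot g x).
Proof.
move=> Lf Lg; have [C C0 hC] := pot_bounded Lg.
apply: (ge0_integ_le _ (integZ C (LP_integ Lf))).
- by apply: measurable_funM; [exact: LP_meas|exact: measurable_pot].
- by move=> x; rewrite mulr_ge0 ?pot_ge0 ?(LP_ge0 _ Lf).
- by move=> x; rewrite mulrC ler_wpM2r ?(LP_ge0 _ Lf).
Qed.

Lemma ben_ge0 f g : LP f -> LP g -> 0 <= ben f g.
Proof. by move=> Lf Lg; apply: Rint_ge0 => x; rewrite mulr_ge0 ?pot_ge0 ?(LP_ge0 _ Lf). Qed.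

Lemma ben_le_ub f g C : LP f -> LP g -> (forall x, pot g x <= C) -> ben f g <= C * Rint f.
Proof.
move=> Lf Lg hC; rewrite -RintZ; last exact: LP_integ.
apply: le_Rint; [exact: integ_ben|by apply: integZ; exact: LP_integ|].
by move=> x; rewrite mulrC ler_wpM2r ?(LP_ge0 _ Lf).
Qed.

Lemma ben_EFin f g : LP f -> LP g ->
  ((ben f g)%:E = \int[mu2]_x \int[mu2]_y (f x * (kk x y * g y))%:E)%E.
Proof.
move=> Lf Lg; rewrite /ben -EFin_Rint; last exact: integ_ben.
apply: eq_integral => x _; rewrite EFinM /pot -EFin_Rint; last exact: integ_kk.
rewrite -ge0_integralZl//.
- apply/measurable_EFinP; apply: measurable_funM; [exact: measurable_kk1|exact: LP_meas].
- by move=> y _; rewrite lee_fin mulr_ge0 ?kk_ge0 ?(LP_ge0 _ Lg).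
- by rewrite lee_fin (LP_ge0 _ Lf).
Qed.

Lemma benC f g : LP f -> LP g -> ben f g = ben g f.
Proof.
move=> Lf Lg; apply: EFin_inj; rewrite (ben_EFin Lf Lg) (ben_EFin Lg Lf).
pose K (v : P * P) : \bar R := (f v.1 * (kk v.1 v.2 * g v.2))%:E.
have K0 v : (0 <= K v)%E by rewrite lee_fin !mulr_ge0 ?kk_ge0 ?(LP_ge0 _ Lf) ?(LP_ge0 _ Lg).
have mK : measurable_fun setT K.
  apply/measurable_EFinP; apply: measurable_funM.
    exact: measurableT_comp (LP_meas Lf) measurable_fst.
  apply: measurable_funM.
    exact: measurable_kk.
  exact: measurableT_comp (LP_meas Lg) measurable_snd.
apply: (etrans (leb2_exchange mK K0)).
apply: eq_integral => y _; apply: eq_integral => x _.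
by rewrite /K/= kkC; congr (_%:E); ring.
Qed.

Lemma benDl f g h : LP f -> LP g -> LP h ->
  ben (fun x => f x + g x) h = ben f h + ben g h.
Proof.
move=> Lf Lg Lh; rewrite /ben -RintD; [|exact: integ_ben|exact: integ_ben].
by apply: eq_Rint => x; rewrite mulrDl.
Qed.

Lemma benDr f g h : LP f -> LP g -> LP h ->
  ben h (fun x => f x + g x) = ben h f + ben h g.
Proof.
move=> Lf Lg Lh; rewrite /ben -RintD; [|exact: integ_ben|exact: integ_ben].
by apply: eq_Rint => x; rewrite potD// mulrDr.
Qed.

Lemma le_ben f f' g g' : LP f -> LP f' -> LP g -> LP g' ->
  (forall x, f x <= f' x) -> (forall x, g x <= g' x) -> ben f g <= ben f' g'.
Proof.
move=> Lf Lf' Lg Lg' ff gg; apply: le_Rint; [exact: integ_ben|exact: integ_ben|].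
by move=> x; apply: ler_pM; rewrite ?pot_ge0 ?(LP_ge0 _ Lf)//; exact: le_pot.
Qed.

Lemma ben_shift2 c f g : LP f -> LP g -> ben (f \o shift2 c) (g \o shift2 c) = ben f g.
Proof.
move=> Lf Lg; rewrite /ben.
have i1 := integ_ben Lf Lg.
have [_ <-] := integ_shift2 c (integ_meas i1) (fun y => mulr_ge0 (LP_ge0 _ Lf) (pot_ge0 _ Lg)) i1.
by apply: eq_Rint => y; rewrite pot_shift2.
Qed.

Lemma ben_gt0 f g : 0 < c_ s -> LP f -> LP g -> (forall y, ~ Dom s y -> f y = 0) ->
  (forall y, ~ Dom s y -> g y = 0) -> 0 < Rint f -> 0 < Rint g -> 0 < ben f g.
Proof.
move=> cs0 Lf Lg fD gD f0 g0; rewrite /ben.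
rewrite (eq_Rint mu2 (fun x => mulrC (f x) (pot g x))).
apply: Rint_mul_gt0 => //.
- by have := integ_ben Lf Lg; under eq_fun do rewrite mulrC.
- by move=> y; exact: pot_ge0.
- by move=> y; exact: LP_ge0.
- exact: LP_meas.
- apply: aeW => y fy; apply: pot_gt0 => //.
  by apply: contrapT => /fD/eqP; rewrite (negbTE fy).
Qed.

Lemma ben_far f g L : LP f -> LP g -> 0 < L ->
  (forall x y, f x != 0 -> g y != 0 -> L <= edist x y) ->
  ben f g <= c_ s * L `^ (- e) * Rint g * Rint f.
Proof.
move=> Lf Lg L0 hL.
have cL : 0 <= c_ s * L `^ (- e) by rewrite mulr_ge0 ?powR_ge0.
rewrite -RintZ; last exact: LP_integ.
apply: le_Rint; [exact: integ_ben|by apply: integZ; exact: LP_integ|].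
move=> x; have [->|fx] := eqVneq (f x) 0; first by rewrite mul0r mulr0.
rewrite mulrC ler_wpM2r ?(LP_ge0 _ Lf)//.
rewrite -RintZ; last exact: LP_integ.
apply: le_Rint; [exact: integ_kk|by apply: integZ; exact: LP_integ|].
move=> y; have [->|gy] := eqVneq (g y) 0; first by rewrite !mulr0.
apply: ler_wpM2r; first exact: LP_ge0 Lg.
apply: (le_trans (kk_le s x y)); rewrite ler_wpM2l// /nk powRN.
have L1 := hL x y fx gy.
rewrite lef_pV2 ?posrE ?powR_gt0//; last exact: lt_le_trans L1.
by apply: ge0_ler_powR => //; rewrite ?nnegrE ?edist_ge0 ?(ltW e0) ?(ltW L0).
Qed.

End Energy.

(** * Gaussian weight, bounded tests and bounded sets *)

Section Weight.
Context {R : realType}.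
Local Notation P := (plane R).
Local Notation mu2 := (@leb2 R).
Local Notation leb := (@lebesgue_measure R).
Local Notation Rint f := (\int[mu2]_x f x).
Implicit Types (x y : P) (f g a : P -> R).

(** The weight for the weak limits. It is integrable with its square, and bounded below on bounded
    sets, so bounded functions of bounded support are dominated by a multiple of it. *)
Definition gweight x : R := gauss_fun x.1 * gauss_fun x.2.

Lemma gauss_fun_gt0 (t : R) : 0 < gauss_fun t. Proof. exact: expR_gt0. Qed.

Lemma gweight_gt0 x : 0 < gweight x.
Proof. by rewrite mulr_gt0// gauss_fun_gt0. Qed.

Lemma gweight_le1 x : gweight x <= 1.
Proof. by rewrite mulr_ile1 ?gauss_fun_ge0 ?gauss_fun_le1. Qed.

Lemma measurable_gweight : measurable_fun setT gweight.
Proof.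
apply: measurable_funM.
  exact: measurableT_comp (@measurable_gauss_fun R) measurable_fst.
exact: measurableT_comp (@measurable_gauss_fun R) measurable_snd.
Qed.

Lemma integ_gweight : integ mu2 gweight.
Proof.
have mg := @measurable_gauss_fun R.
have ig : (\int[leb]_t (gauss_fun t)%:E < +oo)%E.
  have /integrableP[_] := @integrableT_gauss R.
  by under eq_integral do rewrite /= ger0_norm ?gauss_fun_ge0//.
apply: ge0_integ; [exact: measurable_gweight|by move=> x; rewrite ltW ?gweight_gt0|].
have m2 : measurable_fun setT (EFin \o gweight) by apply/measurable_EFinP; exact: measurable_gweight.
rewrite (leb2_tonelli m2); last by move=> x; rewrite lee_fin ltW ?gweight_gt0.
have E t : (\int[leb]_b (EFin \o gweight) (t, b) = (gauss_fun t)%:E * \int[leb]_b (gauss_fun b)%:E)%E.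
  rewrite -ge0_integralZl//.
  - exact/measurable_EFinP.
  - by move=> b _; rewrite lee_fin gauss_fun_ge0.
  - by rewrite lee_fin gauss_fun_ge0.
under eq_integral do rewrite E.
rewrite ge0_integralZr//; last 3 first.
- exact/measurable_EFinP.
- by move=> b _; rewrite lee_fin gauss_fun_ge0.
- by apply: integral_ge0 => b _; rewrite lee_fin gauss_fun_ge0.
rewrite lte_mul_pinfty//; first by apply: integral_ge0 => b _; rewrite lee_fin gauss_fun_ge0.
by rewrite ge0_fin_numE//; apply: integral_ge0 => b _; rewrite lee_fin gauss_fun_ge0.
Qed.

Lemma integ_gweight2 : integ mu2 (fun x => gweight x ^+ 2).
Proof.
apply: (ge0_integ_le _ integ_gweight).
- by apply: measurable_funX; exact: measurable_gweight.
- by move=> x; exact: sqr_ge0.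
- by move=> x; rewrite expr2 ler_piMr ?gweight_le1 ?ltW ?gweight_gt0.
Qed.

(** Continuity is not asked for: indicators of bounded measurable sets are tests, and so are
    potentials restricted to such sets. *)
Definition btest g : Prop :=
  measurable_fun setT g /\ exists C B : R, forall x, 0 <= g x <= C /\ (B < `|x.1| + `|x.2| -> g x = 0).

Lemma btest_wtest g : btest g -> wtest gweight g.
Proof.
move=> [mg [C [B h]]]; split => //.
pose K := expR (- B ^+ 2) * expR (- B ^+ 2).
have K0 : 0 < K by rewrite mulr_gt0// expR_gt0.
exists (`|C| / K) => x; have [/andP[g0 gC] gB] := h x; rewrite g0/=.
have [xB|xB] := ltP B (`|x.1| + `|x.2|).
  by rewrite gB// mulr_ge0 ?divr_ge0 ?(ltW K0) ?(ltW (gweight_gt0 x)).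
apply: (le_trans gC); apply: (le_trans (ler_norm _)).
rewrite mulrAC ler_pdivlMr// ler_wpM2l//.
have sq (t : R) : `|t| <= B -> expR (- B ^+ 2) <= gauss_fun t.
  move=> tB; rewrite /gauss_fun ler_expR lerN2 -[t ^+ 2]real_normK ?num_real//.
  by rewrite ler_sqr ?nnegrE// (le_trans (normr_ge0 t)).
have x1 : `|x.1| <= B by apply: le_trans xB; rewrite lerDl.
have x2 : `|x.2| <= B by apply: le_trans xB; rewrite lerDr.
by apply: ler_pM; rewrite ?expR_ge0// sq.
Qed.

Definition bset (A : set P) : Prop :=
  measurable A /\ exists B : R, forall x, A x -> `|x.1| + `|x.2| <= B.

Lemma bset_btest A g C : bset A -> measurable_fun setT g -> (forall x, A x -> 0 <= g x <= C) ->
  btest (fun x => g x * \1_A x).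
Proof.
move=> [mA [B hB]] mg gC; split.
  by apply: measurable_funM => //; exact: measurable_indic.
exists `|C|, B => x; rewrite indicE; have [xA|xA] := boolP (x \in A); rewrite ?mulr1 ?mulr0.
  have Ax := set_mem xA; have /andP[-> h] := gC x Ax; rewrite (le_trans h) ?ler_norm//.
  by split => // h2; have := hB x Ax; rewrite leNgt h2.
by split => //; rewrite lexx /=.
Qed.

Lemma bset_btest1 A : bset A -> btest (fun x => \1_A x).
Proof.
move=> bA; have := @bset_btest A (fun=> 1) 1 bA (measurable_cst _).
under eq_fun do rewrite mul1r; apply => x _; by rewrite ler01 lexx.
Qed.

Definition boxn (n : nat) : set P := [set x | `|x.1| + `|x.2| <= n%:R].

Lemma measurable_norm12 : measurable_fun setT (fun x : P => `|x.1| + `|x.2|).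
Proof.
by apply: measurable_funD; apply: measurableT_comp.
Qed.

Lemma boxn_bset n : bset (boxn n).
Proof.
split; last by exists n%:R.
rewrite -[X in measurable X]setTI.
by apply: (measurable_fun_ler measurable_norm12 (measurable_cst (n%:R : R))).
Qed.

Lemma bsetI A B : measurable B -> bset A -> bset (A `&` B).
Proof.
move=> mB [mA [C hC]]; split; first exact: measurableI.
by exists C => x [/hC].
Qed.

Lemma integral_box_le f (M : R) : measurable_fun setT f -> (forall x, 0 <= f x) ->
  (forall n, (\int[mu2]_x (f x * \1_(boxn n) x)%:E <= M%:E)%E) ->
  (\int[mu2]_x (f x)%:E <= M%:E)%E.
Proof.
move=> mf f0 h.
have H : (\int[mu2]_x (f x * \1_(boxn n) x)%:E @[n --> \oo] --> \int[mu2]_x (f x)%:E)%E.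
  have -> : (\int[mu2]_x (f x)%:E = \int[mu2]_x (limn (fun n => (f x * \1_(boxn n) x)%:E)))%E.
    apply: eq_integral => x _; apply/esym/cvg_lim => //.
    apply: cvg_near_cst; exists (Num.truncn (`|x.1| + `|x.2|)).+1 => // n /= hn.
    rewrite indicE mem_set ?mulr1// /boxn /=.
    by apply: (le_trans (ltW (truncnS_gt _))); rewrite ler_nat.
  apply: cvg_monotone_convergence => //.
  - move=> n; apply/measurable_EFinP; apply: measurable_funM => //.
    by apply: measurable_indic; exact: (boxn_bset n).1.
  - by move=> n x _; rewrite lee_fin mulr_ge0.
  - move=> x _ n m nm; rewrite lee_fin ler_wpM2l// !indicE.
    have [xn|] := boolP (x \in boxn n) => //.
    rewrite mem_set//; move: (set_mem xn); rewrite /boxn /= => /le_trans; apply.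
    by rewrite ler_nat.
by apply: (cvge_le _ H) => //; exact: nearW.
Qed.

End Weight.

(** * The weak closure as a weakly compact class *)

Section ClassK.
Context {R : realType}.
Local Notation P := (plane R).
Local Notation mu2 := (@leb2 R).
Local Notation Rint f := (\int[mu2]_x f x).
Implicit Types (x y : P) (f g a : P -> R).
Variables (p : R) (D : set P).
Hypothesis p2 : 2 <= p.
Hypothesis mD : measurable D.
Variable z0 : P -> R.
Hypothesis Lz : LP p z0.
Local Notation Phi := (Phi (@leb2s R)).

(** [rearr_wclosure] for representatives chosen at every point; as they vanish off [D], the hinge
    integrals may be taken over the whole plane. *)
Definition inK f : Prop :=
  [/\ measurable_fun setT f, forall x, 0 <= f x, forall x, ~ D x -> f x = 0 &
   forall t, 0 < t -> (Phi f t <= Phi z0 t)%E].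

(** u^2 <= u where u <= 1, and u^2 <= u^p elsewhere because p >= 2. *)
Lemma LP_sqr f : LP p f -> integ mu2 (fun x => f x `^ 2).
Proof.
move=> [mf f0 if_ ifp]; apply: (ge0_integ_le _ (integD if_ ifp)).
- exact: (measurableT_comp (measurable_powR 2)).
- by move=> x; exact: powR_ge0.
- move=> x; have [f1|f1] := leP (f x) 1.
    apply: ler_wpDr; first exact: powR_ge0.
    by rewrite powR_mulrn// expr2 ler_piMr.
  apply: ler_wpDl => //; apply: ler_powR => //; exact: ltW.
Qed.

Lemma K_LP f : inK f -> [/\ LP p f, Rint f <= Rint z0,
  Rint (fun x => f x `^ p) <= Rint (fun x => z0 x `^ p), integ mu2 (fun x => f x ^+ 2) &
  \int[mu2]_x (f x ^+ 2) <= \int[mu2]_x (z0 x ^+ 2)].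
Proof.
move=> [mf f0 fD fPhi]; have [mz z00 iz izp] := Lz.
have mpow q g : measurable_fun setT g -> measurable_fun setT (fun x => g x `^ q).
  by move=> mg; exact: (measurableT_comp (measurable_powR q)).
have h1 : (\int[mu2]_x (f x)%:E <= (Rint z0)%:E)%E.
  by rewrite -EFin_Rint//; exact: (@le_integral_Phi _ _ _ (@leb2s R)).
have hq q : 2 <= q -> integ mu2 (fun x => z0 x `^ q) ->
    integ mu2 (fun x => f x `^ q) /\ Rint (fun x => f x `^ q) <= Rint (fun x => z0 x `^ q).
  move=> q2 izq.
  have h2 : (\int[mu2]_x (f x `^ q)%:E <= (Rint (fun x => z0 x `^ q))%:E)%E.
    by rewrite -EFin_Rint//; exact: (@le_integral_powR_Phi _ _ _ (@leb2s R)).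
  split; last by apply: Rint_le_EFin => // x; exact: powR_ge0.
  apply: ge0_integ; [exact: mpow|by move=> x; exact: powR_ge0|].
  exact: le_lt_trans h2 (ltry _).
have [ip hp] := hq p p2 izp.
have [i2 h2] := hq 2 (lexx _) (LP_sqr Lz).
have E2 g : (forall x, 0 <= g x) -> (fun x => g x `^ 2) = (fun x => g x ^+ 2).
  by move=> g0; apply/funext => x; rewrite powR_mulrn.
split.
- split => //; apply: ge0_integ => //; exact: le_lt_trans h1 (ltry _).
- exact: Rint_le_EFin.
- exact: hp.
- by rewrite -E2.
- by move: h2; rewrite !E2.
Qed.

Lemma le_Phi f g t : measurable_fun setT f -> measurable_fun setT g -> (forall x, f x <= g x) ->
  (Phi f t <= Phi g t)%E.
Proof.
move=> mf mg fg; apply: ge0_le_integral => //.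
- by move=> x _; rewrite lee_fin hinge_ge0.
- by apply/measurable_EFinP; exact: measurable_hinge.
- by apply/measurable_EFinP; exact: measurable_hinge.
- by move=> x _; rewrite lee_fin le_hinge.
Qed.

Lemma K_le f g : inK g -> measurable_fun setT f -> (forall x, 0 <= f x <= g x) -> inK f.
Proof.
move=> [mg g0 gD gPhi] mf fg; split => //.
- by move=> x; case/andP : (fg x).
- by move=> x Dx; apply/eqP; have := fg x; rewrite gD// eq_le andbC.
- move=> t t0; apply: (le_trans _ (gPhi t t0)); apply: le_Phi => // x.
  by case/andP : (fg x).
Qed.

Lemma K_indic f A : inK f -> measurable A -> inK (fun x => f x * \1_A x).
Proof.
move=> Kf mA; apply: (K_le Kf).
  by case: Kf => mf *; apply: measurable_funM => //; exact: measurable_indic.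
case: Kf => _ f0 _ _ x; rewrite mulr_ge0//= ler_piMr// indicE; by case: (_ \in _).
Qed.

Lemma K_shift2 c f : (forall x, D x -> D (shift2 c x)) -> (forall x, D (shift2 c x) -> D x) ->
  inK f -> inK (f \o shift2 c).
Proof.
move=> D1 D2 [mf f0 fD fPhi]; split.
- by apply: measurableT_comp => //; exact: measurable_shift2.
- by move=> x /=.
- by move=> x nDx /=; apply: fD => /D2.
- move=> t t0; apply: le_trans (fPhi t t0); rewrite le_eqVlt; apply/orP; left; apply/eqP.
  apply: (@ge0_integral_shift2 _ c (fun x => (hinge t (f x))%:E)) => //.
    by apply/measurable_EFinP; exact: measurable_hinge.
  by move=> x; rewrite lee_fin hinge_ge0.
Qed.

Definition wcv (U : set_system nat) (f : nat -> P -> R) a : Prop :=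
  forall g, btest g -> \int[mu2]_x (f n x * g x) @[n --> U] --> \int[mu2]_x (a x * g x).

(** The L^1 and L^2 bounds of the class give a weak limit [a]. The constraint passes to it: on a
    box, (a - t)_+ equals (a - t) 1_A with A the part of the box where a > t, which is a bounded set
    and hence a test, while (f_n - t) 1_A <= (f_n - t)_+. *)
Lemma K_weak_compact (U : set_system nat) (UU : UltraFilter U) (f : nat -> P -> R) :
  (forall n, inK (f n)) -> exists a, inK a /\ wcv U f a.
Proof.
move=> Kf.
have mf n : measurable_fun setT (f n) by case: (Kf n).
have f0 n x : 0 <= f n x by case: (Kf n).
have if1 n : integ mu2 (f n) by have [[]] := K_LP (Kf n).
have f1 n : Rint (f n) <= Rint z0 by have [] := K_LP (Kf n).
have if2 n : integ mu2 (fun x => f n x ^+ 2) by have [] := K_LP (Kf n).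
have f2 n : \int[mu2]_x (f n x ^+ 2) <= \int[mu2]_x (z0 x ^+ 2) by have [] := K_LP (Kf n).
have [a [ma a0 H]] := @weak_limit_exists _ _ _ (@leb2s R) gweight measurable_gweight
  gweight_gt0 gweight_le1 integ_gweight2 U UU f (Rint z0) (\int[mu2]_x (z0 x ^+ 2)) mf f0 if1 f1 if2 f2.
(* The [f n] vanish off [D], so cutting the limit down to [D] leaves the limits of all tests
   unchanged. *)
pose a' x := a x * \1_D x.
have m1D : measurable_fun setT (\1_D : P -> R) by exact: measurable_indic.
have ma' : measurable_fun setT a' by exact: measurable_funM.
have a'0 x : 0 <= a' x by rewrite mulr_ge0.
have a'D x : ~ D x -> a' x = 0 by move=> nD; rewrite /a' indicE memNset ?mulr0.
have wa' g : btest g -> integ mu2 (fun x => a' x * g x) /\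
    \int[mu2]_x (f n x * g x) @[n --> U] --> \int[mu2]_x (a' x * g x).
  move=> bg.
  have bgD : btest (fun x => g x * \1_D x).
    case: bg => mg [C [B h]]; split; first exact: measurable_funM.
    exists C, B => x; have [/andP[g0 gC] gB] := h x; split.
      rewrite mulr_ge0//= (le_trans _ gC)// ler_piMr// indicE; by case: (_ \in _).
    by move=> /gB ->; rewrite mul0r.
  have [i1 h1] := H _ (btest_wtest bgD).
  have E x : a x * (g x * \1_D x) = a' x * g x by rewrite /a' mulrCA mulrC mulrAC mulrC mulrA.
  have Ef n x : f n x * (g x * \1_D x) = f n x * g x.
    rewrite indicE; have [xD|xD] := boolP (x \in D); rewrite ?mulr1//.
    case: (Kf n) => _ _ fD _; rewrite fD ?mul0r//.
    by move=> Dx; move: xD; rewrite mem_set.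
  split; first by rewrite (_ : (fun x => _) = (fun x => a x * (g x * \1_D x)))//; apply/funext => x; rewrite E.
  rewrite -(eq_Rint _ E); move: h1.
  by under eq_fun do rewrite (eq_Rint _ (Ef _)).
exists a'; split; last by move=> g bg; exact: (wa' g bg).2.
split => // t t0.
have mz : measurable_fun setT z0 by case: Lz.
have z00 x : 0 <= z0 x by case: Lz.
have ihz : integ mu2 (fun x => hinge t (z0 x)).
  have iz : integ mu2 z0 by case: Lz.
  apply: (ge0_integ_le _ iz); first exact: measurable_hinge.
  - by move=> x; exact: hinge_ge0.
  - by move=> x; apply: hinge_le => //; exact: ltW.
rewrite /Phi [leRHS](EFin_Rint ihz).
apply: integral_box_le.
- exact: measurable_hinge.
- by move=> x; exact: hinge_ge0.
move=> n.
have mA : measurable [set x | t < a' x].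
  rewrite -[X in measurable X]setTI.
  by apply: (measurable_fun_ltr (measurable_cst t) ma').
pose A := boxn n `&` [set x | t < a' x].
have bA : bset A by apply: bsetI => //; exact: boxn_bset.
have m1A : measurable_fun setT (\1_A : P -> R) by apply: measurable_indic; exact: bA.1.
have bt : btest (fun x => \1_A x) := bset_btest1 bA.
have [ia hA] := wa' _ bt.
have i1A : integ mu2 (fun x => \1_A x : R).
  have [C hC] := (btest_wtest bt).2.
  by apply: (ge0_integ_le _ (integZ C integ_gweight)) => // x; case/andP : (hC x).
have Eh x : hinge t (a' x) * \1_(boxn n) x = a' x * \1_A x - t * \1_A x.
  rewrite /A indicI /hinge /= -mulrBl; case: (ltP t (a' x)) => h.
    have -> : \1_[set x0 | t < a' x0] x = 1 :> R by rewrite indicE mem_set.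
    by rewrite mulr1 max_l// subr_ge0 ltW.
  have -> : \1_[set x0 | t < a' x0] x = 0 :> R by rewrite indicE memNset//= ltNge h.
  by rewrite !mulr0 max_r ?mul0r// subr_le0.
have ihn (m : nat) : integ mu2 (fun x => hinge t (f m x)).
  apply: (ge0_integ_le _ (if1 m)); first exact: measurable_hinge.
  - by move=> x; exact: hinge_ge0.
  - by move=> x; apply: hinge_le => //; exact: ltW.
have Eint : integ mu2 (fun x => hinge t (a' x) * \1_(boxn n) x).
  rewrite (_ : (fun x => _) = (fun x => a' x * \1_A x - t * \1_A x)); last exact/funext.
  by apply: integB => //; exact: integZ.
rewrite (EFin_Rint Eint) lee_fin (eq_Rint _ Eh) RintB//; last exact: integZ.
rewrite RintZ// lerBlDr.
apply: (cvgr_to_le hA); apply: nearW => m.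
have ifA : integ mu2 (fun x => f m x * \1_A x).
  apply: (ge0_integ_le _ (if1 m)); first exact: measurable_funM.
  - by move=> x; rewrite mulr_ge0.
  - by move=> x; rewrite ler_piMr// indicE; case: (_ \in _).
rewrite -RintZ// -lerBlDr -RintB//; last exact: integZ.
apply: (@le_trans _ _ (Rint (fun x => hinge t (f m x)))).
  apply: le_Rint => //; first by apply: integB => //; exact: integZ.
  move=> x; rewrite -mulrBl indicE; case: (_ \in _); rewrite ?mulr1 ?mulr0 ?hinge_ge0//.
  by rewrite /hinge le_max lexx.
rewrite -lee_fin -!EFin_Rint//.
by case: (Kf m) => _ _ _ /(_ t t0).
Qed.

End ClassK.

Lemma ler_dist2 {R : realType} (u v w : R) : u <= v + w -> v <= u + w -> `|u - v| <= w.
Proof. by rewrite ler_norml; lra. Qed.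

Lemma sub4_alg {R : realType} (u v w t : R) : u - v - (w - t) = (u - w) - (v - t).
Proof. by ring. Qed.

Lemma four_fifths {R : realType} (d : R) : 0 <= d -> d / 5 + d / 5 + d / 5 + d / 5 <= d.
Proof. lra. Qed.

(** * Energy and impulse along weakly convergent sequences *)

Section WeakEnergy.
Context {R : realType}.
Implicit Types x y z : plane R.
Local Notation mu2 := (@leb2 R).
Local Notation P := (plane R).
Local Notation Rint f := (\int[mu2]_x f x).
Variables s p : R.
Hypothesis s01 : 0 < s < 1.
Hypothesis p2 : 2 <= p.
Hypothesis gp : gam s * (p / (p - 1)) < 2.
Implicit Types f g h a : P -> R.
Local Notation LP := (@LP R p).
Local Notation kk := (kk s).
Local Notation pot := (@pot R s).
Local Notation ben := (@ben R s).
Local Notation D := (@Dom R s).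
Let e := 2 - 2 * s.
Let e0 : 0 < e. Proof. by rewrite /e; have := s01; lra. Qed.

Let q0 : 0 < p / (p - 1).
Proof. by have := p2 => h; rewrite divr_gt0 ?subr_gt0 ?(lt_le_trans _ h)// ?ltr1n ?ltr0n. Qed.

Let ep : e * (p / (p - 1)) < 2.
Proof.
apply: le_lt_trans gp; rewrite ler_wpM2r ?(ltW q0)//.
by rewrite /gam /e; case: ifP => // _; rewrite lerD2r ler_nat.
Qed.

Let cs0 : 0 <= c_ s. Proof. exact: c_ge0. Qed.

(* [ke] is the half-plane kernel made bounded and Lipschitz by replacing the
   distances [r] with [max r eps]; the absolute value keeps it non-negative off the
   half-plane. *)
Definition phie (eps r : R) : R := (Num.max r eps `^ e)^-1.

Lemma phie_ge0 eps r : 0 <= phie eps r.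
Proof. by rewrite invr_ge0 powR_ge0. Qed.

Lemma phie_le eps r : 0 < eps -> phie eps r <= (eps `^ e)^-1.
Proof.
move=> eps0; have m0 : eps <= Num.max r eps by rewrite le_max lexx orbT.
rewrite lef_pV2 ?posrE ?powR_gt0//; last exact: lt_le_trans m0.
by apply: ge0_ler_powR => //; rewrite ?nnegrE ?(ltW e0) ?(ltW eps0) ?(le_trans (ltW eps0) m0).
Qed.

Lemma phie_near eps r : eps <= r -> phie eps r = (r `^ e)^-1.
Proof. by move=> h; rewrite /phie max_l. Qed.

(** r -> max r eps is 1-Lipschitz, and the power is Lipschitz on [eps, oo) by [powR_onem_le] applied
    to the relative increment. *)
Lemma phie_lip eps r r' : 0 < eps ->
  `|phie eps r - phie eps r'| <= (eps `^ e)^-1 * (e / eps) * `|r - r'|.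
Proof.
move=> eps0; wlog rr : r r' / r <= r'.
  move=> H; have [h|/ltW h] := leP r r'; first exact: H.
  by rewrite distrC (distrC r); exact: H.
pose t := Num.max r eps; pose t' := Num.max r' eps.
have te : eps <= t by rewrite le_max lexx orbT.
have t0 : 0 < t by exact: lt_le_trans te.
have tt : t <= t' by rewrite /t ge_max !le_max rr lexx orbT.
have tr : t' - t <= r' - r.
  rewrite /t' /t lerBlDr ge_max; apply/andP; split.
    by rewrite -lerBlDl opprB addrC subrK le_max lexx.
  by apply: (@le_trans _ _ (0 + eps)); [rewrite add0r|apply: lerD; [rewrite subr_ge0|rewrite le_max lexx orbT]].
have u0 : 0 <= (t' - t) / t by rewrite divr_ge0 ?subr_ge0 ?(ltW t0).
have E : t' = t * (1 + (t' - t) / t).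
  by rewrite mulrDr mulr1 mulrCA divff ?gt_eqF// mulr1 addrC subrK.
have P1 : (t' `^ e)^-1 = (t `^ e)^-1 * ((1 + (t' - t) / t) `^ e)^-1.
  by rewrite -invfM -powRM ?(ltW t0) -?E// addr_ge0.
have h := @powR_onem_le R _ e u0 (ltW e0).
have M : phie eps r' <= phie eps r.
  rewrite /phie -/t -/t' lef_pV2 ?posrE ?powR_gt0//; last exact: lt_le_trans tt.
  by apply: ge0_ler_powR => //; rewrite ?nnegrE ?(ltW e0) ?(ltW t0) ?(le_trans (ltW t0) tt).
rewrite ger0_norm ?subr_ge0// (ler0_norm (_ : r - r' <= 0)) ?subr_le0// opprB.
rewrite {1}/phie -/t {1}/phie -/t' P1 -{1}[(t `^ e)^-1]mulr1 -mulrBr.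
apply: (@le_trans _ _ ((t `^ e)^-1 * (e * ((t' - t) / t)))).
  by rewrite ler_wpM2l// invr_ge0 powR_ge0.
rewrite -mulrA; apply: ler_pM.
- by rewrite invr_ge0 powR_ge0.
- by rewrite mulr_ge0// ltW.
- exact: (phie_le r eps0).
- rewrite -mulrA ler_wpM2l ?(ltW e0)// mulrC.
  apply: ler_pM; rewrite ?invr_ge0 ?subr_ge0 ?(ltW t0)//.
  by rewrite lef_pV2 ?posrE.
Qed.

Definition ke (eps : R) x y : R :=
  c_ s * `|phie eps (edist x y) - phie eps (edist x (reflect1 y))|.

Lemma ke_ge0 eps x y : 0 <= ke eps x y.
Proof. exact: mulr_ge0. Qed.

Lemma ke_le eps x y : 0 < eps -> ke eps x y <= c_ s * (eps `^ e)^-1.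
Proof.
move=> eps0; rewrite ler_wpM2l//.
have h1 := phie_ge0 eps (edist x y); have h2 := phie_ge0 eps (edist x (reflect1 y)).
have h3 := phie_le (edist x y) eps0; have h4 := phie_le (edist x (reflect1 y)) eps0.
rewrite ler_norml lerBlDr lerBrDr; apply/andP; split.
  by apply: (le_trans _ h1); rewrite addrC subr_le0.
by apply: (le_trans h3); rewrite lerDl.
Qed.

(** Lipschitz constant of [ke eps] in its first variable; the factor 2 counts the charge and its
    image. *)
Definition Lam (eps : R) : R := 2 * (c_ s * ((eps `^ e)^-1 * (e / eps))).

Lemma Lam_ge0 eps : 0 < eps -> 0 <= Lam eps.
Proof. by move=> eps0; apply: mulr_ge0 => //; apply: mulr_ge0 => //; rewrite mulr_ge0 ?invr_ge0 ?powR_ge0 ?divr_ge0 ?(ltW e0) ?(ltW eps0). Qed.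

Lemma dist_edist x x' y : `|edist x y - edist x' y| <= edist x x'.
Proof.
rewrite ler_norml lerBlDr edist_triangle andbT lerBrDr addrC lerBlDr.
by rewrite addrC (edistC x x') edist_triangle.
Qed.

Lemma ke_lip eps x x' y : 0 < eps -> `|ke eps x y - ke eps x' y| <= Lam eps * edist x x'.
Proof.
move=> eps0; rewrite /ke -mulrBr normrM (ger0_norm cs0) /Lam (mulrC 2) -!(mulrA (c_ s)) ler_wpM2l//.
apply: (le_trans (ler_dist_dist _ _)).
set C := (eps `^ e)^-1 * (e / eps).
have C0 : 0 <= C by rewrite mulr_ge0 ?invr_ge0 ?powR_ge0 ?divr_ge0 ?(ltW e0) ?(ltW eps0).
have h1 := phie_lip (edist x y) (edist x' y) eps0.
have h2 := phie_lip (edist x (reflect1 y)) (edist x' (reflect1 y)) eps0.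
have h3 := le_trans h1 (ler_wpM2l C0 (dist_edist x x' y)).
have h4 := le_trans h2 (ler_wpM2l C0 (dist_edist x x' (reflect1 y))).
rewrite (_ : _ - _ - _ = (phie eps (edist x y) - phie eps (edist x' y))
  - (phie eps (edist x (reflect1 y)) - phie eps (edist x' (reflect1 y)))); last exact: sub4_alg.
apply: (le_trans (ler_normB _ _)).
apply: (le_trans (lerD h3 h4)).
by rewrite [leRHS](_ : _ = C * edist x x' + C * edist x x')//; ring.
Qed.

Lemma measurable_phie eps : measurable_fun [set: R] (phie eps).
Proof.
rewrite /phie; under eq_fun do rewrite -powRN.
apply: (measurableT_comp (measurable_powR (- e))).
by apply: measurable_maxr => //; exact: measurable_id.
Qed.

Lemma measurable_ke d (T : measurableType d) (f g : T -> P) eps :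
  measurable_fun setT f -> measurable_fun setT g ->
  measurable_fun setT (fun t => ke eps (f t) (g t)).
Proof.
move=> mf mg; apply: measurable_funM => //; apply: measurableT_comp => //.
have m1 := measurable_phie eps.
apply: measurable_funB; apply: (measurableT_comp m1); apply: measurable_edist => //.
exact: measurableT_comp measurable_reflect1 mg.
Qed.

(** Below distance [eps] the near part of the kernel pays for everything. Beyond it neither distance
    is regularised, since the image is farther still, and the two kernels agree. *)
Lemma kk_le_ke eps x y : 0 < eps -> 0 < x.1 -> 0 < y.1 ->
  kk x y <= ke eps x y + c_ s * nkc e eps x y.
Proof.
move=> eps0 x0 y0; have [xy|xy] := ltP (edist x y) eps.
  by rewrite /nkc xy; apply: ler_wpDl; [exact: ke_ge0|exact: kk_le].
apply: ler_wpDr; first by rewrite mulr_ge0 ?nkc_ge0.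
have xr : eps <= edist x (reflect1 y).
  by apply: (le_trans xy); apply: edist_le_reflect; exact: ltW.
have nxy : x <> y by move=> h; move: xy; rewrite h edist_xx leNgt eps0.
rewrite kkE// /Gker_plus !GkerE -mulrBr /ke !phie_near// ler_wpM2l//.
exact: ler_norm.
Qed.

Lemma ke_le_kk eps x y : 0 < eps -> 0 < x.1 -> 0 < y.1 -> x <> y ->
  ke eps x y <= kk x y + c_ s * nkc e eps x y.
Proof.
move=> eps0 x0 y0 nxy.
have d0 := edist_gt0 nxy.
have xr : edist x y <= edist x (reflect1 y) by apply: edist_le_reflect; exact: ltW.
have hm : Num.max (edist x y) eps <= Num.max (edist x (reflect1 y)) eps.
  by rewrite ge_max !le_max xr lexx orbT.
have m0 r : 0 < Num.max r eps by rewrite lt_max eps0 orbT.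
have mono : phie eps (edist x (reflect1 y)) <= phie eps (edist x y).
  rewrite /phie lef_pV2 ?posrE ?powR_gt0//.
  by apply: ge0_ler_powR => //; rewrite ?nnegrE ltW.
rewrite /ke ger0_norm ?subr_ge0//.
have [xy|xy] := ltP (edist x y) eps.
  rewrite /nkc xy; apply: ler_wpDl; first exact: kk_ge0.
  rewrite ler_wpM2l//; apply: (@le_trans _ _ (phie eps (edist x y))); first by rewrite gerBl phie_ge0.
  rewrite /phie max_r ?(ltW xy)// /nk lef_pV2 ?posrE ?powR_gt0//.
  by apply: ge0_ler_powR => //; rewrite ?nnegrE ?(ltW e0) ?(ltW d0) ?(ltW eps0) ?(ltW xy).
apply: ler_wpDr; first by rewrite mulr_ge0 ?nkc_ge0.
by rewrite kkE// /Gker_plus !GkerE -mulrBr !phie_near// (le_trans xy).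
Qed.

Definition pote eps f x : R := \int[mu2]_y (ke eps x y * f y).

Lemma measurable_ke1 eps x : measurable_fun setT (ke eps x).
Proof. by apply: measurable_ke => //; exact: measurable_id. Qed.

Lemma integ_ke eps f x : 0 < eps -> LP f -> integ mu2 (fun y => ke eps x y * f y).
Proof.
move=> eps0 Lf; apply: (ge0_integ_le _ (integZ (c_ s * (eps `^ e)^-1) (LP_integ Lf))).
- by apply: measurable_funM; [exact: measurable_ke1|exact: LP_meas Lf].
- by move=> y; rewrite mulr_ge0 ?ke_ge0 ?(LP_ge0 _ Lf).
- by move=> y; rewrite ler_wpM2r ?(LP_ge0 _ Lf)// ke_le.
Qed.

Lemma pote_ge0 eps f x : LP f -> 0 <= pote eps f x.
Proof. by move=> Lf; apply: Rint_ge0 => y; rewrite mulr_ge0 ?ke_ge0 ?(LP_ge0 _ Lf). Qed.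

Lemma pote_le eps f x : 0 < eps -> LP f -> pote eps f x <= c_ s * (eps `^ e)^-1 * Rint f.
Proof.
move=> eps0 Lf; rewrite -RintZ; last exact: LP_integ Lf.
apply: le_Rint; [exact: integ_ke|by apply: integZ; exact: LP_integ Lf|].
by move=> y; rewrite ler_wpM2r ?(LP_ge0 _ Lf)// ke_le.
Qed.

Lemma measurable_pote eps f : LP f -> measurable_fun setT (pote eps f).
Proof.
move=> Lf; rewrite /pote /Rintegral.
apply: (measurableT_comp (@fine_measurable R setT measurableT)).
pose K (v : P * P) : \bar R := (ke eps v.1 v.2 * f v.2)%:E.
have K0 v : (0 <= K v)%E by rewrite lee_fin mulr_ge0 ?ke_ge0 ?(LP_ge0 _ Lf).
have mK : measurable_fun setT K.
  apply/measurable_EFinP; apply: measurable_funM; first exact: measurable_ke.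
  exact: measurableT_comp (LP_meas Lf) measurable_snd.
exact: measurable_leb2_integral mK K0.
Qed.

Lemma pote_lip eps f x x' : 0 < eps -> LP f ->
  `|pote eps f x - pote eps f x'| <= Lam eps * edist x x' * Rint f.
Proof.
move=> eps0 Lf; rewrite /pote -RintB; [|exact: integ_ke|exact: integ_ke].
have ii := integB (integ_ke x eps0 Lf) (integ_ke x' eps0 Lf).
apply: (le_trans (le_normr_Rintegral measurableT ii)).
rewrite -RintZ; last exact: LP_integ Lf.
apply: le_Rint; [exact: integ_norm|by apply: integZ; exact: LP_integ Lf|].
move=> y; rewrite -mulrBl normrM (ger0_norm (LP_ge0 y Lf)).
by rewrite ler_wpM2r ?(LP_ge0 _ Lf)// ke_lip.
Qed.

Lemma integ_nkc r f x : 0 < r -> LP f -> integ mu2 (fun y => nkc e r x y * f y).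
Proof. by move=> r0 Lf; exact: (nkc_young p2 e0 ep x r0 ltr01 Lf).1. Qed.

Lemma pot_approx eps eta f x : 0 < eps -> LP f -> (forall y, ~ D y -> f y = 0) -> D x ->
  \int[mu2]_y (nkc e eps x y * f y) <= eta -> `|pot f x - pote eps f x| <= c_ s * eta.
Proof.
move=> eps0 Lf fD Dx h.
have x0 := Dom_gt0 Dx.
have i1 := integ_kk s01 p2 gp x Lf; have i2 := integ_ke x eps0 Lf.
have i3 := integ_nkc x eps0 Lf; have i4 := integZ (c_ s) i3.
have h' : c_ s * \int[mu2]_y (nkc e eps x y * f y) <= c_ s * eta by rewrite ler_wpM2l.
have A1 : pot f x <= pote eps f x + c_ s * eta.
  apply: (le_trans _ (lerD (lexx _) h')); rewrite -RintZ// -RintD//.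
  apply: le_Rint => //; first exact: integD.
  move=> y; have [Dy|nDy] := pselect (D y); last by rewrite fD// !mulr0 addr0.
  by rewrite mulrA -mulrDl ler_wpM2r ?(LP_ge0 _ Lf)// kk_le_ke// (Dom_gt0 Dy).
have A2 : pote eps f x <= pot f x + c_ s * eta.
  apply: (le_trans _ (lerD (lexx _) h')); rewrite -RintZ// -RintD//.
  (* [ke_le_kk] excludes y = x, where its right-hand side is 0 by the default values. The minimum
     [g] agrees with [ke eps x y * f y] almost everywhere and satisfies the bound at every point. *)
  pose g y := Num.min (ke eps x y * f y) (kk x y * f y + c_ s * (nkc e eps x y * f y)).
  have mg : measurable_fun setT g.
    by apply: measurable_minr; [exact: integ_meas i2|exact: integ_meas (integD i1 i4)].
  rewrite /pote (@eq_ae_Rint _ _ _ mu2 _ g)//.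
  - apply: ge0_le_Rint => //; first exact: integD.
      move=> y; rewrite le_min (mulr_ge0 (ke_ge0 _ _ _) (LP_ge0 _ Lf))/=.
      exact: addr_ge0 (mulr_ge0 (kk_ge0 s _ _) (LP_ge0 _ Lf)) (mulr_ge0 cs0 (mulr_ge0 (nkc_ge0 _ _ _ _) (LP_ge0 _ Lf))).
    by move=> y; rewrite ge_min lexx orbT.
  - exact: integ_meas i2.
  - have := ae_neq x; apply: filterS => y xy.
    rewrite /g min_l//; have [Dy|nDy] := pselect (D y); last by rewrite fD// !mulr0 addr0.
    by rewrite mulrA -mulrDl ler_wpM2r ?(LP_ge0 _ Lf)// ke_le_kk// (Dom_gt0 Dy).
exact: ler_dist2.
Qed.


Lemma ben_approx eps eta f g : 0 < eps -> LP f -> (forall y, ~ D y -> f y = 0) ->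
  LP g -> (forall y, ~ D y -> g y = 0) ->
  (forall x, \int[mu2]_y (nkc e eps x y * g y) <= eta) ->
  `|ben f g - \int[mu2]_x (f x * pote eps g x)| <= c_ s * eta * Rint f.
Proof.
move=> eps0 Lf fD Lg gD h.
have i1 := integ_ben s01 p2 gp Lf Lg.
have i2 : integ mu2 (fun x => f x * pote eps g x).
  apply: (ge0_integ_le _ (integZ (c_ s * (eps `^ e)^-1 * Rint g) (LP_integ Lf))).
  - by apply: measurable_funM; [exact: LP_meas Lf|exact: measurable_pote].
  - by move=> x; rewrite mulr_ge0 ?pote_ge0 ?(LP_ge0 _ Lf).
  - by move=> x; rewrite mulrC ler_wpM2r ?(LP_ge0 _ Lf)// pote_le.
rewrite /ben -RintB//; apply: (le_trans (le_normr_Rintegral measurableT (integB i1 i2))).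
rewrite -RintZ; last exact: LP_integ Lf.
apply: le_Rint; [exact: integ_norm (integB i1 i2)|by apply: integZ; exact: LP_integ Lf|].
move=> x; have [Dx|nDx] := pselect (D x); last by rewrite fD// !mul0r subr0 normr0 mulr0.
rewrite -mulrBr normrM (ger0_norm (LP_ge0 x Lf)) mulrC ler_wpM2r ?(LP_ge0 _ Lf)//.
exact: pot_approx.
Qed.

Lemma measurable_Dom : measurable D.
Proof.
rewrite /Dom; case: ifP => _; rewrite -[X in measurable X]setTI.
  by apply: (measurable_fun_ltr (measurable_cst (0:R)) measurable_fst).
by apply: (measurable_fun_ler (measurable_cst (1:R)) measurable_fst).
Qed.

Variable z0 : P -> R.
Hypothesis Lz : LP z0.
Local Notation K := (inK D z0).
Local Notation M1 := (Rint z0).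
Local Notation Mp := (Rint (fun x => z0 x `^ p)).

Let K_lp f : K f -> LP f. Proof. by move=> /(K_LP p2 Lz)[]. Qed.
Let K_M1 f : K f -> Rint f <= M1. Proof. by move=> /(K_LP p2 Lz)[]. Qed.
Let K_Mp f : K f -> Rint (fun x => f x `^ p) <= Mp. Proof. by move=> /(K_LP p2 Lz)[]. Qed.
Let K_D f x : K f -> ~ D x -> f x = 0. Proof. by move=> [_ _ h _] /h. Qed.
Let M10 : 0 <= M1. Proof. by apply: Rint_ge0 => x; exact: LP_ge0 Lz. Qed.

Lemma le_Rint_indic f A : LP f -> measurable A -> Rint (fun x => f x * \1_A x) <= Rint f.
Proof.
move=> Lf mA; apply: ge0_le_Rint.
- by apply: measurable_funM; [exact: LP_meas Lf|exact: measurable_indic].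
- exact: LP_integ Lf.
- by move=> x; rewrite mulr_ge0 ?(LP_ge0 _ Lf).
- by move=> x; rewrite ler_piMr ?(LP_ge0 _ Lf)// indicE; case: (_ \in _).
Qed.

Section Limits.
Variables (U : set_system nat) (UU : UltraFilter U).

(** A common Lipschitz constant upgrades pointwise convergence to uniform convergence on a compact
    square; compactness is used in its near-covering form, which suits an arbitrary filter. *)
Lemma box_uniform (V : nat -> P -> R) (V0 : P -> R) (L B th : R) : 0 <= L -> 0 < th ->
  (forall n x x', `|V n x - V n x'| <= L * edist x x') ->
  (forall x x', `|V0 x - V0 x'| <= L * edist x x') ->
  (forall x, V n x @[n --> U] --> V0 x) ->
  \forall n \near U, forall x, `|x.1| + `|x.2| <= B -> `|V n x - V0 x| <= th.
Proof.
move=> L0 th0 hV hV0 cV.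
pose Q : set (R * R) := `[- B, B]%classic `*` `[- B, B]%classic.
have cQ : compact Q by apply: compact_setX; exact: segment_compact.
have /compact_near_coveringP ncQ := cQ.
have : \near U, Q `<=` (fun (n : nat) (x : R * R) => `|V n (x : P) - V0 (x : P)| <= th) U.
  apply: (ncQ nat U (fun (n : nat) (x : R * R) => `|V n (x : P) - V0 (x : P)| <= th)).
  move=> x _.
  (* A ball of radius [eta] of the sup norm lies within Euclidean distance 2 eta of its centre, and
     (L + 1) 2 eta = th / 4. *)
  pose eta := th / 4 / (L + 1) / 2.
  have eta0 : 0 < eta by rewrite !divr_gt0// ltr_wpDl.
  have th4 : 0 < th / 4 by rewrite divr_gt0.
  have /cvgrPdist_le /(_ _ th4) := cV x.
  move=> hn.
  have hx : \forall x' \near x, ball x eta x' by exact: nbhsx_ballx.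
  exists (ball x eta, [set n | `|V0 x - V n x| <= th / 4]); first by split.
  move=> [x' n] /= [[b1 b2] h].
  have dx : L * edist (x : P) (x' : P) <= th / 4.
    have d1 : edist (x : P) (x' : P) <= eta + eta.
      apply: (le_trans (eucl_le_norm _)) => /=.
      by apply: lerD; exact: ltW.
    apply: (le_trans (ler_wpM2l L0 d1)).
    have E : (L + 1) * (eta + eta) = th / 4.
      by rewrite /eta; field; rewrite gt_eqF// ltr_wpDl.
    by rewrite -E ler_wpM2r ?addr_ge0 ?(ltW eta0)// lerDl.
  have h1 := le_trans (hV n x x') dx.
  have h2 := le_trans (hV0 x x') dx.
  rewrite (_ : _ - _ = - (V n x - V n x') - (V0 x - V n x) + (V0 x - V0 x')); last by ring.
  apply: (le_trans (ler_normD _ _)).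
  apply: (le_trans (lerD (ler_normB _ _) (lexx _))); rewrite normrN.
  apply: (le_trans (lerD (lerD h1 h) h2)); lra.
apply: filterS => n hQ x xB; apply: hQ; split => /=; rewrite in_itv/= -ler_norml.
  by apply: le_trans xB; rewrite lerDl.
by apply: le_trans xB; rewrite lerDr.
Qed.

(** The product of two weakly convergent sequences is handled by freezing one factor. At an error
    uniform in n, [kk] becomes the Lipschitz kernel [ke eps]; the potentials of f'_n 1_A' then
    converge pointwise, hence uniformly on [A], and the limit potential cut to [A] is a test for the
    f_n. *)
Lemma ben_cvg (f f' : nat -> P -> R) a a' A A' : (forall n, K (f n)) -> (forall n, K (f' n)) -> K a -> K a' ->
  wcv U f a -> wcv U f' a' -> bset A -> bset A' ->
  ben (fun x => f n x * \1_A x) (fun x => f' n x * \1_A' x) @[n --> U] -->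
  ben (fun x => a x * \1_A x) (fun x => a' x * \1_A' x).
Proof.
move=> Kf Kf' Ka Ka' wf wf' bA bA'.
have KA h : K h -> K (fun x => h x * \1_A x) by move=> Kh; apply: K_indic => //; exact: bA.1.
have KA' h : K h -> K (fun x => h x * \1_A' x) by move=> Kh; apply: K_indic => //; exact: bA'.1.
apply/cvgrPdist_le => d d0.
pose G := c_ s * (M1 + 1) + 1.
have G0 : 0 < G by rewrite ltr_wpDl// mulr_ge0// addr_ge0.
have eta0 : 0 < d / 5 / G by rewrite !divr_gt0.
have [eps eps0 heps] := nkc_small p2 e0 ep Mp eta0.
have small h h' : K h -> K h' -> `|ben h h' - \int[mu2]_x (h x * pote eps h' x)| <= d / 5.
  move=> Kh Kh'.
  have hh x : \int[mu2]_y (nkc e eps x y * h' y) <= d / 5 / G.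
    by apply: heps; [exact: K_lp|exact: K_Mp].
  apply: (le_trans (ben_approx eps0 (K_lp Kh) (fun y => K_D Kh) (K_lp Kh') (fun y => K_D Kh') hh)).
  rewrite -mulrA mulrCA; have E5 : d / 5 = d / 5 / G * G by rewrite divfK// gt_eqF.
  rewrite [leRHS]E5; apply: ler_wpM2l; first exact: ltW.
  rewrite /G.
  apply: (@le_trans _ _ (c_ s * (M1 + 1))); last by rewrite lerDl.
  by rewrite ler_wpM2l// (le_trans (K_M1 Kh))// lerDl.
pose V n x := pote eps (fun y => f' n y * \1_A' y) x.
pose V0 x := pote eps (fun y => a' y * \1_A' y) x.
have V_lip h : K h -> forall x x',
    `|pote eps (fun y => h y * \1_A' y) x - pote eps (fun y => h y * \1_A' y) x'|
    <= (Lam eps * M1) * edist x x'.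
  move=> Kh x x'; apply: (le_trans (pote_lip x x' eps0 (K_lp (KA' _ Kh)))).
  rewrite mulrAC ler_wpM2r ?edist_ge0// ler_wpM2l ?Lam_ge0//.
  exact: K_M1 (KA' _ Kh).
have cV x : V n x @[n --> U] --> V0 x.
  have E h : pote eps (fun y => h y * \1_A' y) x = \int[mu2]_y (h y * (ke eps x y * \1_A' y)).
    by apply: eq_Rint => y; rewrite mulrCA.
  rewrite /V /V0 E; under eq_fun do rewrite E.
  apply: wf'; apply: (@bset_btest _ _ _ (c_ s * (eps `^ e)^-1)) => //; first exact: measurable_ke1.
  by move=> y _; rewrite ke_ge0 ke_le.
have [B hB] := bA.2.
have th0 : 0 < d / 5 / (M1 + 1) by rewrite !divr_gt0// ltr_wpDl.
have unif := box_uniform B (mulr_ge0 (Lam_ge0 eps0) M10) th0 (fun n => V_lip _ (Kf' n)) (V_lip _ Ka') cV.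
have LV0 := K_lp (KA' _ Ka').
have cW : \int[mu2]_x (f n x * (V0 x * \1_A x)) @[n --> U] --> \int[mu2]_x (a x * (V0 x * \1_A x)).
  apply: wf; apply: (@bset_btest _ _ _ (c_ s * (eps `^ e)^-1 * Rint (fun y => a' y * \1_A' y))) => //.
    exact: measurable_pote.
  by move=> x _; rewrite pote_ge0// pote_le.
have d5 : 0 < d / 5 by rewrite divr_gt0.
have /cvgrPdist_le /(_ _ d5) := cW.
have integV h h' : K h -> K h' -> integ mu2 (fun x => (h x * \1_A x) * pote eps (fun y => h' y * \1_A' y) x).
  move=> Kh Kh'; have Lh := K_lp (KA _ Kh); have Lh' := K_lp (KA' _ Kh').
  apply: (ge0_integ_le _ (integZ (c_ s * (eps `^ e)^-1 * Rint (fun y => h' y * \1_A' y)) (LP_integ Lh))).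
  - by apply: measurable_funM; [exact: LP_meas Lh|exact: measurable_pote].
  - by move=> x; rewrite (mulr_ge0 (LP_ge0 _ Lh) (pote_ge0 _ _ Lh')).
  - by move=> x; rewrite mulrC ler_wpM2r ?(LP_ge0 _ Lh)// pote_le.
apply: filterS2 unif => n hu hw.
have s1 := small _ _ (KA _ (Kf n)) (KA' _ (Kf' n)).
have s2 := small _ _ (KA _ Ka) (KA' _ Ka').
have E h : \int[mu2]_x (h x * (V0 x * \1_A x)) = \int[mu2]_x ((h x * \1_A x) * V0 x).
  by apply: eq_Rint => x; rewrite (mulrC (V0 x)) mulrA.
rewrite !E in hw.
have s3 : `|\int[mu2]_x ((f n x * \1_A x) * V n x) - \int[mu2]_x ((f n x * \1_A x) * V0 x)| <= d / 5.
  have i1 := integV _ _ (Kf n) (Kf' n); have i2 := integV _ _ (Kf n) Ka'.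
  rewrite -RintB//; apply: (le_trans (le_normr_Rintegral measurableT (integB i1 i2))).
  have LA := K_lp (KA _ (Kf n)).
  apply: (@le_trans _ _ (d / 5 / (M1 + 1) * Rint (fun x => f n x * \1_A x))).
    rewrite -RintZ; last exact: LP_integ LA.
    apply: le_Rint; [exact: integ_norm (integB i1 i2)|by apply: integZ; exact: LP_integ LA|].
    move=> x; rewrite -mulrBr normrM (ger0_norm (LP_ge0 x LA)) mulrC.
    have [xA|xA] := boolP (x \in A); last by rewrite indicE (negbTE xA) !mulr0.
    by apply: ler_wpM2r; [exact: LP_ge0 LA|apply: hu; apply: hB; exact: set_mem].
  rewrite -[leRHS](divfK (_ : M1 + 1 != 0)) ?gt_eqF ?ltr_wpDl//.
  rewrite ler_wpM2l ?(ltW th0)// (le_trans (K_M1 (KA _ (Kf n))))// lerDl//.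
move: s1 s2 s3 hw; rewrite -/(V n) -/V0.
set b1 := ben _ _; set b2 := ben _ _; set r1 := \int[mu2]_x _; set r2 := \int[mu2]_x _; set r3 := \int[mu2]_x _.
move=> s1 s2 s3 hw.
rewrite (_ : b2 - b1 = (b2 - r2) + (r2 - r3) - (r1 - r3) - (b1 - r1)); last by ring.
apply: (le_trans (ler_normB _ _)); apply: (le_trans (lerD (ler_normB _ _) (lexx _))).
apply: (le_trans (lerD (lerD (ler_normD _ _) (lexx _)) (lexx _))).
apply: (le_trans (lerD (lerD (lerD s2 hw) s3) s1)).
exact: four_fifths (ltW d0).
Qed.

(** Tests must be non-negative, so x1 is replaced by its positive part, which makes no difference on
    [D]. *)
Lemma imp_cvg (f : nat -> P -> R) a A : (forall n, K (f n)) -> K a -> wcv U f a -> bset A ->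
  \int[mu2]_x (x.1 * (f n x * \1_A x)) @[n --> U] --> \int[mu2]_x (x.1 * (a x * \1_A x)).
Proof.
move=> Kf Ka wf bA; have [B hB] := bA.2.
have E h : K h -> \int[mu2]_x (x.1 * (h x * \1_A x)) =
    \int[mu2]_x (h x * (Num.max x.1 0 * \1_A x)).
  move=> Kh; apply: eq_Rint => x; have [Dx|nDx] := pselect (D x); last by rewrite (K_D Kh)// !mul0r mulr0.
  by rewrite max_l ?(ltW (Dom_gt0 Dx))// mulrCA.
rewrite (E a Ka); under eq_fun do rewrite (E _ (Kf _)).
apply: wf; apply: (@bset_btest _ _ _ B) => //.
  by apply: measurable_maxr => //; exact: measurable_fst.
move=> x Ax; rewrite le_max lexx orbT /= ge_max.
have h := hB x Ax; rewrite (le_trans (normr_ge0 x.1))//=; last first.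
  by apply: le_trans h; rewrite lerDl.
rewrite andbT; apply: (le_trans (ler_norm _)); apply: le_trans h; by rewrite lerDl.
Qed.

End Limits.

Definition strip (c L : R) : set P := [set x | `|x.2 - c| < L].

Lemma measurable_strip c L : measurable (strip c L).
Proof.
rewrite -[X in measurable X]setTI; apply: (measurable_fun_ltr _ (measurable_cst L)) => //.
by apply: measurableT_comp => //; apply: measurable_funB => //; exact: measurable_snd.
Qed.

(** Suppose every strip of half-width [L] carries less than [m0]. Each potential splits into
    distances below [r] (small by [nkc_small]), distances at least [r] inside the strip (at most
    r^-e times its mass), and the rest (at most L^-e times the total mass). Each part is at most c_s
    beta / (4 G), with G above c_s times the mass bound, so the energy is at most 3 beta / 4. Strips
    suffice because the impulse confines x1. *)
Lemma nonvanishing beta : 0 < beta -> exists m0 L, [/\ 0 < m0, 0 < L &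
  forall f, K f -> beta <= ben f f -> exists c, m0 <= Rint (fun x => f x * \1_(strip c L) x)].
Proof.
move=> beta0; have bb : ~ (beta <= 3 * (beta / 4)) by lra.
pose G := c_ s * M1 + 1.
have G0 : 0 < G by rewrite ltr_wpDl// mulr_ge0.
have b4 : 0 < beta / 4 / G by rewrite !divr_gt0.
have [r r0 hr] := nkc_small p2 e0 ep Mp b4.
have rn0 : 0 < r `^ (- e) by exact: powR_gt0.
have bM : 0 < (M1 + 1) / (beta / 4 / G) by rewrite divr_gt0// ltr_wpDl.
pose L := ((M1 + 1) / (beta / 4 / G)) `^ e^-1.
have L0 : 0 < L by exact: powR_gt0.
have hL : L `^ (- e) * M1 <= beta / 4 / G.
  rewrite powRN /L -powRrM mulVf ?gt_eqF// powRr1 ?(ltW bM)// invf_div.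
  by rewrite mulrAC ler_pdivrMr ?ltr_wpDl// ler_wpM2l ?(ltW b4)// lerDl.
exists (beta / 4 / G / r `^ (- e)), L; split => //; first by rewrite divr_gt0.
move=> f Kf bf; apply: contrapT => /forallNP nc.
have Lf := K_lp Kf.
have f0 x := LP_ge0 x Lf.
have mw c L' : integ mu2 (fun x => f x * \1_(strip c L') x).
  apply: (ge0_integ_le _ (LP_integ Lf)).
  - by apply: measurable_funM; [exact: LP_meas Lf|apply: measurable_indic; exact: measurable_strip].
  - by move=> x; rewrite mulr_ge0.
  - by move=> x; rewrite ler_piMr// indicE; case: (_ \in _).
have pot_small x : pot f x <= c_ s * (3 * (beta / 4 / G)).
  apply: (le_trans (pot_le_nk s01 p2 gp x Lf)); rewrite ler_wpM2l//.
  have i1 := integ_nkc x r0 Lf.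
  have i2 := integZ (r `^ (- e)) (mw x.2 L).
  have i3 := integZ (L `^ (- e)) (LP_integ Lf).
  apply: (@le_trans _ _ (\int[mu2]_y (nkc e r x y * f y + r `^ (- e) * (f y * \1_(strip x.2 L) y)
      + L `^ (- e) * f y))).
    apply: le_Rint; [exact: (integ_nk s01 p2 gp)|exact: integD (integD i1 i2) i3|].
    move=> y; rewrite (mulrC (f y)) mulrA -!mulrDl ler_wpM2r//.
    have [yr|yr] := ltP (edist x y) r.
      rewrite -/e /nkc yr -addrA lerDl addr_ge0 ?powR_ge0// mulr_ge0 ?powR_ge0//.
    have pos : 0 <= nkc e r x y by exact: nkc_ge0.
    have [yL|yL] := ltP `|y.2 - x.2| L.
      rewrite indicE mem_set// mulr1.
      apply: (@le_trans _ _ (r `^ (- e))); last first.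
        by rewrite -addrA addrCA lerDl addr_ge0 ?powR_ge0.
      rewrite /nk powRN lef_pV2 ?posrE ?powR_gt0//; last exact: lt_le_trans yr.
      by apply: ge0_ler_powR => //; rewrite ?nnegrE ?(ltW e0) ?(ltW r0) ?edist_ge0.
    apply: (@le_trans _ _ (L `^ (- e))); last first.
      by rewrite lerDr addr_ge0// mulr_ge0 ?powR_ge0.
    have yL' : L <= edist x y.
      apply: (le_trans yL); rewrite distrC; exact: (norm2_le_eucl (x.1 - y.1, x.2 - y.2)).
    rewrite /nk powRN lef_pV2 ?posrE ?powR_gt0//; last exact: lt_le_trans yL'.
    by apply: ge0_ler_powR => //; rewrite ?nnegrE ?(ltW e0) ?(ltW L0) ?edist_ge0.
  rewrite RintD//; last exact: integD.
  rewrite RintD// RintZ ?(RintZ _ (LP_integ Lf))//.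
  have h1 : \int[mu2]_y (nkc e r x y * f y) <= beta / 4 / G by exact: hr _ _ Lf (K_Mp Kf).
  have h2 : r `^ (- e) * \int[mu2]_x0 (f x0 * \1_(strip x.2 L) x0) <= beta / 4 / G.
    have /negP := nc x.2; rewrite -ltNge => /ltW h.
    by apply: (le_trans (ler_wpM2l (ltW rn0) h)); rewrite mulrC divfK// gt_eqF.
  have h3 : L `^ (- e) * Rint f <= beta / 4 / G.
    by apply: le_trans hL; rewrite ler_wpM2l ?powR_ge0//; exact: K_M1.
  apply: (le_trans (lerD (lerD h1 h2) h3)); rewrite le_eqVlt; apply/orP; left; apply/eqP; ring.
have := ben_le_ub s01 p2 gp Lf Lf pot_small.
move=> h; apply: bb; apply: (le_trans bf); apply: (le_trans h).
have -> : 3 * (beta / 4) = 3 * (beta / 4 / G) * G by field; rewrite gt_eqF.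
rewrite mulrAC mulrC; apply: ler_wpM2l; first by rewrite mulr_ge0// ltW.
by apply: ler_wpDr => //; apply: ler_wpM2l => //; exact: K_M1.
Qed.

End WeakEnergy.

(** [kap n] is the largest k <= n for which P k n holds. It is at least j as soon as j <= n and P j
    n holds, which is the case on a set of [U]; the condition P 0 n makes the maximum exist. *)
Lemma diagonal_filter (U : set_system nat) (FU : ProperFilter U) (P : nat -> nat -> Prop) :
  \oo `<=` U -> (forall k, \near U, P k U) ->
  exists kap : nat -> nat, forall j, \forall n \near U, (j <= kap n)%N /\ P (kap n) n.
Proof.
move=> ooU hP.
pose best n k := P k n /\ (k <= n)%N /\ forall j, (j <= n)%N -> P j n -> (j <= k)%N.
have hbest n : exists k, P 0 n -> best n k.
  have [p0|np0] := pselect (P 0 n); last by exists 0.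
  pose b k := (k <= n)%N && `[< P k n >].
  have exb : exists k, b k by exists 0; rewrite /b leq0n; exact/asboolP.
  have ubb k : b k -> (k <= n)%N by case/andP.
  exists (ex_maxn exb ubb) => _; case: ex_maxnP => k /andP[kn /asboolP pk] mx.
  by split => //; split => // j jn pj; apply: mx; rewrite /b jn; exact/asboolP.
have [kap hk] := choice hbest; exists kap => j.
have oj : U [set n | (j <= n)%N] by apply: ooU; exists j.
apply: filterS3 (hP 0) (hP j) oj => n p0 pj jn.
by have [pk [_ mx]] := hk n p0; split => //; exact: mx.
Qed.

Lemma Et_alg {R : realType} (W u v w i j : R) :
  (u + v + (v + w)) / 2 - W * (i + j) = u / 2 - W * i + (w / 2 - W * j) + v.
Proof. by field. Qed.

Lemma truncation_alg {R : realType} (W e u v w i : R) : u = v + w -> u <= W * i ->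
  e + (w / 2 - W * i) + v <= e - w / 2.
Proof. move=> -> h; rewrite -subr_ge0 in h; rewrite -subr_ge0; lra. Qed.

Lemma half_alg {R : realType} (m u v : R) : m <= u + v -> v <= m / 2 -> m / 2 <= u.
Proof. lra. Qed.

Lemma splitting_alg {R : realType} (W Eu Ea b c m i k e Cp Ev : R) :
  Eu <= Ea + W * i + e -> b <= e -> m <= 3 * e -> i <= e -> 0 < W -> 0 < Cp ->
  e * (2 + W + 3 * Cp) = k -> c <= Cp * m ->
  Eu + Ev + b + c <= Ea + Ev + k.
Proof.
move=> h1 h2 h3 h4 W0 C0 <- h5.
have h6 : W * i <= W * e by rewrite ler_wpM2l// ltW.
have h7 : Cp * m <= Cp * (3 * e) by rewrite ler_wpM2l// ltW.
lra.
Qed.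

Lemma half_le_alg {R : realType} (a b : R) : 0 <= a -> 0 <= b -> a / 2 - b <= a.
Proof. lra. Qed.

Lemma Ea_alg {R : realType} (u v w i : R) : u <= v -> u / 2 - w <= v / 2 - (w + i) + i.
Proof. lra. Qed.

Lemma mass_alg {R : realType} (e u v w : R) : u <= v + e -> v <= e -> w <= e -> u + w <= 3 * e.
Proof. lra. Qed.

Lemma far_alg {R : realType} (n l u v : R) : n + l <= v -> u <= n -> l <= v - u.
Proof. lra. Qed.

Lemma shift_alg {R : realType} (B u v w k : R) : B + k < u + v -> v <= w + k -> B < u + w.
Proof. lra. Qed.

(** The energy balance of the contradiction. [Eu], [Ev], [b], [Ee] are the pieces of the competitor
    and their interaction; primes mark the truncated limits; [Eg] is the energy of the translated
    outer part and [Ef] that of f_n. [Ee] cancels, which leaves the three gains against six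
    errors. *)
Lemma gain_alg {R : realType} (S Eu Ev b Ee Ea Ed Ea' Ed' b' Eg Ef e : R) :
  Eu + Ev + b + Ee <= S -> Ea' - e <= Eu -> Ed' - e <= Ev -> b' - e <= b ->
  Eg <= Ed + Ee + e -> Ef <= Ea + Eg + e -> S - e <= Ef -> 
  (Ea' - Ea) + (Ed' - Ed) + b' <= 6 * e.
Proof. lra. Qed.

(** * Penalised energy: truncation, extraction, splitting *)

Section Compactness.
Context {R : realType}.
Implicit Types x y : plane R.
Local Notation mu2 := (@leb2 R).
Local Notation P := (plane R).
Local Notation Rint f := (\int[mu2]_x f x).
Variables s p W : R.
Hypothesis s01 : 0 < s < 1.
Hypothesis p2 : 2 <= p.
Hypothesis gp : gam s * (p / (p - 1)) < 2.
Hypothesis W0 : 0 < W.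
Implicit Types f g h a d : P -> R.
Local Notation LP := (@LP R p).
Local Notation pot := (@pot R s).
Local Notation ben := (@ben R s).
Local Notation D := (@Dom R s).
Variable z0 : P -> R.
Hypothesis Lz : LP z0.
Local Notation K := (inK D z0).
Local Notation Phi := (Phi (@leb2s R)).
Local Notation rs f A := (fun x => f x * \1_A x).

Let K_lp f : K f -> LP f. Proof. by move=> /(K_LP p2 Lz)[]. Qed.
Let K_M1 f : K f -> Rint f <= Rint z0. Proof. by move=> /(K_LP p2 Lz)[]. Qed.
Let K_Mp f : K f -> Rint (fun x => f x `^ p) <= Rint (fun x => z0 x `^ p).
Proof. by move=> /(K_LP p2 Lz)[]. Qed.
Let K_D f x : K f -> ~ D x -> f x = 0. Proof. by case=> _ _ h _ /h. Qed.
Let K_ge0 f x : K f -> 0 <= f x. Proof. by case. Qed.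
Let K_meas f : K f -> measurable_fun setT f. Proof. by case. Qed.
Let cs0 : 0 <= c_ s. Proof. exact: c_ge0. Qed.

Definition imp f : R := \int[mu2]_x (x.1 * f x).
Definition Et f : R := ben f f / 2 - W * imp f.
(** Only with finite impulse is [Et] the penalised energy; a divergent impulse would give [imp] a
    meaningless real value. *)
Definition KI f : Prop := K f /\ integ mu2 (fun x => x.1 * f x).

Lemma x1_mul_ge0 f x : (forall x, 0 <= f x) -> (forall x, ~ D x -> f x = 0) -> 0 <= x.1 * f x.
Proof.
move=> f0 fD; have [Dx|nDx] := pselect (D x); last by rewrite fD// mulr0.
by apply: mulr_ge0; [exact: ltW (Dom_gt0 Dx)|exact: f0].
Qed.

Lemma x1f_ge0 f x : K f -> 0 <= x.1 * f x.
Proof. by case=> _ f0 fD _; exact: x1_mul_ge0. Qed.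

Lemma measurable_x1f f : measurable_fun setT f -> measurable_fun setT (fun x : P => x.1 * f x).
Proof. by move=> mf; apply: measurable_funM => //; exact: measurable_fst. Qed.

Lemma imp_ge0 f : K f -> 0 <= imp f.
Proof. by move=> Kf; apply: Rint_ge0 => x; exact: x1f_ge0. Qed.

Lemma KI_le f g : KI g -> measurable_fun setT f -> (forall x, 0 <= f x <= g x) -> KI f /\ imp f <= imp g.
Proof.
move=> [Kg ig] mf fg; have Kf := K_le Kg mf fg.
have le1 x : x.1 * f x <= x.1 * g x.
  have [Dx|nDx] := pselect (D x); last by rewrite (K_D Kf)// (K_D Kg)// !mulr0.
  by apply: ler_wpM2l; [exact: ltW (Dom_gt0 Dx)|case/andP: (fg x)].
have mx := measurable_x1f mf.
split; last by apply: ge0_le_Rint => // x; exact: x1f_ge0.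
by split => //; apply: (ge0_integ_le _ ig) => // x; exact: x1f_ge0.
Qed.

Lemma KI_indic f A : KI f -> measurable A -> KI (rs f A) /\ imp (rs f A) <= imp f.
Proof.
move=> Kf mA; have f0 x := K_ge0 x Kf.1; apply: (KI_le Kf).
  by apply: measurable_funM; [exact: K_meas Kf.1|exact: measurable_indic].
by move=> x; rewrite mulr_ge0//= ler_piMr// indicE; case: (_ \in _).
Qed.

Lemma Dom_shift2 c x : D (shift2 c x) <-> D x.
Proof. by rewrite /Dom; case: ifP. Qed.

Lemma KI_shift2 c f : KI f -> [/\ KI (f \o shift2 c), imp (f \o shift2 c) = imp f &
  Et (f \o shift2 c) = Et f].
Proof.
move=> [Kf If]; have Lf := K_lp Kf.
have [i1 i2] := integ_shift2 c (measurable_x1f (K_meas Kf)) (fun x => x1f_ge0 x Kf) If.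
have ei : imp (f \o shift2 c) = imp f by rewrite -[RHS]i2.
split => //; last by rewrite /Et ei (ben_shift2 s01 p2 gp c Lf Lf).
by split => //; apply: K_shift2 => // x; rewrite Dom_shift2.
Qed.

Lemma EtD f g : LP f -> LP g -> integ mu2 (fun x => x.1 * f x) -> integ mu2 (fun x => x.1 * g x) ->
  Et (fun x => f x + g x) = Et f + Et g + ben f g.
Proof.
move=> Lf Lg If Ig; have Lfg := LPD p2 Lf Lg.
rewrite /Et (benDl s01 p2 gp)// !(benDr s01 p2 gp)// (benC s01 p2 gp Lg Lf).
have -> : imp (fun x => f x + g x) = imp f + imp g.
  by rewrite /imp -RintD//; apply: eq_Rint => x; rewrite mulrDr.
exact: Et_alg.
Qed.

(** Hinges with t >= 0 vanish at 0, so functions with disjoint supports contribute separately. *)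
Lemma PhiD f g t : measurable_fun setT f -> measurable_fun setT g -> 0 <= t ->
  (forall x, f x = 0 \/ g x = 0) -> Phi (fun x => f x + g x) t = (Phi f t + Phi g t)%E.
Proof.
move=> mf mg t0 fg; rewrite /Phi -ge0_integralD//; last 4 first.
- by move=> x _; rewrite lee_fin hinge_ge0.
- by apply/measurable_EFinP; exact: measurable_hinge.
- by move=> x _; rewrite lee_fin hinge_ge0.
- by apply/measurable_EFinP; exact: measurable_hinge.
apply: eq_integral => x _; rewrite -EFinD; congr EFin.
have h0 : hinge t 0 = 0 by rewrite /hinge sub0r max_r// oppr_le0.
by case: (fg x) => ->; rewrite ?add0r ?addr0 h0 ?add0r ?addr0.
Qed.

Lemma Phi_shift2 c f t : measurable_fun setT f -> Phi (f \o shift2 c) t = Phi f t.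
Proof.
move=> mf; apply: (@ge0_integral_shift2 _ c (fun x => (hinge t (f x))%:E)) => //.
  by apply/measurable_EFinP; exact: measurable_hinge.
by move=> x; rewrite lee_fin hinge_ge0.
Qed.

Lemma rs_split f A : measurable A -> LP f -> [/\ LP (rs f A), LP (rs f (~` A)) &
  forall x, f x = f x * \1_A x + f x * \1_(~` A) x].
Proof.
move=> mA Lf; have f0 x := LP_ge0 x Lf.
have H B : measurable B -> LP (rs f B).
  move=> mB; apply: (LP_le p2 _ Lf).
    by apply: measurable_funM; [exact: LP_meas Lf|exact: measurable_indic].
  by move=> x; rewrite mulr_ge0//= ler_piMr// indicE; case: (_ \in _).
split; [exact: H|apply: H; exact: measurableC|].
move=> x; rewrite -mulrDr !indicE in_setC; by case: (_ \in _); rewrite ?addr0 ?add0r mulr1.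
Qed.

(* With [A] the set where [pot a x >= W x.1] and [h] the part of [a] off [A], removing
   [h] changes the energy by [W imp h - ben h a + ben h h / 2 >= ben h h / 2]. *)
Lemma truncation a : 0 < c_ s -> KI a -> 0 < Rint a -> exists A, [/\ bset A,
  Et a <= Et (rs a A) & (Rint (rs a A) = 0 -> Et a < Et (rs a A))].
Proof.
move=> c0 [Ka Ia] a0; have La := K_lp Ka.
pose A := [set x | D x] `&` [set x : P | W * x.1 <= pot a x].
have mA : measurable A.
  apply: measurableI; first exact: measurable_Dom.
  have mW : measurable_fun setT (fun x : P => W * x.1).
    by apply: measurable_funM => //; exact: measurable_fst.
  by rewrite -[X in measurable X]setTI; exact: (measurable_fun_ler mW (measurable_pot s La)).
have bA : bset A.
  split => //; have W2 : 0 < W / 2 by rewrite divr_gt0.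
  (* With the constant W / 2 the potential falls strictly below W x1 outside radius [B], so [A] is
     bounded. *)
  have [B B0 hB] := pot_decay s01 p2 gp La (fun x => K_D Ka) W2.
  exists B => x [Dx /= hx]; rewrite leNgt; apply/negP => /(hB x Dx) h.
  have := Dom_gt0 Dx => x0; have := le_trans hx h.
  by rewrite ler_pM2r// leNgt ltr_pdivrMr// ltr_pMr// ltr1n.
have [LA Lh spl] := rs_split mA La.
have [[KA IA] _] := KI_indic (conj Ka Ia) mA.
have [[Kh Ih] _] := KI_indic (conj Ka Ia) (measurableC mA).
set h := rs a (~` A) in Lh Kh Ih spl *; set a' := rs a A in LA KA IA spl *.
have E : Et a = Et a' + Et h + ben a' h.
  by rewrite -EtD//; congr Et; apply/funext => x; exact: spl.
have bha : ben h a = ben a' h + ben h h.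
  rewrite (benC s01 p2 gp LA Lh); have <- := benDr s01 p2 gp LA Lh Lh.
  by congr (ben h _); apply/funext => x; exact: spl.
have bW : ben h a <= W * imp h.
  rewrite /imp -RintZ//; apply: le_Rint; [exact: (integ_ben s01 p2 gp)|exact: integZ|].
  move=> x; rewrite /h /= indicE; have [xA|xA] := boolP (x \in ~` A); last by rewrite !(mulr0, mul0r).
  rewrite mulr1; have [Dx|nDx] := pselect (D x); last by rewrite (K_D Ka)// mul0r !mulr0.
  rewrite mulrA mulrC ler_wpM2r ?(K_ge0 x Ka)// leNgt; apply/negP => /ltW hh.
  by move: xA => /set_mem; apply.
have bhh := ben_ge0 s Lh Lh.
have main : Et a <= Et a' - ben h h / 2.
  by rewrite E /(Et h); exact: truncation_alg bha bW.
exists A; split => //.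
  by apply: (le_trans main); rewrite gerBl divr_ge0.
move=> a'0; apply: (le_lt_trans main); rewrite gtrBl divr_gt0//.
apply: (ben_gt0 s01 p2 gp) => //.
- by move=> y; exact: K_D.
- by move=> y; exact: K_D.
- have : Rint a = Rint a' + Rint h.
    by rewrite -RintD ?(LP_integ LA) ?(LP_integ Lh)//; apply: eq_Rint => x; exact: spl.
  by rewrite a'0 add0r => <-.
- have : Rint a = Rint a' + Rint h.
    by rewrite -RintD ?(LP_integ LA) ?(LP_integ Lh)//; apply: eq_Rint => x; exact: spl.
  by rewrite a'0 add0r => <-.
Qed.

Lemma imp_indic_split f A : KI f -> measurable A -> imp f = imp (rs f A) + imp (rs f (~` A)).
Proof.
move=> Kf mA; have [[KA IA] _] := KI_indic Kf mA; have [[KC IC] _] := KI_indic Kf (measurableC mA).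
have [_ _ spl] := rs_split mA (K_lp Kf.1).
by rewrite /imp -RintD//; apply: eq_Rint => x; rewrite -mulrDr -spl.
Qed.

Lemma tail_boxn f eps : measurable_fun setT f -> (forall x, 0 <= f x) -> integ mu2 f -> 0 < eps ->
  exists N, forall n, (N <= n)%N -> Rint (rs f (~` boxn n)) <= eps.
Proof.
move=> mf f0 If eps0; have [B [B0 hB]] := integ_tail f0 If eps0.
have mnorm := @measurable_norm12 R.
have mB : measurable [set x : P | B < `|x.1| + `|x.2|].
  by rewrite -[X in measurable X]setTI; exact: (measurable_fun_ltr (measurable_cst B) mnorm).
exists (Num.truncn B).+1 => n Bn; apply: le_trans hB.
have E : (fun y : P => if B < `|y.1| + `|y.2| then f y else 0) = rs f [set x : P | B < `|x.1| + `|x.2|].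
  apply/funext => y; rewrite indicE; case: ifP => h; first by rewrite mem_set ?mulr1.
  by rewrite memNset ?mulr0//= h.
rewrite E; apply: ge0_le_Rint.
- apply: measurable_funM => //; apply: measurable_indic; apply: measurableC; exact: (boxn_bset n).1.
- apply: (ge0_integ_le _ If); first by apply: measurable_funM => //; exact: measurable_indic.
  + by move=> x; rewrite mulr_ge0.
  + by move=> x; rewrite ler_piMr// indicE; case: (_ \in _).
- by move=> x; rewrite mulr_ge0.
- move=> x; apply: ler_wpM2l => //; rewrite !indicE.
  have [xn|xn] := boolP (x \in ~` boxn n); last by case: (_ \in _).
  rewrite mem_set//=; move/set_mem: xn => /= /negP; rewrite -ltNge; apply: le_lt_trans.
  by apply: (le_trans (ltW (truncnS_gt _))); rewrite ler_nat.
Qed.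

Section Sequences.
Variables (U : set_system nat) (UU : UltraFilter U).

(** Fatou for the impulse: on each box it is a limit of impulses bounded by [C], and the boxes
    exhaust the plane. *)
Lemma KI_weak (f : nat -> P -> R) a C : (forall n, KI (f n)) -> (\forall n \near U, imp (f n) <= C) ->
  K a -> wcv U f a -> KI a.
Proof.
move=> Kf hC Ka wa; split => //; have La := K_lp Ka.
apply: ge0_integ; [exact: measurable_x1f (K_meas Ka)|by move=> x; exact: x1f_ge0|].
apply: (@le_lt_trans _ _ C%:E); last exact: ltry.
apply: integral_box_le; [exact: measurable_x1f (K_meas Ka)|by move=> x; exact: x1f_ge0|].
move=> n; have bn := boxn_bset (R := R) n.
have i1 : integ mu2 (fun x => x.1 * a x * \1_(boxn n) x).
  apply: (ge0_integ_le _ (integZ n%:R (LP_integ La))).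
  - by apply: measurable_funM; [exact: measurable_x1f (K_meas Ka)|apply: measurable_indic; exact: bn.1].
  - by move=> x; rewrite mulr_ge0// x1f_ge0.
  - move=> x; have a0 := K_ge0 x Ka; rewrite indicE; have [xn|_] := boolP (x \in _); last by rewrite mulr0 mulr_ge0.
    rewrite mulr1 ler_wpM2r//; apply: (le_trans (ler_norm _)); apply: le_trans (set_mem xn).
    by rewrite lerDl.
rewrite (EFin_Rint i1) lee_fin.
have E : Rint (fun x => x.1 * a x * \1_(boxn n) x) = imp (rs a (boxn n)).
  by apply: eq_Rint => x; rewrite mulrA.
rewrite E; apply: (cvgr_to_le (imp_cvg (fun m => (Kf m).1) Ka wa bn)).
apply: filterS hC => m h; apply: le_trans h; exact: (KI_indic (Kf m) bn.1).2.
Qed.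

(** [nonvanishing] provides strips of mass at least [m0], whose centres are moved to x2 = 0. The
    mass beyond x1 = X is at most C / X <= m0 / 2 by the choice of [X], so a fixed box keeps mass m0
    / 2, and this bound passes to the weak limit. *)
Lemma extraction (g : nat -> P -> R) beta C : 0 < beta -> 0 <= C -> (forall n, KI (g n)) ->
  (\forall n \near U, beta <= ben (g n) (g n)) -> (\forall n \near U, imp (g n) <= C) ->
  exists (c : nat -> R) d, [/\ KI d, 0 < Rint d & wcv U (fun n => g n \o shift2 (c n)) d].
Proof.
move=> beta0 C0 Kg hb hC.
have [m0 [L [m00 L0 hm]]] := nonvanishing s01 p2 gp Lz beta0.
have ex n : exists c, beta <= ben (g n) (g n) -> m0 <= Rint (rs (g n) (strip c L)).
  have [b|nb] := pselect (beta <= ben (g n) (g n)); last by exists 0.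
  by have [c hc] := hm _ (Kg n).1 b; exists c.
have [c hc] := choice ex.
pose h n := g n \o shift2 (c n).
have Kh n : KI (h n) by have [] := KI_shift2 (c n) (Kg n).
have hCh : \forall n \near U, imp (h n) <= C.
  by apply: filterS hC => n; have [_ -> _] := KI_shift2 (c n) (Kg n).
have [d [Kd wd]] := K_weak_compact p2 (measurable_Dom s) Lz UU (fun n => (Kh n).1).
exists c, d; split => //; first exact: KI_weak Kh hCh Kd wd.
pose X := 2 * (C + 1) / m0.
have X0 : 0 < X by rewrite !divr_gt0// mulr_gt0// ltr_wpDl.
pose N := (Num.truncn (L + X)).+1.
have hN : L + X <= N%:R by exact: ltW (truncnS_gt _).
have mb := (boxn_bset (R := R) N).1.
have mass : \forall n \near U, m0 / 2 <= Rint (rs (h n) (boxn N)).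
  apply: filterS2 hb hCh => n hbn hCn.
  have Lg := K_lp (Kg n).1; have Lh := K_lp (Kh n).1; have h0 x := LP_ge0 x Lh.
  have [Lgs _ _] := rs_split (measurable_strip (c n) L) Lg.
  have [Lhs _ _] := rs_split (measurable_strip 0 L) Lh.
  have [Lhb _ _] := rs_split mb Lh.
  have e1 : Rint (rs (g n) (strip (c n) L)) = Rint (rs (h n) (strip 0 L)).
    have [_ <-] := integ_shift2 (c n) (LP_meas Lgs) (fun x => LP_ge0 x Lgs) (LP_integ Lgs).
    apply: eq_Rint => x; rewrite /h /= !indicE; congr (_ * _%:R).
    congr nat_of_bool; apply/idP/idP => /set_mem hx; apply/mem_set; move: hx; rewrite /strip /= subr0 addrK//.
  have Ib := integD (LP_integ Lhb) (integZ X^-1 (Kh n).2).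
  have e2 : Rint (rs (h n) (strip 0 L)) <= Rint (rs (h n) (boxn N)) + X^-1 * imp (h n).
    rewrite -(RintZ _ (Kh n).2) -(RintD (LP_integ Lhb) (integZ X^-1 (Kh n).2)); apply: le_Rint => //; first exact: LP_integ Lhs.
    move=> x; have pos : 0 <= X^-1 * (x.1 * h n x).
      by apply: mulr_ge0; [rewrite invr_ge0 ltW|exact: x1f_ge0 (Kh n).1].
    have [Dx|nDx] := pselect (D x); last by rewrite (K_D (Kh n).1 nDx) !(mul0r, mulr0) addr0.
    rewrite [X in X <= _]mulrC [X in _ <= X + _]mulrC !indicE.
    have [xs|_] := boolP (x \in strip 0 L); last by rewrite mul0r addr_ge0// mulr_ge0.
    have [xb|xb] := boolP (x \in boxn N); first by rewrite lerDl.
    rewrite mul1r mul0r add0r ler_pdivlMl// ler_wpM2r//.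
    move/negP: xb => xb; rewrite leNgt; apply/negP => xX; apply: xb; apply/mem_set.
    rewrite /boxn /=; apply: le_trans hN; rewrite addrC; apply: lerD.
      by apply: ltW; move: (set_mem xs); rewrite /strip /= subr0.
    by rewrite gtr0_norm ?(Dom_gt0 Dx)// ltW.
  have := hc n hbn; rewrite e1 => /le_trans /(_ e2) => le3.
  have le4 : X^-1 * imp (h n) <= m0 / 2.
    rewrite ler_pdivrMl// /X; apply: (le_trans hCn).
    have -> : 2 * (C + 1) / m0 * (m0 / 2) = C + 1 by field; rewrite gt_eqF.
    by rewrite lerDl.
  exact: half_alg le3 le4.
have := wd _ (bset_btest1 (boxn_bset N)) => cv.
apply: (@lt_le_trans _ _ (m0 / 2)); first by rewrite divr_gt0.
apply: le_trans (le_Rint_indic (K_lp Kd) mb).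
exact: (cvgr_to_ge cv).
Qed.


Definition outer (r : R) : set P := [set x | r < `|x.2|].

Lemma measurable_outer r : measurable (outer r).
Proof.
rewrite -[X in measurable X]setTI; apply: (measurable_fun_ltr (measurable_cst r)) => //.
by apply: measurableT_comp => //; exact: measurable_snd.
Qed.

Lemma ben_self_split f g : LP f -> LP g -> ben g (fun x => f x + g x) = ben f g + ben g g.
Proof. by move=> Lf Lg; rewrite (benDr s01 p2 gp Lf Lg Lg) (benC s01 p2 gp Lg Lf). Qed.

(** Let [w] be the part of [f] on A and B and [m] the remainder. The loss Et m + ben w m is at most
    ben m m + ben w m = ben m f, that is, the mass of [m] against a bounded potential. *)
Lemma Et_le_split3 Cp f A B : (forall h x, K h -> pot h x <= Cp) -> KI f -> measurable A -> measurable B ->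
  A `&` B = set0 ->
  Et f <= Et (rs f A) + Et (rs f B) + ben (rs f A) (rs f B) + Cp * Rint (rs f (~` (A `|` B))).
Proof.
move=> hCp Kf mA mB AB0; have Lf := K_lp Kf.1.
have mAB := measurableU _ _ mA mB.
have [LAB LC spl] := rs_split mAB Lf.
have [[KAB IAB] _] := KI_indic Kf mAB.
have [[KC IC] _] := KI_indic Kf (measurableC mAB).
have [[KA IA] _] := KI_indic Kf mA; have [[KB IB] _] := KI_indic Kf mB.
have LA := K_lp KA; have LB := K_lp KB.
set u := rs f A in KA IA LA *; set v := rs f B in KB IB LB *.
set m := rs f (~` (A `|` B)) in LC spl KC IC *; set w := rs f (A `|` B) in LAB spl KAB IAB.
have Ew : w = (fun x => u x + v x).
  apply/funext => x; rewrite /w /u /v /= -mulrDr; congr (_ * _).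
  have /(congr1 (fun C => x \in C)) := AB0; rewrite in_setI in_set0 !indicE in_setU.
  by case: (x \in A); case: (x \in B) => //= _; rewrite ?addr0 ?add0r.
have Ef : f = (fun x => w x + m x) by apply/funext => x; exact: spl.
have E1 : Et f = Et w + Et m + ben w m by rewrite [in LHS]Ef; exact: EtD.
have E2 : Et w = Et u + Et v + ben u v by rewrite Ew; exact: EtD.
have E3 : ben m f = ben w m + ben m m.
  by rewrite [X in ben m X]Ef; exact: ben_self_split.
have h1 : ben m f <= Cp * Rint m.
  by apply: (ben_le_ub s01 p2 gp LC Lf) => x; exact: hCp Kf.1.
have h2 := ben_ge0 s LC LC.
have h3 : 0 <= W * imp m by apply: mulr_ge0; [exact: ltW|exact: imp_ge0].
rewrite E1 E2 /(Et m); rewrite -(addrA (Et u + Et v + ben u v)) lerD2l; apply: le_trans h1.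
rewrite E3 addrC lerD2l; move: h2 h3; move: (ben m m) (W * imp m) => a1 a2; exact: half_le_alg.
Qed.

Lemma far_small e : 0 < e -> exists2 L, 0 < L & forall f g, K f -> K g ->
  (forall x y, f x != 0 -> g y != 0 -> L <= edist x y) -> ben f g <= e.
Proof.
move=> e0; pose b := 2 - 2 * s; have b0 : 0 < b by rewrite /b; have := s01; lra.
have M0 : 0 <= Rint z0 by apply: Rint_ge0 => x; exact: LP_ge0 Lz.
have G0 : 0 < c_ s * (Rint z0 * Rint z0) + 1.
  by rewrite ltr_wpDl//; apply: mulr_ge0 => //; apply: mulr_ge0.
pose t := e / (c_ s * (Rint z0 * Rint z0) + 1).
have t0 : 0 < t by rewrite divr_gt0.
have L0 : 0 < t `^ (- b^-1) by exact: powR_gt0.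
exists (t `^ (- b^-1)) => // f g Kf Kg sep.
apply: (le_trans (ben_far s01 p2 gp (K_lp Kf) (K_lp Kg) L0 sep)).
have -> : (t `^ (- b^-1)) `^ (- (2 - 2 * s)) = t.
  by rewrite -/b -powRrM mulrNN mulVf ?gt_eqF// powRr1// ltW.
have h : Rint g * Rint f <= Rint z0 * Rint z0.
  apply: ler_pM; [by apply: Rint_ge0 => x; exact: K_ge0|by apply: Rint_ge0 => x; exact: K_ge0|exact: K_M1|exact: K_M1].
rewrite -mulrA (mulrC (c_ s)) -mulrA.
have -> : e = t * (c_ s * (Rint z0 * Rint z0) + 1) by rewrite /t divfK// gt_eqF.
apply: ler_wpM2l; first exact: ltW.
by apply: ler_wpDr => //; apply: ler_wpM2l.
Qed.

Lemma Et_cvg (f : nat -> P -> R) a A : (forall n, K (f n)) -> K a -> wcv U f a -> bset A ->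
  Et (rs (f n) A) @[n --> U] --> Et (rs a A).
Proof.
move=> Kf Ka wa bA; apply: cvgB.
  by apply: cvgMl; exact: (ben_cvg s01 p2 gp Lz UU Kf Kf Ka Ka wa wa bA bA).
by apply: cvgMr; exact: (imp_cvg Kf Ka wa bA).
Qed.

(** Three regions: a box holding almost all of [a], where energies converge; the outer part, at
    distance at least [L] from the box; and what lies between. The latter has small mass: up to x1 =
    X it is compared with the tail of [a] on the bounded set [Q], beyond X it is controlled by the
    impulse. *)
Lemma splitting (f : nat -> P -> R) a C eps : 0 < eps -> 0 <= C -> (forall n, KI (f n)) ->
  (\forall n \near U, imp (f n) <= C) -> KI a -> wcv U f a ->
  exists R0, forall r, R0 <= r -> \forall n \near U,
    Et (f n) <= Et a + Et (rs (f n) (outer r)) + eps.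
Proof.
move=> eps0 C0 Kf hC Ka wa.
have [Cp Cp0 hCp'] := pot_ub s01 p2 gp (Rint z0) (Rint (fun x => z0 x `^ p)).
have hCp h x : K h -> pot h x <= Cp by move=> Kh; apply: hCp'; [exact: K_lp|exact: K_M1|exact: K_Mp].
have den0 : 0 < 2 + W + 3 * Cp by rewrite !addr_gt0// mulr_gt0.
pose e1 := eps / (2 + W + 3 * Cp).
(* The budget [eps] pays for the convergence in the box and the interaction with the outer part (2
   e1), the impulse of [a] lost outside the box (W e1), and a potential bounded by [Cp] against a
   mass of at most 3 e1. *)
have e10 : 0 < e1 by rewrite divr_gt0.
have ek : e1 * (2 + W + 3 * Cp) = eps by rewrite divfK// gt_eqF.
have [L L0 hL] := far_small e10.
have La := K_lp Ka.1.
have [N1 hN1] := tail_boxn (LP_meas La) (fun x => LP_ge0 x La) (LP_integ La) e10.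
have [N2 hN2] := tail_boxn (measurable_x1f (K_meas Ka.1)) (fun x => x1f_ge0 x Ka.1) Ka.2 e10.
pose N := maxn N1 N2.
have tail1 : Rint (rs a (~` boxn N)) <= e1 by apply: hN1; exact: leq_maxl.
have tail2 : imp (rs a (~` boxn N)) <= e1.
  apply: le_trans (hN2 N (leq_maxr _ _)); rewrite le_eqVlt; apply/orP; left; apply/eqP.
  by apply: eq_Rint => x; rewrite mulrA.
have bN := boxn_bset (R := R) N.
exists (N%:R + L) => r Rr.
pose X := (C + 1) / e1.
have X0 : 0 < X by rewrite divr_gt0// ltr_wpDl.
pose N' := (Num.truncn (r + X)).+1.
have hN' : r + X <= N'%:R by exact: ltW (truncnS_gt _).
have bN' := boxn_bset (R := R) N'.
pose Q := boxn N' `&` ~` boxn N : set P.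
have bQ : bset Q by apply: bsetI => //; apply: measurableC; exact: bN.1.
have [KaN IaN] := KI_indic Ka bN.1.
have Ea : Et (rs a (boxn N)) <= Et a + W * imp (rs a (~` boxn N)).
  rewrite /Et [imp a](imp_indic_split Ka bN.1) mulrDr.
  have : ben (rs a (boxn N)) (rs a (boxn N)) <= ben a a.
    have la x : a x * \1_(boxn N) x <= a x by rewrite ler_piMr ?(LP_ge0 x La)// indicE; case: (_ \in _).
    by have LN := K_lp KaN.1; apply: (le_ben s01 p2 gp).
  by move: (ben _ _) (ben a a) (W * _) (W * _) => u v w i; exact: Ea_alg.
have near1 : \forall n \near U, Et (rs (f n) (boxn N)) <= Et (rs a (boxn N)) + e1.
  have cv := Et_cvg (fun m => (Kf m).1) Ka.1 wa bN.
  have lt1 : Et (rs a (boxn N)) < Et (rs a (boxn N)) + e1 by rewrite ltrDl.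
  by apply: filterS (cvgr_lt _ cv _ lt1) => n /ltW.
have near2 : \forall n \near U, Rint (rs (f n) Q) <= Rint (rs a Q) + e1.
  have cv := wa _ (bset_btest1 bQ).
  have lt1 : Rint (rs a Q) < Rint (rs a Q) + e1 by rewrite ltrDl.
  by apply: filterS (cvgr_lt _ cv _ lt1) => n /ltW.
have aQ : Rint (rs a Q) <= e1.
  have [_ LC _] := rs_split bN.1 La; have [LQ _ _] := rs_split bQ.1 La.
  apply: le_trans tail1; apply: le_Rint; [exact: LP_integ LQ|exact: LP_integ LC|].
  move=> x; apply: ler_wpM2l; first exact: LP_ge0 La.
  by rewrite /Q !indicE in_setI; case: (_ \in boxn N'); case: (_ \in ~` _).
have mo := measurable_outer r.
apply: filterS3 hC near1 near2 => n hCn h1 h2.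
have dis : boxn N `&` outer r = set0.
  apply/seteqP; split => // x [] /=; rewrite /boxn /outer /= => xN xr.
  have : `|x.2| <= N%:R by apply: le_trans xN; rewrite lerDr.
  move=> /(lt_le_trans xr); rewrite ltNge => /negP; apply.
  by apply: le_trans Rr; rewrite lerDl ltW.
apply: (le_trans (Et_le_split3 hCp (Kf n) bN.1 mo dis)).
have Lf := K_lp (Kf n).1; have f0 x := LP_ge0 x Lf.
set m := rs (f n) (~` _).
have [_ Lm _] := rs_split (measurableU _ _ bN.1 mo) Lf.
have [LQ _ _] := rs_split bQ.1 Lf.
have Ib := integD (LP_integ LQ) (integZ X^-1 (Kf n).2).
have mass : Rint m <= 3 * e1.
  apply: (@le_trans _ _ (Rint (rs (f n) Q) + X^-1 * imp (f n))).
    rewrite -(RintZ _ (Kf n).2) -(RintD (LP_integ LQ) (integZ X^-1 (Kf n).2)); apply: le_Rint => //; first exact: LP_integ Lm.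
    move=> x; have pos : 0 <= X^-1 * (x.1 * f n x).
      by apply: mulr_ge0; [rewrite invr_ge0 ltW|exact: x1f_ge0 (Kf n).1].
    have [Dx|nDx] := pselect (D x); last by rewrite /m (K_D (Kf n).1 nDx) !(mul0r, mulr0) addr0.
    rewrite /m /= [X in X <= _]mulrC [X in _ <= X + _]mulrC !indicE.
    have [xm|_] := boolP (x \in ~` _); last by rewrite mul0r addr_ge0// mulr_ge0.
    have [xb|xb] := boolP (x \in Q); first by rewrite lerDl.
    rewrite mul1r mul0r add0r ler_pdivlMl// ler_wpM2r//.
    move/negP: xb => xb; rewrite leNgt; apply/negP => xX; apply: xb; apply/mem_set.
    move/set_mem: xm => xm; split; last by move=> xN; apply: xm; left.
    rewrite /boxn /=; apply: le_trans hN'; rewrite addrC; apply: lerD.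
      by rewrite leNgt; apply/negP => xr; apply: xm; right.
    by rewrite gtr0_norm ?(Dom_gt0 Dx)// ltW.
  have : X^-1 * imp (f n) <= e1.
    rewrite ler_pdivrMl// /X divfK ?gt_eqF//; apply: (le_trans hCn).
    by rewrite lerDl.
  move: h2 aQ; move: (Rint (rs (f n) Q)) (Rint (rs a Q)) (X^-1 * _); exact: mass_alg.
have far : ben (rs (f n) (boxn N)) (rs (f n) (outer r)) <= e1.
  apply: hL; [by apply: (KI_indic (Kf n) bN.1).1.1|by apply: (KI_indic (Kf n) mo).1.1|].
  move=> x y; rewrite !indicE.
  have [xN _|_] := boolP (x \in boxn N); last by rewrite mulr0 eqxx.
  have [yr _|_] := boolP (y \in outer r); last by rewrite mulr0 eqxx.
  move: (set_mem xN) (set_mem yr); rewrite /boxn /outer /= => hx hy.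
  apply: le_trans (norm2_le_eucl (x.1 - y.1, x.2 - y.2)) => /=.
  rewrite distrC; apply: le_trans (lerB_dist _ _).
  have : `|x.2| <= N%:R by apply: le_trans hx; rewrite lerDr.
  move: (ltW (le_lt_trans Rr hy)); move: `|x.2| `|y.2| => u v; exact: far_alg.
have h5 := le_trans h1 (lerD Ea (lexx e1)).
exact: (splitting_alg (Et (rs (f n) (outer r))) h5 far mass tail2 W0 Cp0 ek (lexx (Cp * Rint m))).
Qed.


Lemma wcv_shift2 (f : nat -> P -> R) a l : (forall n, K (f n)) -> K a -> wcv U f a ->
  wcv U (fun n => f n \o shift2 l) (a \o shift2 l).
Proof.
move=> Kf Ka wa g bg.
have mg : measurable_fun setT (g \o shift2 (- l)).
  by apply: measurableT_comp; [exact: bg.1|exact: measurable_shift2].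
have g0 x : 0 <= g x by case: bg => _ [C [B h]]; case: (h x) => /andP[].
have bg' : btest (g \o shift2 (- l)).
  split => //; case: bg => _ [C [B h]]; exists C, (B + `|l|) => x; have [h1 h2] := h (shift2 (- l) x).
  split => // hx; apply: h2; rewrite /shift2 /=.
  have : `|x.2| <= `|x.2 - l| + `|l| by rewrite -{1}(subrK l x.2) ler_normD.
  move: hx; move: `|x.1| `|x.2| `|x.2 - l| `|l| => u v w k; exact: shift_alg.
have E h : K h -> Rint (fun x => (h \o shift2 l) x * g x) = Rint (fun x => h x * (g \o shift2 (- l)) x).
  move=> Kh; congr fine.
  rewrite -(@ge0_integral_shift2 _ l (fun x => (h x * (g \o shift2 (- l)) x)%:E)).
  - apply: eq_integral => x _; congr EFin; congr (_ * g _).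
    by rewrite /shift2 /= addrK; case: x.
  - by apply/measurable_EFinP; apply: measurable_funM => //; exact: K_meas.
  - by move=> x; rewrite lee_fin; apply: mulr_ge0; [exact: K_ge0 x Kh|exact: g0].
rewrite (E a Ka); under eq_fun do rewrite (E _ (Kf _)).
exact: wa.
Qed.

End Sequences.

(** The reason why a function assembled from disjoint pieces of [f] still satisfies the constraint
    obeyed by [f]. *)
Lemma Phi_rs_disjoint f A B t : measurable_fun setT f -> (forall x, 0 <= f x) -> 0 <= t ->
  measurable A -> measurable B -> A `&` B = set0 ->
  (Phi (rs f A) t + Phi (rs f B) t <= Phi f t)%E.
Proof.
move=> mf f0 t0 mA mB AB0.
have m1 C : measurable C -> measurable_fun setT (rs f C).
  by move=> mC; apply: measurable_funM => //; exact: measurable_indic.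
have dis x : (x \in A) && (x \in B) = false.
  by have /(congr1 (fun C => x \in C)) := AB0; rewrite in_setI in_set0.
rewrite -PhiD //; [|exact: m1|exact: m1|].
  apply: le_Phi => //; first by apply: measurable_funD; exact: m1.
  move=> x; rewrite -mulrDr ler_piMr// !indicE; have := dis x.
  by case: (x \in A); case: (x \in B) => //= _; rewrite ?addr0 ?add0r.
move=> x; rewrite !indicE; have := dis x; case: (x \in A); case: (x \in B) => //= _; rewrite mulr0; by [left|right].
Qed.

Lemma rs_shift2 f A l : rs (f \o shift2 l) (shift2 l @^-1` A) = rs f A \o shift2 l.
Proof.
by apply/funext => x; rewrite /= !indicE; congr (_ * _%:R); congr nat_of_bool.
Qed.

(* The pieces [rs f A] and (a translate of) [rs g A'] sit side by side inside the hole
   [|x.2| <= r] left by [rs g (outer r)]; being disjoint pieces of [f], they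
   stay in the weak closure, and their mutual interaction is a pure gain. *)
Lemma competitor S f r1 cc A A' r l : (forall h, KI h -> Et h <= S) -> KI f ->
  measurable A -> measurable A' -> A `&` outer r1 = set0 -> A' `&` outer r = set0 ->
  A `&` (shift2 l @^-1` A') = set0 -> (A `|` (shift2 l @^-1` A')) `&` outer r = set0 ->
  forall g, g = rs f (outer r1) \o shift2 cc ->
  Et (rs f A) + Et (rs g A') + ben (rs f A) (rs (g \o shift2 l) (shift2 l @^-1` A'))
  + Et (rs g (outer r)) <= S.
Proof.
move=> HS Kf mA mA' d1 d2 d3 d4 g Eqg.
have mo r' := measurable_outer r'.
have [Kb Ib] := KI_indic Kf (mo r1).
have := KI_shift2 cc Kb; rewrite -Eqg => -[Kg Ig Eg].
have [KA IA] := KI_indic Kf mA.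
have [KA' IA'] := KI_indic Kg mA'.
have [Ke Ie] := KI_indic Kg (mo r).
have [Kv Iv Ev] := KI_shift2 l KA'.

rewrite rs_shift2 -Ev.
set u := rs f A in KA IA *; set v := rs g A' \o shift2 l in Kv Iv Ev *; set e := rs g (outer r) in Ke Ie *.
have Lu := K_lp KA.1; have Lv := K_lp Kv.1; have Le := K_lp Ke.1.
have Luv := LPD p2 Lu Lv; have Luve := LPD p2 Luv Le.
have mA'' : measurable (shift2 l @^-1` A').
  by rewrite -[X in measurable X]setTI; exact: measurable_shift2.
have indis A1 A2 x : A1 `&` A2 = set0 -> (x \in A1) && (x \in A2) = false.
  by move=> A120; have /(congr1 (fun C => x \in C)) := A120; rewrite in_setI in_set0.
have vE : v = rs (g \o shift2 l) (shift2 l @^-1` A') by rewrite rs_shift2.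
have duv x : u x = 0 \/ v x = 0.
  rewrite vE /u /= !indicE; have := indis _ _ x d3.
  case: (x \in A); case: (x \in shift2 l @^-1` A') => //= _; rewrite mulr0; by [left|right].
have duve x : u x + v x = 0 \/ e x = 0.
  rewrite vE /u /e /= !indicE; have := indis _ _ x d4; rewrite in_setU.
  case: (x \in A); case: (x \in shift2 l @^-1` A'); case: (x \in outer r) => //= _; rewrite !mulr0 ?addr0; by [left|right].
have Iuv := integD KA.2 Kv.2.
have E12 : integ mu2 (fun x => x.1 * (u x + v x)).
  by rewrite (_ : (fun x => _) = (fun x => x.1 * u x + x.1 * v x))//; apply/funext => x; rewrite mulrDr.
have E123 : integ mu2 (fun x => x.1 * (u x + v x + e x)).
  rewrite (_ : (fun x => _) = (fun x => x.1 * (u x + v x) + x.1 * e x)); last by apply/funext => x; rewrite mulrDr.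
  exact: integD E12 Ke.2.
have Kh : KI (fun x => u x + v x + e x).
  split => //; split.
  - exact: LP_meas Luve.
  - by move=> x; exact: LP_ge0 Luve.
  - by move=> x nD; rewrite (K_D KA.1 nD) (K_D Kv.1 nD) (K_D Ke.1 nD) !addr0.
  - move=> t t0; have t0' := ltW t0.
    rewrite (PhiD (LP_meas Luv) (LP_meas Le) t0' duve) (PhiD (LP_meas Lu) (LP_meas Lv) t0' duv).
    rewrite (Phi_shift2 l t (K_meas KA'.1)) -addeA.
    apply: (@le_trans _ _ (Phi f t)); last by case: Kf => [[_ _ _ /(_ t t0)]].
    apply: le_trans (Phi_rs_disjoint (K_meas Kf.1) (fun x => K_ge0 x Kf.1) t0' mA (mo r1) d1).
    rewrite leeD2l//.
    apply: (le_trans (Phi_rs_disjoint (K_meas Kg.1) (fun x => K_ge0 x Kg.1) t0' mA' (mo r) d2)).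
    by rewrite Eqg (Phi_shift2 cc t (K_meas Kb.1)).
apply: le_trans (HS _ Kh).
rewrite (EtD Luv Le E12 Ke.2) (EtD Lu Lv KA.2 Kv.2).
by rewrite lerDl; exact: (ben_ge0 s Luv Le).
Qed.

End Compactness.

Lemma bset_bound {R : realType} (A : set (plane R)) : bset A ->
  measurable A /\ exists2 B : R, 0 < B & forall x, A x -> `|x.1| + `|x.2| <= B.
Proof.
move=> [mA [B hB]]; split => //; exists (`|B| + 1); first by rewrite ltr_wpDl.
by move=> x Ax; apply: (le_trans (hB x Ax)); apply: (le_trans (ler_norm _)); rewrite lerDl.
Qed.

Lemma bset_shift2 {R : realType} l (A : set (plane R)) : bset A -> bset (shift2 l @^-1` A).
Proof.
move=> [mA [B hB]]; split.
  by rewrite -[X in measurable X]setTI; exact: measurable_shift2.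
exists (B + `|l|) => x /hB; rewrite /shift2 /= => h.
have : `|x.2| <= `|x.2 + l| + `|l| by rewrite -{1}(addrK l x.2) ler_normB.
by move: h; move: `|x.1| `|x.2| `|x.2 + l| `|l| => u v w k; lra.
Qed.

Lemma beta_alg {R : realType} (S a f b m : R) : S - (S - a) / 2 / 2 <= f ->
  f <= a + b + (S - a) / 2 / 2 -> b <= m / 2 -> 0 <= m -> (S - a) / 2 <= m.
Proof. lra. Qed.

Lemma hole_alg {R : realType} (B B' l r u v : R) : 0 <= u -> u + v <= B' -> r < v ->
  B' + l + B <= r -> 0 < l -> 0 < B -> False.
Proof. lra. Qed.

Lemma sep_alg {R : realType} (B B' u v w : R) : 0 <= u -> u + v <= B -> u + w <= B' ->
  B + B' + 1 <= w + v -> False.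
Proof. lra. Qed.

Lemma hole_alg2 {R : realType} (B B' l r u v : R) : 0 <= u -> u + v <= B ->
  B' + l + B <= r -> 0 < l -> 0 < B' -> r < v -> False.
Proof. lra. Qed.

Lemma hole_alg3 {R : realType} (B B' l r u v w : R) : 0 <= u -> u + w <= B' -> r < v ->
  v <= w + l -> B' + l + B <= r -> 0 < B -> False.
Proof. lra. Qed.

(** * Maximising sequences *)

Section MaximizingSequence.
Context {R : realType}.
Implicit Types x y : plane R.
Local Notation mu2 := (@leb2 R).
Local Notation P := (plane R).
Local Notation Rint f := (\int[mu2]_x f x).
Variables s p W : R.
Hypothesis s01 : 0 < s < 1.
Hypothesis p2 : 2 <= p.
Hypothesis gp : gam s * (p / (p - 1)) < 2.
Hypothesis W0 : 0 < W.
Implicit Types f g h a d : P -> R.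
Local Notation LP := (@LP R p).
Local Notation pot := (@pot R s).
Local Notation ben := (@ben R s).
Local Notation D := (@Dom R s).
Variable z0 : P -> R.
Hypothesis Lz : LP z0.
Local Notation K := (inK D z0).
Local Notation KI := (KI s z0).
Local Notation Et := (Et s W).
Local Notation rs f A := (fun x => f x * \1_A x).
Variable S : R.
Hypothesis S0 : 0 < S.
Hypothesis HS : forall h, KI h -> Et h <= S.
Hypothesis c0 : 0 < c_ s.
Variables (U : set_system nat) (UU : UltraFilter U).
Hypothesis ooU : \oo `<=` U.

Let K_lp f : K f -> LP f. Proof. by move=> /(K_LP p2 Lz)[]. Qed.
Let K_D f x : K f -> ~ D x -> f x = 0. Proof. by case=> _ _ h _ /h. Qed.

(** A non-negative penalised energy bounds W I by the energy, which is bounded on the whole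
    class. *)
Lemma Et_imp_bound : exists2 C, 0 <= C & forall f, KI f -> 0 <= Et f -> imp f <= C.
Proof.
have [Cp Cp0 hCp'] := pot_ub s01 p2 gp (Rint z0) (Rint (fun x => z0 x `^ p)).
have M0 : 0 <= Rint z0 by apply: Rint_ge0 => x; exact: LP_ge0 Lz.
exists (Cp * Rint z0 / W); first by apply: divr_ge0; [apply: mulr_ge0; [exact: ltW|exact: M0]|exact: ltW].
move=> f [Kf If]; have [Lf M1 Mp _ _] := K_LP p2 Lz Kf.
have hb : ben f f <= Cp * Rint f by apply: (ben_le_ub s01 p2 gp Lf Lf) => x; exact: hCp'.
have hb2 : ben f f <= Cp * Rint z0 by apply: (le_trans hb); rewrite ler_wpM2l// ltW.
have hb0 := ben_ge0 s Lf Lf.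
rewrite /Et subr_ge0 => h; rewrite ler_pdivlMr// mulrC; apply: (le_trans h); apply: le_trans hb2.
by rewrite ler_pdivrMr// ler_peMr// ler1n.
Qed.

(** If one of the truncations is trivial, removing the whole function was already a strict gain.
    Otherwise both pieces carry mass and their interaction is positive. *)
Lemma strict_gain a A d A' l : KI a -> KI d -> bset A -> bset A' ->
  0 < Rint a -> 0 < Rint d ->
  Et a <= Et (rs a A) -> (Rint (rs a A) = 0 -> Et a < Et (rs a A)) ->
  Et d <= Et (rs d A') -> (Rint (rs d A') = 0 -> Et d < Et (rs d A')) ->
  0 < (Et (rs a A) - Et a) + (Et (rs d A') - Et d)
      + ben (rs a A) (rs (d \o shift2 l) (shift2 l @^-1` A')).
Proof.
move=> Ka Kd bA bA' a0 d0 h1 h2 h3 h4.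
have [KA _] := KI_indic Ka bA.1.
have [KA' _] := KI_indic Kd bA'.1.
have [Kv Iv _] := KI_shift2 W s01 p2 gp Lz l KA'.
rewrite rs_shift2; have LA := K_lp KA.1; have LA' := K_lp KA'.1; have Lv := K_lp Kv.1.
have b0 := ben_ge0 s LA Lv.
have RA : 0 <= Rint (rs a A) by apply: Rint_ge0 => x; exact: LP_ge0 LA.
have RA' : 0 <= Rint (rs d A') by apply: Rint_ge0 => x; exact: LP_ge0 LA'.
rewrite -subr_ge0 in h1; rewrite -subr_ge0 in h3.
have [z|nz] := eqVneq (Rint (rs a A)) 0.
  by rewrite ltr_wpDr// ltr_wpDr// subr_gt0 h2.
have [z'|nz'] := eqVneq (Rint (rs d A')) 0.
  by rewrite ltr_wpDr// ltr_wpDl// subr_gt0 h4.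
apply: ltr_wpDl; first exact: addr_ge0.
apply: (ben_gt0 s01 p2 gp) => //.
- by move=> y nD; exact: K_D KA.1 nD.
- by move=> y nD; exact: K_D Kv.1 nD.
- by rewrite lt_neqAle eq_sym nz.
- have [_ ->] := integ_shift2 l (LP_meas LA') (fun x => LP_ge0 x LA') (LP_integ LA').
  by rewrite lt_neqAle eq_sym nz'.
Qed.

(** [splitting] is used twice: for [f] against [a] with radii growing with n, so that the remainder
    [b n] leaves every bounded set, and for its translate [g] against [d] at a fixed radius [r].
    What [g] has beyond [r] is kept in the competitor, since nothing is known about its limit. *)
Lemma limit_attains (f : nat -> P -> R) a : (forall n, KI (f n)) ->
  Et (f n) @[n --> U] --> S -> KI a -> 0 < Rint a -> wcv U f a -> Et a = S.
Proof.
move=> Kf cS Ka a0 wa; apply: le_anti; rewrite HS//= leNgt; apply/negP => aS.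
have [C C0 hC] := Et_imp_bound.
have nearS e : 0 < e -> \forall n \near U, S - e <= Et (f n).
  move=> e0; have lt1 : S - e < S by rewrite gtrBl.
  by apply: filterS (cvgr_gt _ cS _ lt1) => n /ltW.
have fC : \forall n \near U, imp (f n) <= C.
  by apply: filterS (nearS _ S0) => n; rewrite subrr => h; exact: hC.
have hsplit k : exists R0, forall r, R0 <= r -> \forall n \near U,
    Et (f n) <= Et a + Et (rs (f n) (outer r)) + k.+1%:R^-1.
  by apply: (splitting s01 p2 gp W0 Lz UU _ C0 Kf fC Ka wa); rewrite invr_gt0.
have [R0 hR0] := choice hsplit.
(* [R0 k] makes the splitting valid with error 1/(k+1); [k] forces the radii to infinity. *)
pose rk k := Num.max (R0 k) k%:R.
have [kap hkap] := diagonal_filter _ ooU (fun k => hR0 k (rk k) ltac:(by rewrite le_max lexx)).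
pose b n := rs (f n) (outer (rk (kap n))).
have Kb n : KI (b n) by exact: (KI_indic (Kf n) (measurable_outer _)).1.
have bC : \forall n \near U, imp (b n) <= C.
  by apply: filterS fC => n h; apply: le_trans h; exact: (KI_indic (Kf n) (measurable_outer _)).2.
have fb e : 0 < e -> \forall n \near U, Et (f n) <= Et a + Et (b n) + e.
  move=> e0; have [j _ hj] : \forall j \near \oo, (j.+1%:R^-1 : R) < e.
    exact: near_infty_natSinv_lt (PosNum e0).
  apply: filterS (hkap j) => n [jk] /le_trans; apply; rewrite lerD2l.
  apply: ltW; apply: le_lt_trans (hj j (leqnn _)).
  by rewrite lef_pV2 ?posrE ?ltr0n// ler_nat ltnS.
have rkap (B : R) : \forall n \near U, B <= rk (kap n).
  apply: filterS (hkap (Num.truncn B).+1) => n [jk _]; rewrite /rk le_max; apply/orP; right.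
  by apply: (le_trans (ltW (truncnS_gt _))); rewrite ler_nat.
(* Half the deficit: up to errors beta / 2 in the value of f_n and in the splitting, the remainder
   must supply the energy that [a] lacks. *)
pose beta := (S - Et a) / 2.
have beta0 : 0 < beta by rewrite divr_gt0// subr_gt0.
have hb : \forall n \near U, beta <= ben (b n) (b n).
  have be2 : 0 < beta / 2 by rewrite divr_gt0.
  apply: filterS2 (nearS _ be2) (fb _ be2) => n h1 h2.
  have h3 : Et (b n) <= ben (b n) (b n) / 2.
    rewrite /Et gerBl; apply: mulr_ge0; [exact: ltW|].
    exact: imp_ge0 (Kb n).1.
  have h4 := ben_ge0 s (K_lp (Kb n).1) (K_lp (Kb n).1).
  exact: beta_alg h1 h2 h3 h4.
have [c' [d [Kd d0 wd]]] := extraction W s01 p2 gp Lz UU beta0 C0 Kb hb bC.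
pose g n := b n \o shift2 (c' n).
have Kg n : KI (g n) by have [] := KI_shift2 W s01 p2 gp Lz (c' n) (Kb n).
have Eg n : Et (g n) = Et (b n) by have [] := KI_shift2 W s01 p2 gp Lz (c' n) (Kb n).
have gC : \forall n \near U, imp (g n) <= C.
  by apply: filterS bC => n; have [_ <- _] := KI_shift2 W s01 p2 gp Lz (c' n) (Kb n).
have [A [bA hA sA]] := truncation s01 p2 gp W0 Lz c0 Ka a0.
have [A' [bA' hA' sA']] := truncation s01 p2 gp W0 Lz c0 Kd d0.
have [mA [B B0 hB]] := bset_bound bA; have [mA' [B' B'0 hB']] := bset_bound bA'.
(* A vertical translation by more than the sum of the two radii makes the second bounded set
   disjoint from the first. *)
pose l := B + B' + 1.
have bA'' := bset_shift2 l bA'.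
have gain := strict_gain l Ka Kd bA bA' a0 d0 hA sA hA' sA'.
set G := (X in 0 < X) in gain.
(* The final balance contains six errors [e], whose sum stays below the gain [G]. *)
pose e := G / 8.
have e0 : 0 < e by rewrite divr_gt0.
have [R1 hR1] := splitting s01 p2 gp W0 Lz UU e0 C0 Kg gC Kd wd.
(* Beyond the radius required by the splitting, the hole must contain [A] and the translated second
   set. *)
pose r := Num.max R1 (B' + l + B).
have rR1 : R1 <= r by rewrite le_max lexx.
have rB : B' + l + B <= r by rewrite le_max lexx orbT.
have l0 : 0 < l by rewrite /l; apply: ltr_wpDl => //; apply: addr_ge0; exact: ltW.
have d2 : A' `&` outer r = set0.
  apply/seteqP; split => // x [/hB' h1]; rewrite /outer /= => h2.
  by move: h1 h2 rB l0 B0; have := normr_ge0 x.1; move: `|x.1| `|x.2| => u v; exact: hole_alg.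
have d3 : A `&` (shift2 l @^-1` A') = set0.
  apply/seteqP; split => // x [/hB h1 /hB']; rewrite /shift2 /= => h2.
  have h3 : l <= `|x.2 + l| + `|x.2|.
    by apply: (le_trans (ler_norm l)); rewrite -{1}(addKr x.2 l) addrC; exact: ler_normB.
  move: h1 h2 h3; have := normr_ge0 x.1; move: `|x.1| `|x.2| `|x.2 + l| => u v w; exact: sep_alg.
have d4 : (A `|` (shift2 l @^-1` A')) `&` outer r = set0.
  apply/seteqP; split => // x [[/hB h1|/hB']]; rewrite /outer /=.
    by move: h1 rB l0 B'0; have := normr_ge0 x.1; move: `|x.1| `|x.2| => u v; exact: hole_alg2.
  move=> h1 h2.
  have h3 : `|x.2| <= `|x.2 + l| + l by have := ler_normB (x.2 + l) l; rewrite addrK (gtr0_norm l0).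
  by move: h1 h2 h3 rB B0; have := normr_ge0 x.1; move: `|x.1| `|x.2| `|x.2 + l| => u v w; exact: hole_alg3.
have near_ge (v : nat -> R) v0 : v n @[n --> U] --> v0 -> \forall n \near U, v0 - e <= v n.
  move=> cv; have lt1 : v0 - e < v0 by rewrite gtrBl.
  by apply: filterS (cvgr_gt _ cv _ lt1) => n /ltW.
have Kf1 n := (Kf n).1; have Kg1 n := (Kg n).1.
have n1 := near_ge _ _ (Et_cvg (W := W) s01 p2 gp Lz UU Kf1 Ka.1 wa bA).
have n2 := near_ge _ _ (Et_cvg (W := W) s01 p2 gp Lz UU Kg1 Kd.1 wd bA').
have Kgl n : K (g n \o shift2 l) by have [[]] := KI_shift2 W s01 p2 gp Lz l (Kg n).
have [[Kdl _] _ _] := KI_shift2 W s01 p2 gp Lz l Kd.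
have n3 := near_ge _ _ (ben_cvg s01 p2 gp Lz UU Kf1 Kgl Ka.1 Kdl wa (wcv_shift2 Kg1 Kd.1 wd) bA bA'').
have nI (X Y : set nat) : U X -> U Y -> U (X `&` Y) by exact: filterI.
have /filter_ex[n [[[m1 m2] [m3 m4]] [[m5 m6] m7]]] := nI _ _ (nI _ _ (nI _ _ n1 n2) (nI _ _ n3 (hR1 r rR1)))
  (nI _ _ (nI _ _ (fb _ e0) (nearS _ e0)) (rkap B)).
have d1 : A `&` outer (rk (kap n)) = set0.
  apply/seteqP; split => // x [/hB h1]; rewrite /outer /= => h2.
  have : `|x.2| <= B by apply: le_trans h1; rewrite lerDr.
  by move=> /le_trans /(_ m7); rewrite leNgt h2.
have m8 := competitor s01 p2 gp Lz HS (Kf n) mA mA' d1 d2 d3 d4 (erefl (g n)).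
rewrite -Eg in m5.
have := gain_alg m8 m1 m2 m3 m4 m5 m6.
rewrite -/G leNgt /e => /negP; apply.
by rewrite mulrA ltr_pdivrMr// mulrC ltr_pM2l// ltr_nat.
Qed.

Lemma maximizing_limit (f : nat -> P -> R) : (forall n, KI (f n)) ->
  Et (f n) @[n --> U] --> S -> exists (c : nat -> R) a,
  [/\ KI a, Et a = S & wcv U (fun n => f n \o shift2 (c n)) a].
Proof.
move=> Kf cS; have [C C0 hC] := Et_imp_bound.
have S2 : 0 < S / 2 by rewrite divr_gt0.
have lt1 : S / 2 < S by rewrite ltr_pdivrMr// ltr_pMr// ltr1n.
have nS : \forall n \near U, S / 2 < Et (f n) by exact: (cvgr_gt _ cS _ lt1).
have fC : \forall n \near U, imp (f n) <= C.
  by apply: filterS nS => n h; apply: hC => //; exact: ltW (lt_trans S2 h).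
have hb : \forall n \near U, S / 2 <= ben (f n) (f n).
  apply: filterS nS => n /ltW h; have h3 : Et (f n) <= ben (f n) (f n) / 2.
    rewrite /Et gerBl; apply: mulr_ge0; [exact: ltW|exact: imp_ge0 (Kf n).1].
  have h4 := ben_ge0 s (K_lp (Kf n).1) (K_lp (Kf n).1).
  apply: (le_trans h); apply: (le_trans h3).
  by rewrite ler_pdivrMr// ler_peMr// ler1n.
have [c [a [Ka a0 wa]]] := extraction W s01 p2 gp Lz UU S2 C0 Kf hb fC.
exists c, a; split => //.
apply: (limit_attains _ _ Ka a0 wa).
  by move=> n; have [] := KI_shift2 W s01 p2 gp Lz (c n) (Kf n).
have E n : Et (f n \o shift2 (c n)) = Et (f n) by have [] := KI_shift2 W s01 p2 gp Lz (c n) (Kf n).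
by under eq_fun do rewrite E.
Qed.

End MaximizingSequence.

Lemma mul_le_sqrD {R : realType} (u v : R) : 0 <= (u + v) ^+ 2 -> 0 <= (u - v) ^+ 2 -> u * v <= u ^+ 2 + v ^+ 2.
Proof. by rewrite sqrrD sqrrB; lra. Qed.

Lemma strong_alg {R : realType} (z f2 a2 e ag fg fa : R) : a2 - e / 4 <= ag -> ag - e / 4 <= fg -> fg <= fa ->
  f2 <= z -> z <= a2 -> f2 + a2 - 2 * fa <= e.
Proof. lra. Qed.

Lemma young1 {R : realType} (v t : R) : 0 < t -> `|v| <= t + t^-1 * v ^+ 2.
Proof.
move=> t0; have [h|h] := leP `|v| t; first by rewrite ler_wpDr// mulr_ge0 ?sqr_ge0// invr_ge0 ltW.
rewrite ler_wpDl ?(ltW t0)// ler_pdivlMl// -[v ^+ 2]real_normK ?num_real// expr2.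
by rewrite ler_wpM2r// ltW.
Qed.

Lemma abs_alg1 {R : realType} (v t w : R) : 0 <= t -> 0 <= w -> `|v| <= t + w -> `|v| - v <= 2 * (t + w).
Proof. by have := ler_norm (- v); rewrite normrN; lra. Qed.

Lemma abs_alg2 {R : realType} (u v w : R) : 0 <= u -> 0 <= v -> 0 <= w -> `|u - v| - (u - v) <= 2 * (v + w).
Proof. by move=> *; have [h|h] := leP 0 (u - v); rewrite ?(ger0_norm h) ?(ltr0_norm h); lra. Qed.

Lemma sixth_alg {R : realType} (e tB w f a m : R) : m <= e / 6 -> tB <= e / 6 -> w <= e / 6 -> f <= a ->
  f - a + 2 * (m + tB + w) <= e.
Proof. lra. Qed.

Lemma reduction_alg {R : realType} (d e u1 u2 u3 u4 u5 u6 : R) : 0 < e -> u1 - u2 <= d -> - d <= u3 - u4 ->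
  u5 - u6 <= d -> u2 - u4 <= e / 4 -> u6 <= e / 4 -> d <= e / 8 -> u1 - u3 + u5 <= e.
Proof. lra. Qed.

Lemma hinge_min_hinge {R : realType} (t tau h u : R) : 0 <= t ->
  hinge t (Num.min (hinge tau u) h) <= hinge (t + tau) u.
Proof.
move=> t0; apply: (@le_trans _ _ (hinge t (hinge tau u))); first by apply: le_hinge; rewrite ge_min lexx.
rewrite {2}/hinge; have [h1|h1] := leP u tau.
  by rewrite max_r ?subr_le0// {1}/hinge max_r ?hinge_ge0// subr_le0.
rewrite max_l ?subr_ge0 ?(ltW h1)// /hinge le_eqVlt; apply/orP; left; apply/eqP.
by congr (Num.max _ _); ring.
Qed.

(** * Strong convergence and reduction to the weak closure *)

Section Strong.
Context {R : realType}.
Implicit Types x y : plane R.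
Local Notation mu2 := (@leb2 R).
Local Notation P := (plane R).
Local Notation Rint f := (\int[mu2]_x f x).
Variables (p : R) (D : set P).
Hypothesis p2 : 2 <= p.
Implicit Types f g h a d : P -> R.
Local Notation LP := (@LP R p).
Variable z0 : P -> R.
Hypothesis Lz : LP z0.
Local Notation K := (inK D z0).
Local Notation rs f A := (fun x => f x * \1_A x).

Lemma integ_mul f g : measurable_fun setT f -> measurable_fun setT g ->
  integ mu2 (fun x => f x ^+ 2) -> integ mu2 (fun x => g x ^+ 2) -> integ mu2 (fun x => f x * g x).
Proof.
move=> mf mg if2 ig2; apply: (integ_le _ (integD if2 ig2)); first exact: measurable_funM.
move=> x; rewrite normrM -[f x ^+ 2]real_normK ?num_real// -[g x ^+ 2]real_normK ?num_real//.
by have := sqr_ge0 (`|f x| - `|g x|); have := sqr_ge0 (`|f x| + `|g x|);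
  move: (`|f x|) (`|g x|) => u v; exact: mul_le_sqrD.
Qed.

(** Expand the square: the norm of f_n is at most that of [z0], hence that of [a], so a lower bound
    of the product with [a] suffices. As [a] need not be a test, it is replaced by the truncations
    [g N] below it, which are tests and whose product with [a] approaches the square of its norm. *)
Lemma strong_L2 (U : set_system nat) (UU : UltraFilter U) (f : nat -> P -> R) a :
  (forall n, K (f n)) -> K a -> wcv U f a -> \int[mu2]_x (z0 x ^+ 2) <= \int[mu2]_x (a x ^+ 2) ->
  forall e, 0 < e -> \forall n \near U, integ mu2 (fun x => (f n x - a x) ^+ 2) /\ 
    \int[mu2]_x ((f n x - a x) ^+ 2) <= e.
Proof.
move=> Kf Ka wa za e e0.
have [La _ _ ia2 _] := K_LP p2 Lz Ka.
have ma := LP_meas La; have a0 x := LP_ge0 x La.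
pose g (N : nat) x := Num.min (a x) N%:R * \1_(boxn N) x.
have g0 N x : 0 <= g N x by rewrite mulr_ge0// le_min a0 ler0n.
have mg N : measurable_fun setT (g N).
  apply: measurable_funM; last by apply: measurable_indic; exact: (boxn_bset N).1.
  by apply: measurable_minr => //; exact: measurable_cst.
have ga N x : g N x <= a x.
  apply: (@le_trans _ _ (Num.min (a x) N%:R)); last by rewrite ge_min lexx.
  by rewrite ler_piMr ?le_min ?a0 ?ler0n// indicE; case: (_ \in _).
have btg N : btest (g N).
  apply: (@bset_btest _ _ _ N%:R (boxn_bset N)); first by apply: measurable_minr => //; exact: measurable_cst.
  by move=> x _; rewrite le_min a0 ler0n ge_min lexx orbT.
have [_ cvN] : integ mu2 (fun x => a x ^+ 2) /\
    \int[mu2]_x (a x * g n x) @[n --> \oo] --> \int[mu2]_x (a x ^+ 2).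
  apply: (Rint_dct _ ia2).
  - by move=> n; exact: measurable_funM.
  - move=> n x; have m0 : 0 <= a x * g n x by apply: mulr_ge0.
    by rewrite (ger0_norm m0) expr2; apply: ler_wpM2l.
  - move=> x; apply: cvg_near_cst; exists (Num.truncn (`|x.1| + `|x.2| + a x)).+1 => // n /= hn.
    have h : `|x.1| + `|x.2| + a x <= n%:R.
      by apply: (le_trans (ltW (truncnS_gt _))); rewrite ler_nat.
    rewrite /g indicE mem_set ?mulr1 /boxn /=; last by apply: le_trans h; rewrite lerDl.
    by rewrite min_l ?expr2//; apply: le_trans h; rewrite lerDr addr_ge0.
have e4 : 0 < e / 4 by rewrite divr_gt0.
have lt1 : \int[mu2]_x (a x ^+ 2) - e / 4 < \int[mu2]_x (a x ^+ 2) by rewrite gtrBl.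
have [N _ hN] : \forall n \near \oo, \int[mu2]_x (a x ^+ 2) - e / 4 < \int[mu2]_x (a x * g n x).
  exact: (cvgr_gt _ cvN _ lt1).
have h1 := ltW (hN N (leqnn N)).
have lt2 : \int[mu2]_x (a x * g N x) - e / 4 < \int[mu2]_x (a x * g N x) by rewrite gtrBl.
have nU : \forall n \near U, \int[mu2]_x (a x * g N x) - e / 4 < \int[mu2]_x (f n x * g N x).
  exact: (cvgr_gt _ (wa _ (btg N)) _ lt2).
apply: filterS nU => n /ltW h2.
have [Lf _ _ if2 f2] := K_LP p2 Lz (Kf n).
have mf := LP_meas Lf; have f0 x := LP_ge0 x Lf.
have ifa := integ_mul mf ma if2 ia2.
have h3 : \int[mu2]_x (f n x * g N x) <= \int[mu2]_x (f n x * a x).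
  apply: ge0_le_Rint => //; first exact: measurable_funM.
  - by move=> x; rewrite mulr_ge0.
  - by move=> x; rewrite ler_wpM2l.
have i2 := integB (integD if2 ia2) (integZ 2 ifa).
have E : (fun x => (f n x - a x) ^+ 2) = (fun x => f n x ^+ 2 + a x ^+ 2 - 2 * (f n x * a x)).
  by apply/funext => x; ring.
rewrite E; split => //.
rewrite (RintB (integD if2 ia2) (integZ 2 ifa)) (RintD if2 ia2) (RintZ _ ifa).
exact: strong_alg h1 h2 h3 f2 za.
Qed.

(** In a box |v| <= t + v^2 / t reduces to the L^2 distance. Outside, |f - a| <= (f - a) + 2 a. The
    signed term f - a integrates to at most 0 because [a] has at least the mass of [z0], so only the
    tail of [a] remains and no tightness of f_n is required. *)
Lemma strong_L1 (U : set_system nat) (UU : UltraFilter U) (f : nat -> P -> R) a :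
  (forall n, K (f n)) -> K a -> wcv U f a -> \int[mu2]_x (z0 x ^+ 2) <= \int[mu2]_x (a x ^+ 2) ->
  Rint z0 <= Rint a ->
  forall e, 0 < e -> \forall n \near U, \int[mu2]_x `|f n x - a x| <= e.
Proof.
move=> Kf Ka wa za z1 e e0.
have [La _ _ ia2 _] := K_LP p2 Lz Ka.
have ma := LP_meas La; have a0 x := LP_ge0 x La.
have e6 : 0 < e / 6 by rewrite divr_gt0.
have [N hN'] := tail_boxn ma a0 (LP_integ La) e6; have hN := hN' N (leqnn N).
have bN := boxn_bset (R := R) N.
have i1 : integ mu2 (fun x => \1_(boxn N) x : R).
  have [_ [C hC]] := btest_wtest (bset_btest1 bN).
  by apply: (ge0_integ_le _ (integZ C (@integ_gweight R))) => [|x|x]; [apply: measurable_indic; exact: bN.1|by []|case/andP: (hC x)].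
set B := Rint (fun x => \1_(boxn N) x : R).
have B0 : 0 <= B by apply: Rint_ge0.
pose t := e / 6 / (B + 1).
have t0 : 0 < t by rewrite divr_gt0// ltr_wpDl.
have tB : t * B <= e / 6.
  by rewrite /t mulrAC ler_pdivrMr ?ltr_wpDl// ler_wpM2l ?(ltW e6)// lerDl.
have te : 0 < t * (e / 6) by rewrite mulr_gt0.
apply: filterS (strong_L2 UU Kf Ka wa za te) => n [i2 h2].
have [Lf f1 _ _ _] := K_LP p2 Lz (Kf n).
have mf := LP_meas Lf; have f0 x := LP_ge0 x Lf.
have [_ Lt _] : [/\ LP (rs a (boxn N)), LP (rs a (~` boxn N)) & forall x, a x = a x * \1_(boxn N) x + a x * \1_(~` boxn N) x].
  exact: (rs_split p2 bN.1 La).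
have ib := integB (LP_integ Lf) (LP_integ La).
have itot := integD (integD (LP_integ Lt) (integZ t i1)) (integZ t^-1 i2).
have pt x : `|f n x - a x| <= (f n x - a x) + 2 * (a x * \1_(~` boxn N) x + t * \1_(boxn N) x + t^-1 * (f n x - a x) ^+ 2).
  have s0 : 0 <= t^-1 * (f n x - a x) ^+ 2 by apply: mulr_ge0; [rewrite invr_ge0 ltW|exact: sqr_ge0].
  rewrite -[_ - _ + _]addrC -lerBlDr !indicE in_setC; case: (x \in boxn N) => /=; rewrite ?mulr0 ?mulr1 ?add0r ?addr0.
    have := young1 (f n x - a x) t0; move: s0; move: (t^-1 * _) => w; move: (f n x - a x) => v; exact: abs_alg1 (ltW t0).
  move: s0; move: (t^-1 * _) => w; have := a0 x; have := f0 x; move: (f n x) (a x) => u v; exact: abs_alg2.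
have inorm := integ_norm ib.
apply: (le_trans (le_Rint inorm (integD ib (integZ 2 itot)) pt)).
rewrite (RintD ib (integZ 2 itot)) (RintB (LP_integ Lf) (LP_integ La)) (RintZ 2 itot).
rewrite (RintD (integD (LP_integ Lt) (integZ t i1)) (integZ t^-1 i2)) (RintD (LP_integ Lt) (integZ t i1)).
rewrite (RintZ t i1) (RintZ _ i2) -/B.
have h3 : t^-1 * \int[mu2]_x ((f n x - a x) ^+ 2) <= e / 6 by rewrite ler_pdivrMl.
have h4 : Rint (f n) <= Rint a by exact: le_trans z1.
exact: sixth_alg hN tB h3 h4.
Qed.


Definition rphi f (t : R) : R := Rint (fun x => hinge t (f x)).

Lemma integ_hinge f t : LP f -> 0 <= t -> integ mu2 (fun x => hinge t (f x)).
Proof.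
move=> Lf t0; apply: (ge0_integ_le _ (LP_integ Lf)).
- by apply: measurable_hinge; exact: LP_meas Lf.
- by move=> x; exact: hinge_ge0.
- by move=> x; apply: hinge_le => //; exact: LP_ge0 Lf.
Qed.

Lemma rphi_ge0 f t : 0 <= rphi f t.
Proof. by apply: Rint_ge0 => x; exact: hinge_ge0. Qed.

Lemma le_rphi f t t' : LP f -> 0 <= t -> t <= t' -> rphi f t' <= rphi f t.
Proof.
move=> Lf t0 tt'; apply: le_Rint; [apply: integ_hinge => //; exact: le_trans tt'|exact: integ_hinge|].
by move=> x; rewrite /hinge ge_max !le_max lexx orbT andbT lerB.
Qed.

(** The slope of [rphi f] at t is the measure of {f > t}, which Chebyshev bounds by the mass over
    [c]. *)
Lemma rphi_lip f t t' c : LP f -> 0 < c -> c <= t -> t <= t' ->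
  rphi f t - rphi f t' <= (t' - t) / c * Rint f.
Proof.
move=> Lf c0 ct tt'.
have t0 : 0 <= t by exact: le_trans (ltW c0) ct.
have i1 := integ_hinge Lf t0; have i2 := integ_hinge Lf (le_trans t0 tt').
rewrite -RintB// -(RintZ _ (LP_integ Lf)); apply: le_Rint; [exact: integB|by apply: integZ; exact: LP_integ Lf|].
move=> x; have f0 := LP_ge0 x Lf.
have d0 : 0 <= t' - t by rewrite subr_ge0.
rewrite /hinge mulrAC ler_pdivlMr//; have [h|h] := leP (f x) t.
  rewrite max_r ?subr_le0// max_r ?subr_le0 ?(le_trans h)// subrr mul0r; exact: mulr_ge0.
rewrite max_l ?subr_ge0 ?(ltW h)//.
apply: (@le_trans _ _ ((t' - t) * c)); last by apply: ler_wpM2l => //; exact: le_trans ct (ltW h).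
apply: ler_wpM2r; first exact: ltW.
have : f x - t' <= Num.max (f x - t') 0 by rewrite le_max lexx.
move: (Num.max _ _) => m; lra.
Qed.

Lemma rphi_cvg0 f e : LP f -> 0 < e -> exists N : nat, rphi f N%:R <= e.
Proof.
move=> Lf e0.
have [_ cv] : integ mu2 (fun=> 0 : R) /\ rphi f n%:R @[n --> \oo] --> \int[mu2]_x (0 : R).
  apply: (Rint_dct _ (LP_integ Lf)).
  - by move=> n; apply: measurable_hinge; exact: LP_meas Lf.
  - by move=> n x; rewrite ger0_norm ?hinge_ge0// hinge_le// (LP_ge0 x Lf).
  - move=> x; apply: cvg_near_cst; exists (Num.truncn (f x)).+1 => // n /= hn.
    rewrite /hinge max_r// subr_le0; apply: (le_trans (ltW (truncnS_gt _))).
    by rewrite ler_nat.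
rewrite Rint_cst0 in cv.
have [N _ hN] : \forall n \near \oo, rphi f n%:R < e by exact: (cvgr_lt _ cv _ e0).
by exists N; apply: ltW; apply: hN => /=.
Qed.

Lemma rphi_cvgr f e : LP f -> 0 < e -> exists2 t, 0 < t & Rint f - rphi f t <= e.
Proof.
move=> Lf e0.
have [_ cv] : integ mu2 f /\ rphi f n.+1%:R^-1 @[n --> \oo] --> Rint f.
  apply: (Rint_dct _ (LP_integ Lf)).
  - by move=> n; apply: measurable_hinge; exact: LP_meas Lf.
  - by move=> n x; rewrite ger0_norm ?hinge_ge0// hinge_le// ?invr_ge0// (LP_ge0 x Lf).
  - move=> x; have f0 := LP_ge0 x Lf; apply/cvgrPdist_le => d d0.
    apply: filterS (near_infty_natSinv_lt (PosNum d0)) => n /= hn.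
    have i0 : 0 <= n.+1%:R^-1 :> R by rewrite invr_ge0.
    rewrite ger0_norm ?subr_ge0 ?hinge_le//; apply: le_trans (ltW hn).
    by rewrite lerBlDr -lerBlDl /hinge le_max lexx.
have lt1 : Rint f - e < Rint f by rewrite gtrBl.
have [N _ hN] : \forall n \near \oo, Rint f - e < rphi f n.+1%:R^-1 by exact: (cvgr_gt _ cv _ lt1).
exists N.+1%:R^-1; first by rewrite invr_gt0.
by have := hN N (leqnn N); rewrite ltrBlDr lerBlDl => /ltW.
Qed.

(** Thresholds move upwards from [c] in steps [k] so short that [rphi] drops by at most e / 2 each
    time. At the first value not above [e] the previous one exceeds [e], so the new one is positive.
    A level is thus found that costs little when cut off, yet lies below the top of [f]. *)
Lemma rphi_ivt f e : LP f -> 0 < Rint f -> 0 < e -> exists2 t, 0 < t & 0 < rphi f t <= e.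
Proof.
move=> Lf f0 e0.
have f2 : 0 < Rint f / 2 by rewrite divr_gt0.
have [c c0 hc] := rphi_cvgr Lf f2.
have pc : 0 < rphi f c by move: hc f0; move: (Rint f) (rphi f c) => u v; lra.
have e2 : 0 < e / 2 by rewrite divr_gt0.
pose k := e / 2 * c / (Rint f).
have k0 : 0 < k by rewrite divr_gt0// mulr_gt0.
pose t n := c + n%:R * k.
have ct n : c <= t n by rewrite lerDl mulr_ge0// ltW.
have [N hN] := rphi_cvg0 Lf e0.
have ex : exists n, rphi f (t n) <= e.
  exists (Num.truncn (N%:R / k)).+1; apply: le_trans hN; apply: le_rphi => //.
  apply: ler_wpDl; first exact: ltW.
  by rewrite -ler_pdivrMr//; exact: ltW (truncnS_gt _).
case: (ex_minnP ex) => -[h0 _|n hn mn].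
  by exists c => //; move: h0; rewrite /t mul0r addr0 pc.
exists (t n.+1); first exact: lt_le_trans c0 (ct _).
rewrite hn andbT.
have hlt : e < rphi f (t n) by rewrite ltNge; apply/negP => /mn; rewrite ltnn.
have tt : t n <= t n.+1 by rewrite lerD2l ler_wpM2r ?ler_nat// ltW.
have := rphi_lip Lf c0 (ct n) tt.
have -> : (t n.+1 - t n) / c * Rint f = e / 2.
  by rewrite /t /k -addn1 natrD; field; rewrite !gt_eqF.
by move: hlt e0; move: (rphi f _) (rphi f _) => u v; lra.
Qed.



Hypothesis z0_gt0 : 0 < Rint z0.

Lemma Phi_rphi f t : LP f -> 0 <= t -> (Phi (@leb2s R) f t = (rphi f t)%:E)%E.
Proof. by move=> Lf t0; exact: (EFin_Rint (integ_hinge Lf t0)). Qed.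

Lemma rphi0 f : LP f -> rphi f 0 = Rint f.
Proof. by move=> Lf; apply: eq_Rint => x; rewrite /hinge subr0 max_l// (LP_ge0 x Lf). Qed.

(* Take [f = min ((xi - tau)_+, h)]: then [Phi f t <= Phi xi (t + tau)] for [t < h] and
   [Phi f t = 0] otherwise, so it is enough that
   [delta <= Phi z0 t - Phi z0 (t + tau)] for [t < h]; the right-hand side is at least
   [tau * |{z0 > h + tau}|]. *)
Lemma reduction e : 0 < e -> exists2 delta, 0 < delta &
  forall xi, LP xi -> (forall x, ~ D x -> xi x = 0) ->
    (forall t, 0 <= t -> `|rphi xi t - rphi z0 t| <= delta) ->
    exists f, [/\ K f, forall x, f x <= xi x & \int[mu2]_x (xi x - f x) <= e].
Proof.
move=> e0.
have e4 : 0 < e / 4 by rewrite divr_gt0.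
have [t1 t10 ht1] := rphi_cvgr Lz e4.
have [T T0 /andP[T1 T2]] := rphi_ivt Lz z0_gt0 e4.
(* Small enough for the bottom slice of [z0] to be negligible, and below [T] so that the height [h]
   is positive. *)
pose tau := Num.min t1 (T / 2).
have T20 : 0 < T / 2 by rewrite divr_gt0.
have tau0 : 0 < tau by rewrite lt_min t10.
have tauT : tau < T by rewrite gt_min; apply/orP; right; rewrite ltr_pdivrMr// ltr_pMr// ltr1n.
have htau : Rint z0 - rphi z0 tau <= e / 4.
  apply: le_trans ht1; rewrite lerB// le_rphi// ?(ltW tau0)//.
  by rewrite ge_min lexx.
pose h := T - tau.
have h0 : 0 < h by rewrite subr_gt0.
have hT : h + tau = T by rewrite subrK.
have mz := LP_meas Lz.
have mS : measurable [set x | T < z0 x].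
  by rewrite -[X in measurable X]setTI; exact: (measurable_fun_ltr (measurable_cst T) mz).
have iS : integ mu2 (fun x => \1_[set x | T < z0 x] x : R).
  apply: (ge0_integ_le _ (integZ T^-1 (LP_integ Lz))) => //; first exact: measurable_indic.
  move=> x; rewrite indicE; have [xS|_] := boolP (x \in _).
    by rewrite ler_pdivlMl// mulr1; apply: ltW; exact: (set_mem xS).
  by rewrite mulr_ge0 ?invr_ge0 ?(ltW T0)// (LP_ge0 x Lz).
set m := Rint (fun x => \1_[set x | T < z0 x] x : R).
have m0 : 0 < m.
  rewrite lt_neqAle Rint_ge0 ?andbT//; apply/eqP => /esym m0.
  have ae0 := Rint_eq0_ae iS (fun x => ltac:(by [])) m0.
  move: T1; rewrite /rphi (ae0_Rint _) ?ltxx//; last exact: measurable_hinge.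
  apply: filterS ae0 => x; rewrite indicE; have [xS|xS] := boolP (x \in _).
    by move/eqP; rewrite oner_eq0.
  move=> _; rewrite /hinge max_r// subr_le0 leNgt; apply/negP => hx.
  by move/negP: xS; apply; apply/mem_set.
(* [tau * m] serves the constraint; [e / 8] is spent three times in the L^1 estimate, at the
   thresholds 0, [tau] and [T]. *)
pose delta := Num.min (tau * m) (e / 8).
have delta0 : 0 < delta by rewrite lt_min mulr_gt0//= divr_gt0.
exists delta => // xi Lxi xiD hxi.
have mxi := LP_meas Lxi.
have key (w : R) : 0 < w -> w < h -> delta <= rphi z0 w - rphi z0 (w + tau).
  move=> a0 ah; apply: (@le_trans _ _ (tau * m)); first by rewrite ge_min lexx.
  have a0' := ltW a0.
  have i1 := integ_hinge Lz a0'; have i2 := integ_hinge Lz (addr_ge0 a0' (ltW tau0)).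
  rewrite /rphi -RintB// -(RintZ tau iS); apply: le_Rint; [exact: integZ|exact: integB|].
  move=> x; have := LP_ge0 x Lz => zx; rewrite indicE; have [xS|_] := boolP (x \in _).
    have hz := set_mem xS; rewrite /= in hz.
    rewrite mulr1 /hinge max_l; last by rewrite subr_ge0 ltW// (lt_trans ah)// (lt_trans _ hz)// -hT ltrDl.
    rewrite max_l; last by rewrite subr_ge0 ltW// (lt_trans _ hz)// -hT ltrD2r.
    by rewrite le_eqVlt; apply/orP; left; apply/eqP; ring.
  rewrite mulr0 subr_ge0 /hinge ge_max !le_max lexx orbT andbT; apply/orP; left.
  by rewrite lerB// lerDl ltW.
pose f x := Num.min (hinge tau (xi x)) h.
have mf : measurable_fun setT f.
  by apply: measurable_minr; [exact: measurable_hinge|exact: measurable_cst].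
have f0 x : 0 <= f x by rewrite le_min hinge_ge0 ltW.
have fxi x : f x <= xi x.
  by rewrite ge_min hinge_le ?(ltW tau0)// (LP_ge0 x Lxi).
have Lf : LP f by apply: (LP_le p2 mf Lxi) => x; rewrite f0 fxi.
have delta8 : delta <= e / 8 by rewrite ge_min lexx orbT.
exists f; split => //.
  split => //.
    by move=> x nD; apply/eqP; rewrite eq_le f0 andbT -(xiD x nD).
  move=> t t0; have t0' := ltW t0; rewrite !Phi_rphi// lee_fin.
  have [ht|th] := leP h t.
    apply: (@le_trans _ _ 0); last exact: rphi_ge0.
    rewrite le_eqVlt; apply/orP; left; apply/eqP; rewrite -[RHS](Rint_cst0 mu2).
    apply: eq_Rint => x; rewrite /hinge max_r// subr_le0 (le_trans _ ht)//.
    by rewrite ge_min lexx orbT.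
  have tt0 : 0 <= t + tau by rewrite addr_ge0// ltW.
  have h1 : rphi f t <= rphi xi (t + tau).
    apply: le_Rint; [exact: integ_hinge|exact: integ_hinge|].
    by move=> x; exact: hinge_min_hinge.
  have := key t t0 th; have := hxi _ tt0; rewrite ler_norml => /andP[_].
  by move: h1; move: (rphi f t) (rphi xi _) (rphi z0 _) (rphi z0 _) => u v w k; lra.
(* The truncation removes a bottom slice of height [tau] and everything above T = h + tau. *)
have Ef x : xi x - f x = (xi x - hinge tau (xi x)) + hinge T (xi x).
  have := LP_ge0 x Lxi; rewrite /f /hinge -hT => x0.
  have [h1|h1] := leP (xi x) tau.
    rewrite max_r ?subr_le0// min_l ?(ltW h0)// max_r; first by rewrite subr0 addr0.
    by rewrite subr_le0 (le_trans h1)// lerDr ltW.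
  rewrite max_l; last by rewrite subr_ge0 ltW.
  have [h2|h2] := leP (xi x - tau) h.
    by rewrite max_r ?addr0// subr_le0 -lerBlDr.
  rewrite max_l; first ring.
  by rewrite subr_ge0 ltW// -ltrBrDr.
have tau0' := ltW tau0; have T0' := ltW T0.
have i1 := integB (LP_integ Lxi) (integ_hinge Lxi tau0').
rewrite (eq_Rint _ Ef) (RintD i1 (integ_hinge Lxi T0')) (RintB (LP_integ Lxi) (integ_hinge Lxi tau0')).
rewrite -/(rphi xi tau) -/(rphi xi T).
have := hxi 0 (lexx _); rewrite (rphi0 Lxi) (rphi0 Lz) ler_norml => /andP[_ a1].
have := hxi _ tau0'; rewrite ler_norml => /andP[a2 _].
have := hxi _ T0'; rewrite ler_norml => /andP[_ a3].
move: a1 a2 a3 htau T2 delta8.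
move: (Rint xi) (Rint z0) (rphi xi tau) (rphi z0 tau) (rphi xi T) (rphi z0 T) => u1 u2 u3 u4 u5 u6.
exact: reduction_alg e0.
Qed.

End Strong.

Lemma cS_alg {R : realType} (S e v u r i j : R) : S - e / 2 <= v / 2 - i -> v <= u + 2 * r ->
  r <= e / 2 -> j <= i -> S - (u / 2 - j) <= e.
Proof. lra. Qed.

Lemma quarter_alg {R : realType} (e u v : R) : u <= e / 4 -> v <= e / 4 -> 2 * u + 2 * v <= e.
Proof. lra. Qed.

Lemma sqr_sum_alg {R : realType} (u v w M : R) : 0 <= w -> w <= u -> u <= M -> (u - v) ^+ 2 <= 2 * (M * (u - w)) + 2 * (w - v) ^+ 2.
Proof.
move=> w0 wu uM; have h1 : (u - w) ^+ 2 <= M * (u - w).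
  by rewrite expr2 ler_wpM2r ?subr_ge0// lerBlDr ler_wpDr.
by have := sqr_ge0 ((u - w) - (w - v)); rewrite !sqrrB in h1 *; nra.
Qed.

Lemma K_zero {R : realType} (D : set (plane R)) z0 : inK D z0 (fun=> 0).
Proof.
split => // t t0; apply: (@le_trans _ _ 0%E); last exact: Phi_ge0.
by rewrite /Phi integral0_eq// => x _; rewrite /hinge sub0r max_r// oppr_le0 ltW.
Qed.

(** * Nearly maximizing sequences outside the class *)

Section Stability.
Context {R : realType}.
Implicit Types x y : plane R.
Local Notation mu2 := (@leb2 R).
Local Notation P := (plane R).
Local Notation Rint f := (\int[mu2]_x f x).
Variables s p W : R.
Hypothesis s01 : 0 < s < 1.
Hypothesis p2 : 2 <= p.
Hypothesis gp : gam s * (p / (p - 1)) < 2.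
Hypothesis W0 : 0 < W.
Implicit Types f g h a d : P -> R.
Local Notation LP := (@LP R p).
Local Notation pot := (@pot R s).
Local Notation ben := (@ben R s).
Local Notation D := (@Dom R s).
Variable z0 : P -> R.
Hypothesis Lz : LP z0.
Local Notation K := (inK D z0).
Local Notation KI := (KI s z0).
Local Notation Et := (Et s W).
Variable S : R.
Hypothesis S0 : 0 < S.
Hypothesis HS : forall h, KI h -> Et h <= S.
Hypothesis c0 : 0 < c_ s.
Hypothesis z0_gt0 : 0 < Rint z0.
Hypothesis Hmax : forall a, KI a -> Et a = S ->
  Rint z0 <= Rint a /\ \int[mu2]_x (z0 x ^+ 2) <= \int[mu2]_x (a x ^+ 2).

Let K_lp f : K f -> LP f. Proof. by move=> /(K_LP p2 Lz)[]. Qed.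

(** As f <= g + w with w = (f - g)_+, monotonicity and bilinearity leave two terms in which [w] is
    paired with a bounded potential. *)
Lemma ben_le_sub f g C : LP f -> LP g -> LP (fun x => Num.max (f x - g x) 0) ->
  (forall x, pot f x <= C) -> (forall x, pot g x <= C) ->
  ben f f <= ben g g + 2 * (C * \int[mu2]_x (Num.max (f x - g x) 0)).
Proof.
move=> Lf Lg; set w := (fun x => Num.max (f x - g x) 0) => Lw hf hg.
have Lgw := LPD p2 Lg Lw.
have fgw x : f x <= g x + w x by rewrite /w -lerBlDl le_max lexx.
have b1 : ben f f <= ben f (fun x => g x + w x) by apply: (le_ben s01 p2 gp).
have b2 : ben f g <= ben (fun x => g x + w x) g by apply: (le_ben s01 p2 gp).
rewrite (benDr s01 p2 gp Lg Lw Lf) in b1; rewrite (benDl s01 p2 gp Lg Lw Lg) in b2.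
have b3 : ben w g <= C * Rint w by exact: (ben_le_ub s01 p2 gp Lw Lg).
have b4 : ben w f <= C * Rint w by exact: (ben_le_ub s01 p2 gp Lw Lf).
rewrite (benC s01 p2 gp Lf Lw) in b1.
apply: (le_trans b1); apply: (le_trans (lerD b2 b4)); rewrite -addrA lerD2l.
by apply: (le_trans (lerD b3 (lexx _))); rewrite -mulr2n mulr_natl.
Qed.

(** The [xi n] violate the constraint slightly; [reduction] puts f_n below them in the class, with
    vanishing L^1 error, and the compactness of f_n is carried over. For L^2 this uses (xi - f)^2 <=
    M (xi - f). The weighted estimate is one-sided: it sees only what [xi n] lacks of [a],
    controlled by L^1 in a box and by the tail of x1 a outside. *)
Lemma stability (U : set_system nat) (UU : UltraFilter U) (xi : nat -> P -> R) M :
  \oo `<=` U -> (forall n, LP (xi n)) -> (forall n x, ~ D x -> xi n x = 0) ->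
  (forall n x, xi n x <= M) -> (forall n, integ mu2 (fun x => x.1 * xi n x)) ->
  (forall e, 0 < e -> \forall n \near U, forall t, 0 <= t -> `|rphi (xi n) t - rphi z0 t| <= e) ->
  (forall e, 0 < e -> \forall n \near U, S - e <= Et (xi n)) ->
  exists a, [/\ KI a, Et a = S & forall e, 0 < e -> \forall n \near U, exists c,
    [/\ \int[mu2]_x `|xi n (shift2 c x) - a x| <= e,
      \int[mu2]_x ((xi n (shift2 c x) - a x) ^+ 2) <= e &
      \int[mu2]_x (x.1 * Num.max (a x - xi n (shift2 c x)) 0) <= e]].
Proof.
move=> ooU Lxi xiD xiM Ixi hphi hEt.
have M0 : 0 <= M by apply: le_trans (xiM 0 (0, 0)); exact: LP_ge0 (Lxi 0).
have pw n x : xi n x `^ p <= M `^ (p - 1) * xi n x.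
  exact: powR_bounded_le p2 (LP_ge0 x (Lxi n)) (xiM n x).
(* One L^p bound for both the class and the [xi n]; for the latter it follows from the bound [M] and
   the mass. *)
pose Mp := Num.max (Rint (fun x => z0 x `^ p)) (M `^ (p - 1) * (Rint z0 + 1)).
have [C C0 hC] := pot_ub s01 p2 gp (Rint z0 + 1) Mp.
have xi1 : \forall n \near U, Rint (xi n) <= Rint z0 + 1.
  apply: filterS (hphi 1 ltr01) => n /(_ 0 (lexx _)).
  by rewrite (rphi0 (Lxi n)) (rphi0 Lz) ler_norml => /andP[_]; rewrite lerBlDl.
have potxi : \forall n \near U, forall x, pot (xi n) x <= C.
  apply: filterS xi1 => n h x; apply: hC => //.
  apply: (@le_trans _ _ (Rint (fun x => M `^ (p - 1) * xi n x))).
    apply: le_Rint; [exact: LP_integp (Lxi n)|by apply: integZ; exact: LP_integ (Lxi n)|exact: pw].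
  rewrite (RintZ _ (LP_integ (Lxi n))) le_max; apply/orP; right.
  by rewrite ler_wpM2l// powR_ge0.
have potK f x : K f -> pot f x <= C.
  move=> Kf; have [Lf M1 Mpf _ _] := K_LP p2 Lz Kf.
  apply: hC => //; first by apply: (le_trans M1); rewrite lerDl.
  by apply: (le_trans Mpf); rewrite le_max lexx.
have hred k : \forall n \near U, exists f, [/\ K f, forall x, f x <= xi n x & \int[mu2]_x (xi n x - f x) <= k.+1%:R^-1].
  have k0 : 0 < k.+1%:R^-1 :> R by rewrite invr_gt0.
  have [de de0 hde] := reduction D p2 Lz z0_gt0 k0.
  apply: filterS (hphi _ de0) => n h; exact: (hde _ (Lxi n) (xiD n) h).
have [kap hkap] := diagonal_filter _ ooU hred.
have K0 : K (fun=> 0).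
  exact: K_zero.
(* Where the property at level [kap n] fails, 0 is a placeholder: it lies in the class and below
   [xi n]. This happens only off a set of [U]. *)
have ex n : exists f, [/\ K f, forall x, f x <= xi n x &
    (exists f, [/\ K f, forall x, f x <= xi n x & \int[mu2]_x (xi n x - f x) <= (kap n).+1%:R^-1]) ->
    \int[mu2]_x (xi n x - f x) <= (kap n).+1%:R^-1].
  have [[f [h1 h2 h3]]|nex] := pselect (exists f, [/\ K f, forall x, f x <= xi n x & \int[mu2]_x (xi n x - f x) <= (kap n).+1%:R^-1]).
    by exists f; split.
  by exists (fun=> 0); split => // x; exact: LP_ge0 (Lxi n).
have [f hf] := choice ex.
have Kf n : K (f n) by have [] := hf n.
have fxi n x : f n x <= xi n x by have [_ h _] := hf n.
have diff e : 0 < e -> \forall n \near U, \int[mu2]_x (xi n x - f n x) <= e.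
  move=> e0; have [j _ hj] : \forall j \near \oo, (j.+1%:R^-1 : R) < e.
    exact: near_infty_natSinv_lt (PosNum e0).
  apply: filterS (hkap j) => n [jk exn]; have [_ _ /(_ exn)] := hf n.
  move=> /le_trans; apply; apply: ltW; apply: le_lt_trans (hj j (leqnn _)).
  by rewrite lef_pV2 ?posrE ?ltr0n// ler_nat ltnS.
have f0 n x : 0 <= f n x by exact: LP_ge0 (K_lp (Kf n)).
have x1xi n x : 0 <= x.1 * xi n x.
  have [Dx|nDx] := pselect (D x); last by rewrite xiD// mulr0.
  by apply: mulr_ge0; [exact: ltW (Dom_gt0 Dx)|exact: LP_ge0 (Lxi n)].
have x1fxi n x : x.1 * f n x <= x.1 * xi n x.
  have [Dx|nDx] := pselect (D x); last first.
    by rewrite xiD// mulr0; case: (Kf n) => _ _ -> //; rewrite mulr0.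
  by apply: ler_wpM2l => //; exact: ltW (Dom_gt0 Dx).
have mf n := LP_meas (K_lp (Kf n)).
have KIf n : KI (f n).
  split => //; apply: (ge0_integ_le _ (Ixi n)) => //; first exact: measurable_x1f.
  by move=> x; exact: x1f_ge0 (Kf n).
have impf n : imp (f n) <= imp (xi n).
  by apply: ge0_le_Rint => //; [exact: measurable_x1f|move=> x; exact: x1f_ge0 (Kf n)].
have cS : Et (f n) @[n --> U] --> S.
  apply/cvgrPdist_le => e e0.
  have e2 : 0 < e / 2 by rewrite divr_gt0.
  have eC : 0 < e / 2 / C by rewrite divr_gt0.
  apply: filterS3 (hEt _ e2) (diff _ eC) potxi => n h1 h2 h3.
  rewrite ger0_norm; last by rewrite subr_ge0; exact: HS.
  have Em x : Num.max (xi n x - f n x) 0 = xi n x - f n x by rewrite max_l// subr_ge0.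
  have Lw : LP (fun x => Num.max (xi n x - f n x) 0).
    apply: (LP_le p2 _ (Lxi n)).
      by apply: measurable_maxr => //; apply: measurable_funB => //; exact: LP_meas (Lxi n).
    by move=> x; rewrite Em subr_ge0 fxi/= lerBlDr lerDl.
  have h4 := ben_le_sub (Lxi n) (K_lp (Kf n)) Lw h3 (fun x => potK _ x (Kf n)).
  rewrite (eq_Rint _ Em) in h4.
  have h5 : C * \int[mu2]_x (xi n x - f n x) <= e / 2.
    by apply: (le_trans (ler_wpM2l (ltW C0) h2)); rewrite mulrC divfK// gt_eqF.
  have h6 : W * imp (f n) <= W * imp (xi n) by apply: ler_wpM2l; [exact: ltW|exact: impf].
  move: h1; rewrite /Et => h1; exact: cS_alg h1 h4 h5 h6.
have [c [a [Ka Ea wa]]] := maximizing_limit s01 p2 gp W0 Lz S0 HS c0 UU ooU KIf cS.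
exists a; split => // e e0.
have [z1 zsq] := Hmax Ka Ea.
pose h n := f n \o shift2 (c n).
have KIh n : KI (h n) by have [] := KI_shift2 W s01 p2 gp Lz (c n) (KIf n).
have La := K_lp Ka.1.
have e2 : 0 < e / 2 by rewrite divr_gt0.
have [N hN'] := tail_boxn (measurable_x1f (LP_meas La)) (fun x => x1f_ge0 x Ka.1) Ka.2 e2.
have hN := hN' N (leqnn N).
(* The second bound absorbs the factor N, which dominates x1 in the box. *)
pose t := Num.min (e / 2) (e / 2 / (N%:R + 1)).
have N1 : 0 < N%:R + 1 :> R by rewrite ltr_wpDl.
have t0 : 0 < t by rewrite lt_min e2 divr_gt0.
have t2 : 0 < t / 2 by rewrite divr_gt0.
have q0 : 0 < e / 4 by rewrite divr_gt0.
have qM : 0 < e / 4 / (M + 1) by rewrite divr_gt0// ltr_wpDl.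
have n1 := strong_L1 p2 Lz UU (fun n => (KIh n).1) Ka.1 wa zsq z1 t2.
have n2 := strong_L2 p2 Lz UU (fun n => (KIh n).1) Ka.1 wa zsq q0.
have nI (X Y : set nat) : U X -> U Y -> U (X `&` Y) by exact: filterI.
apply: filterS (nI _ _ (nI _ _ n1 n2) (nI _ _ (diff _ t2) (diff _ qM))) => n [[k1 [i2 k2]] [k3 k4]]; exists (c n).
pose xc := xi n \o shift2 (c n).
have Lxc : LP xc := LP_shift2 (c n) (Lxi n).
have Lh := K_lp (KIh n).1.
have hxc x : h n x <= xc x by exact: fxi.
have id := integB (LP_integ Lxc) (LP_integ Lh).
have Ed : \int[mu2]_x (xc x - h n x) = \int[mu2]_x (xi n x - f n x).
  have id0 := integB (LP_integ (Lxi n)) (LP_integ (K_lp (Kf n))).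
  have md0 := integ_meas id0.
  by have [_ <-] := integ_shift2 (c n) md0 (fun x => ltac:(by rewrite subr_ge0)) id0.
have ixa := integB (LP_integ Lxc) (LP_integ La).
have iha := integB (LP_integ Lh) (LP_integ La).
have r1 : \int[mu2]_x `|xc x - a x| <= t.
  apply: (@le_trans _ _ (\int[mu2]_x ((xc x - h n x) + `|h n x - a x|))).
    apply: le_Rint; [exact: integ_norm|exact: integD id (integ_norm iha)|].
    move=> x; have d0 : 0 <= xc x - h n x by rewrite subr_ge0.
    rewrite -[X in _ <= X + _](ger0_norm d0).
    apply: le_trans (ler_normD _ _); rewrite le_eqVlt; apply/orP; left; apply/eqP; congr (`|_|); ring.
  rewrite (RintD id (integ_norm iha)) Ed.
  by apply: (le_trans (lerD k3 k1)); rewrite -splitr.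
have te : t <= e by apply: (@le_trans _ _ (e / 2)); [rewrite ge_min lexx|rewrite ler_pdivrMr// ler_peMr ?ler1n// ltW].
split; first exact: le_trans te.
- have i3 := integZ 2 (integZ M id); have i4 := integZ 2 i2.
  apply: (@le_trans _ _ (\int[mu2]_x (2 * (M * (xc x - h n x)) + 2 * (h n x - a x) ^+ 2))).
    apply: ge0_le_Rint; [|exact: integD|by move=> x; exact: sqr_ge0|].
      by apply: measurable_funX; exact: integ_meas ixa.
    by move=> x; exact: (sqr_sum_alg (a x) (LP_ge0 x Lh) (hxc x) (xiM n _)).
  rewrite (RintD i3 i4) (RintZ _ (integZ M id)) (RintZ _ id) (RintZ _ i2) Ed.
  have k5 : M * \int[mu2]_x (xi n x - f n x) <= e / 4.
    apply: (le_trans (ler_wpM2l M0 k4)); rewrite mulrCA ler_piMr ?(ltW q0)//.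
    by rewrite ler_pdivrMr ?ltr_wpDl// mul1r lerDl.
  exact: quarter_alg k5 k2.
- have x1pos x : 0 <= x.1 * Num.max (a x - xc x) 0.
    have [Dx|nDx] := pselect (D x).
      by apply: mulr_ge0; [exact: ltW (Dom_gt0 Dx)|rewrite le_max lexx orbT].
    have -> : a x = 0 by case: Ka.1 => _ _ ->.
    by rewrite /xc /= xiD ?subrr ?max_l ?mulr0// => /Dom_shift2.
  have iA : integ mu2 (fun x => x.1 * a x * \1_(~` boxn N) x).
    apply: (ge0_integ_le _ Ka.2).
    + apply: measurable_funM; first by apply: measurable_x1f; exact: LP_meas La.
      by apply: measurable_indic; apply: measurableC; exact: (boxn_bset N).1.
    + by move=> x; rewrite mulr_ge0// (x1f_ge0 x Ka.1).
    + by move=> x; rewrite ler_piMr ?(x1f_ge0 x Ka.1)// indicE; case: (_ \in _).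
  have inx := integZ N%:R (integ_norm ixa).
  apply: (@le_trans _ _ (\int[mu2]_x (N%:R * `|xc x - a x| + x.1 * a x * \1_(~` boxn N) x))).
    apply: ge0_le_Rint => //; last 2 first.
    - exact: integD inx iA.
    - move=> x; have a0 := LP_ge0 x La; have xc0 := LP_ge0 x Lxc.
      rewrite -[xi n _]/(xc x); have [Dx|nDx] := pselect (D x); last first.
        have -> : a x = 0 by case: Ka.1 => _ _ ->.
        have -> : xc x = 0 by rewrite /xc /= xiD// => /Dom_shift2.
        by rewrite subrr max_l// !(mulr0, mul0r) normr0 ?mulr0 ?addr0.
      have x10 := ltW (Dom_gt0 Dx).
      rewrite indicE; have [xb|xb] := boolP (x \in ~` boxn N).
        have p1 : 0 <= N%:R * `|xc x - a x| by apply: mulr_ge0.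
        rewrite mulr1; apply: ler_wpDl => //; apply: ler_wpM2l => //.
        by rewrite ge_max a0 andbT lerBlDr lerDl.
      rewrite mulr0 addr0; apply: ler_pM => //; first by rewrite le_max lexx orbT.
        move: xb; rewrite in_setC negbK => /set_mem; rewrite /boxn /=; apply: le_trans.
        by rewrite (ger0_norm x10) lerDl.
      by rewrite ge_max normr_ge0 andbT distrC ler_norm.
    - apply: measurable_x1f; apply: measurable_maxr => //.
      by apply: measurable_funB; [exact: LP_meas La|exact: LP_meas Lxc].
  rewrite (RintD inx iA) (RintZ _ (integ_norm ixa)).
  have k6 : N%:R * \int[mu2]_x `|xc x - a x| <= e / 2.
    have k7 : \int[mu2]_x `|xc x - a x| <= e / 2 / (N%:R + 1).
      by apply: (le_trans r1); rewrite ge_min lexx orbT.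
    apply: (@le_trans _ _ (N%:R * (e / 2 / (N%:R + 1)))); first by rewrite ler_wpM2l.
    rewrite mulrCA ler_piMr ?(ltW e2)//.
    by rewrite ler_pdivrMr// mul1r lerDl.
  by rewrite [leRHS]splitr; apply: lerD.
Qed.

End Stability.

(** * Pointwise representatives of almost-everywhere classes *)

Section Versions.
Context {R : realType}.
Implicit Types x y : plane R.
Local Notation mu2 := (@leb2 R).
Local Notation P := (plane R).
Local Notation Rint f := (\int[mu2]_x f x).
Variable s : R.
Hypothesis s01 : 0 < s < 1.
Implicit Types f g h a d zeta : P -> R.
Local Notation D := (@Dom R s).

(** [f] is a representative of [zeta] whose sign and support conditions hold at every point, as the
    preceding sections require. *)
Definition version zeta f : Prop :=
  [/\ measurable_fun setT zeta, measurable_fun setT f, forall x, 0 <= f x, forall x, ~ D x -> f x = 0 &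
   {ae mu2, forall x, zeta x = f x}].

Lemma version_exists zeta : measurable_fun setT zeta -> ae_nonneg zeta -> ae_supported D zeta ->
  exists f, version zeta f.
Proof.
move=> mz z0 zD; exists (fun x => Num.max (zeta x) 0 * \1_D x); split => //.
- apply: measurable_funM; first exact: measurable_maxr.
  by apply: measurable_indic; exact: measurable_Dom.
- by move=> x; rewrite mulr_ge0// le_max lexx orbT.
- by move=> x nD; rewrite indicE memNset// mulr0.
- apply: filterS2 z0 zD => x z0 zD; rewrite indicE; have [Dx|Dx] := boolP (x \in D).
    by rewrite mulr1 max_l.
  by rewrite mulr0 zD// => Dx'; move: Dx; rewrite mem_set.
Qed.

Lemma version_refl f : measurable_fun setT f -> (forall x, 0 <= f x) -> (forall x, ~ D x -> f x = 0) ->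
  version f f.
Proof. by move=> *; split => //; exact: nearW. Qed.

Lemma ae_integral f g : measurable_fun setT f -> measurable_fun setT g ->
  {ae mu2, forall x, f x = g x} -> (\int[mu2]_x (f x)%:E = \int[mu2]_x (g x)%:E)%E.
Proof.
move=> mf mg fg; apply: ae_eq_integral => //; [exact/measurable_EFinP|exact/measurable_EFinP|].
by apply: filterS fg => x -> _.
Qed.

Lemma integral_supported (A : set P) (h : P -> R) : (forall x, ~ A x -> h x = 0) ->
  (\int[mu2]_(x in A) (h x)%:E = \int[mu2]_x (h x)%:E)%E.
Proof.
move=> hA; rewrite integral_mkcond; apply: eq_integral => x _; rewrite patchE.
by case: ifPn => // /negP nA; rewrite hA// => Ax; apply: nA; exact/mem_set.
Qed.

Lemma integral_version (A : set P) (F : P -> R -> R) zeta f : measurable A -> D `<=` A -> version zeta f ->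
  measurable_fun setT (fun x => F x (zeta x)) -> measurable_fun setT (fun x => F x (f x)) ->
  (forall x, F x 0 = 0) ->
  (\int[mu2]_(x in A) (F x (zeta x))%:E = \int[mu2]_x (F x (f x))%:E)%E.
Proof.
move=> mA DA [mz mf f0 fD zf] m1 m2 F0.
transitivity (\int[mu2]_(x in A) (F x (f x))%:E)%E.
  apply: ae_eq_integral => //.
  - by apply: measurable_funTS; exact/measurable_EFinP.
  - by apply: measurable_funTS; exact/measurable_EFinP.
  - by apply: filterS zf => x -> _.
apply: integral_supported => x nA; rewrite fD ?F0// => /DA; exact: nA.
Qed.

Lemma leb2_version zeta f tau : version zeta f ->
  mu2 [set x | tau < zeta x] = mu2 [set x | tau < f x].
Proof.
move=> [mz mf f0 fD zf].
have mS h : measurable_fun setT h -> measurable [set x : P | tau < h x].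
  by move=> mh; rewrite -[X in measurable X]setTI; exact: (measurable_fun_ltr (measurable_cst tau) mh).
have E h : measurable_fun setT h -> mu2 [set x : P | tau < h x] = (\int[mu2]_x (\1_[set x : P | tau < h x] x)%:E)%E.
  by move=> mh; rewrite integral_indic ?setIT//; exact: mS.
rewrite (E _ mz) (E _ mf); apply: ae_integral.
- by apply: measurable_indic; exact: mS.
- by apply: measurable_indic; exact: mS.
- by apply: filterS zf => x zf; rewrite !indicE; congr (_%:R); congr nat_of_bool; apply/idP/idP => /set_mem /= h;
    apply/mem_set; rewrite /= ?zf// -zf.
Qed.

Lemma impulse_version zeta f : version zeta f -> impulse s zeta = (\int[mu2]_x (x.1 * f x)%:E)%E.
Proof.
move=> v; have [mz mf _ _ _] := v; apply: (integral_version (F := fun x t => x.1 * t)) => //.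
- exact: measurable_Dom.
- by apply: measurable_funM => //; exact: measurable_fst.
- by apply: measurable_funM => //; exact: measurable_fst.
- by move=> x; rewrite mulr0.
Qed.

Lemma Phi_version zeta f t : version zeta f -> 0 <= t ->
  (\int[mu2]_(x in D) (Num.max (zeta x - t) 0)%:E = Phi (@leb2s R) f t)%E.
Proof.
move=> v t0; have [mz mf _ _ _] := v; apply: (integral_version (F := fun=> hinge t)) => //.
- exact: measurable_Dom.
- exact: measurable_hinge.
- exact: measurable_hinge.
- by move=> x; rewrite /hinge sub0r max_r// oppr_le0.
Qed.

Variable p : R.
Hypothesis p2 : 2 <= p.
Hypothesis gp : gam s * (p / (p - 1)) < 2.
Local Notation LP := (@LP R p).

(** Cutting the kernel at 0 changes it, between points of the half-plane, only on the diagonal,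
    which is negligible for a fixed [x]. *)
Lemma Gs_plus_version zeta f x : version zeta f -> LP f -> D x -> Gs_plus s zeta x = (pot s f x)%:E.
Proof.
move=> v Lf Dx; have [mz mf f0 fD zf] := v.
have x0 := Dom_gt0 Dx.
have mG : measurable_fun setT (Gker_plus s x).
  have mc : measurable_fun setT (fun _ : P => x) by exact: measurable_cst.
  have me : measurable_fun setT (fun y : P => edist x y) by apply: measurable_edist => //; exact: measurable_id.
  have mr : measurable_fun setT (fun y : P => edist x (reflect1 y)).
    by apply: measurable_edist => //; exact: measurable_reflect1.
  rewrite /Gker_plus /Gker; apply: measurable_funB; apply: measurable_funM => //; under eq_fun do rewrite -powRN.
    exact: (measurableT_comp (measurable_powR _)).
  exact: (measurableT_comp (measurable_powR _)).
have mh : measurable (@half_plane R).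
  by rewrite -[X in measurable X]setTI; exact: (measurable_fun_ltr (measurable_cst (0:R)) measurable_fst).
rewrite /Gs_plus (integral_version (F := fun y t => Gker_plus s x y * t) mh _ v).
- rewrite /pot -EFin_Rint; last exact: (integ_kk s01 p2 gp).
  have mk := @measurable_kk1 _ s x.
  apply: ae_integral; [exact: measurable_funM|exact: measurable_funM|].
  apply: filterS (ae_neq x) => y xy; have [Dy|nDy] := pselect (D y); last by rewrite fD// !mulr0.
  by rewrite (kkE s01 x0 (Dom_gt0 Dy) xy).
- by move=> y; exact: Dom_gt0.
- exact: measurable_funM.
- exact: measurable_funM.
- by move=> y; rewrite mulr0.
Qed.

Lemma energy_version zeta f : version zeta f -> LP f -> energy s zeta = (ben s f f / 2)%:E.
Proof.
move=> v Lf; have [mz mf f0 fD zf] := v; rewrite /energy mulrC EFinM; congr (_ * _)%E.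
rewrite /ben -EFin_Rint; last exact: (integ_ben s01 p2 gp).
transitivity (\int[mu2]_(x in D) (zeta x * pot s f x)%:E)%E.
  by apply: eq_integral => x /set_mem Dx; rewrite (Gs_plus_version v).
have mp := measurable_pot s Lf.
apply: (integral_version (F := fun x t => t * pot s f x)) => //.
- exact: measurable_Dom.
- exact: measurable_funM.
- exact: measurable_funM.
- by move=> x; rewrite mul0r.
Qed.

Variable W : R.
Hypothesis W0 : 0 < W.

Lemma energyW_version zeta f : version zeta f -> LP f -> integ mu2 (fun x => x.1 * f x) ->
  energyW s W zeta = (Et s W f)%:E.
Proof.
move=> v Lf If; rewrite /energyW (energy_version v Lf) (impulse_version v).
by rewrite EFin_Rint.
Qed.

(** The energy is finite on [LP], so an infinite impulse decides; since 0 competes with value 0,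
    such functions are never maximizers. *)
Lemma energyW_version_Ny zeta f : version zeta f -> LP f -> ~ integ mu2 (fun x => x.1 * f x) ->
  energyW s W zeta = -oo%E.
Proof.
move=> v Lf nIf; have [mz mf f0 fD _] := v.
rewrite /energyW (energy_version v Lf) (impulse_version v).
have x1 x : 0 <= x.1 * f x.
  have [Dx|nDx] := pselect (D x); last by rewrite fD// mulr0.
  by apply: mulr_ge0 => //; exact: ltW (Dom_gt0 Dx).
have -> : (\int[mu2]_x (x.1 * f x)%:E = +oo)%E.
  apply/eqP; rewrite eq_le leey /= leNgt; apply/negP => h; apply: nIf.
  by apply: ge0_integ => //; exact: measurable_x1f.
by rewrite gt0_muley ?lte_fin.
Qed.

Lemma normp2_le g e : measurable_fun setT g -> 0 <= e -> integ mu2 (fun x => g x ^+ 2) ->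
  \int[mu2]_x (g x ^+ 2) <= e ^+ 2 -> (normp 2 g <= e%:E)%E.
Proof.
move=> mg e0 ig h; rewrite /normp unlock /Lnorm.
have -> : (\int[mu2]_x (`|(EFin \o g) x| `^ 2) = (\int[mu2]_x (g x ^+ 2))%:E)%E.
  rewrite -EFin_Rint//; apply: eq_integral => x _ /=.
  by rewrite powR_mulrn// real_normK ?num_real.
have i0 : 0 <= \int[mu2]_x (g x ^+ 2) by apply: Rint_ge0 => x; exact: sqr_ge0.
rewrite poweR_EFin lee_fin powR12_sqrt// -(ger0_norm e0) -sqrtr_sqr.
by apply: ler_wsqrtr.
Qed.


Lemma normpy_ae g M : measurable_fun setT g -> (normp +oo g <= M%:E)%E -> {ae mu2, forall x, `|g x| <= M}.
Proof.
move=> mg; rewrite /normp unlock /Lnorm; case: ifPn => [m0|].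
  by move/ess_sup_inf.ess_supP; apply: filterS => x /=; rewrite lee_fin.
rewrite -leNgt => m0 _; exists setT; split => //.
by apply/eqP; rewrite eq_le m0 measure_ge0.
Qed.

Lemma version_bounded zeta f M : 0 <= M -> version zeta f -> {ae mu2, forall x, `|zeta x| <= M} ->
  version zeta (fun x => Num.min (f x) M).
Proof.
move=> M0 [mz mf f0 fD zf] zM; split => //.
- by apply: measurable_minr.
- by move=> x; rewrite le_min f0.
- by move=> x nD; rewrite fD// min_l.
- apply: filterS2 zf zM => x zf; rewrite zf => fM; rewrite min_l//.
  exact: le_trans (ler_norm _) fM.
Qed.

Lemma bounded_LP f M : measurable_fun setT f -> (forall x, 0 <= f x) -> (forall x, f x <= M) -> integ mu2 f -> LP f.
Proof.
move=> mf f0 fM If; split => //.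
apply: (ge0_integ_le _ (integZ (M `^ (p - 1)) If)).
- exact: (measurableT_comp (measurable_powR p)).
- by move=> x; exact: powR_ge0.
- by move=> x; exact: powR_bounded_le.
Qed.

Lemma normp_integ (r : R) zeta f : 0 < r -> version zeta f -> (normp r%:E zeta < +oo)%E ->
  integ mu2 (fun x => f x `^ r).
Proof.
move=> r0 [mz mf f0 fD zf] h.
have mpow g : measurable_fun setT g -> measurable_fun setT (fun x => g x `^ r).
  by move=> mg; exact: (measurableT_comp (measurable_powR r)).
apply: ge0_integ; [exact: mpow|by move=> x; exact: powR_ge0|].
have -> : (\int[mu2]_x (f x `^ r)%:E = \int[mu2]_x (`|zeta x| `^ r)%:E)%E.
  apply: ae_integral; [exact: mpow| |by apply: filterS zf => x ->; rewrite ger0_norm].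
  by apply: mpow; exact: measurableT_comp.
have <- : ((normp r%:E zeta) `^ r = \int[mu2]_x (`|zeta x| `^ r)%:E)%E.
  by rewrite /normp poweR_Lnorm ?gt_eqF//; apply: eq_integral => x _.
exact: poweR_lty.
Qed.

Lemma normp1_integ zeta f : version zeta f -> (normp 1 zeta < +oo)%E -> integ mu2 f.
Proof.
move=> v /(normp_integ ltr01 v); congr integ; apply/funext => x; rewrite powRr1//.
by case: v.
Qed.

Lemma rearr_Phi zeta xi f g t : rearr s xi zeta -> version zeta f -> version xi g -> 0 <= t ->
  Phi (@leb2s R) f t = Phi (@leb2s R) g t.
Proof.
move=> [_ _ h] vf vg t0; have [_ mf _ _ _] := vf; have [_ mg _ _ _] := vg.
apply: (eq_Phi mf mg t0) => tau tau0.
exact: etrans (esym (leb2_version tau vf)) (etrans (h tau tau0) (leb2_version tau vg)).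
Qed.

Lemma wclosure_K zeta0 z0 zeta f : version zeta0 z0 -> rearr_wclosure s zeta0 zeta -> version zeta f ->
  inK D z0 f.
Proof.
move=> vz [mz zD zn h] vf; have [_ mf f0 fD _] := vf; split => // t t0.
by rewrite -(Phi_version vf (ltW t0)) -(Phi_version vz (ltW t0)); exact: h.
Qed.

Lemma K_wclosure zeta0 z0 f : version zeta0 z0 -> inK D z0 f -> rearr_wclosure s zeta0 f.
Proof.
move=> vz [mf f0 fD h]; split => //; [exact: nearW|exact: nearW|].
move=> t t0; rewrite (Phi_version (version_refl mf f0 fD) (ltW t0)) (Phi_version vz (ltW t0)).
exact: h.
Qed.

End Versions.

(** The condition gam p / (p - 1) < 2 reads p (2 - gam) > 2. With gam = 2 - 2s it is p > 1/s, and
    with gam = 3 - 2s it is p > 2 / (2s - 1), which already forces p > 2: the thresholds of the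
    theorem. *)
Lemma exponent_bound {R : realType} (s p : R) : 0 < s < 1 -> (s <= 2^-1 -> Num.max 2 s^-1 < p) ->
  (2^-1 < s -> 2 / (2 * s - 1) < p) -> 2 <= p /\ gam s * (p / (p - 1)) < 2.
Proof.
move=> /andP[s0 s1] low high.
have [hs|hs] := leP s 2^-1.
  have := low hs; rewrite gt_max => /andP[p2 ps]; split; first exact: ltW.
  have p1 : 0 < p - 1 by lra.
  rewrite /gam (ltNge _ s) hs /= mulrA ltr_pdivrMr//.
  by move: ps; rewrite -[s^-1]mul1r ltr_pdivrMr//; lra.
have := high hs; have s2 : 0 < 2 * s - 1 by lra.
rewrite ltr_pdivrMr// => hp.
have p2 : 2 <= p.
  rewrite leNgt; apply/negP => h; have : p * (2 * s - 1) <= 2 * (2 * s - 1) by rewrite ler_wpM2r// ltW.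
  lra.
split => //; have p1 : 0 < p - 1 by lra.
by rewrite /gam hs mulrA ltr_pdivrMr//; lra.
Qed.

(** For q infinite any finite exponent above the thresholds will do, because bounded integrable
    functions belong to every L^p. *)
Lemma exponent_choice {R : realType} (s : R) (q : \bar R) : 0 < s < 1 ->
  (s <= 2^-1 -> ((Num.max 2 s^-1)%:E < q)%E) -> (2^-1 < s -> ((2 / (2 * s - 1))%:E < q)%E) ->
  exists p, [/\ 2 <= p, gam s * (p / (p - 1)) < 2 & q = +oo%E \/ q = p%:E].
Proof.
move=> s01 low high; case: q low high => [r low high|_ _|low high].
- have [h1 h2] := @exponent_bound _ s r s01 low high.
  by exists r; split => //; right.
- pose p := Num.max (Num.max 2 s^-1) (2 / (2 * s - 1)) + 1.
  have [h1 h2] : 2 <= p /\ gam s * (p / (p - 1)) < 2.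
    apply: exponent_bound => // _; apply: (@le_lt_trans _ _ (p - 1)); rewrite ?gtrBl// /p addrK.
      by rewrite le_max lexx.
    by rewrite le_max lexx orbT.
  by exists p; split => //; left.
- have [hs|hs] := leP s 2^-1; first by have := low hs; rewrite ltNge leNye.
  by have := high hs; rewrite ltNge leNye.
Qed.

(** * The maximal value of the penalised energy *)

Section Maximizers.
Context {R : realType}.
Implicit Types x y : plane R.
Local Notation mu2 := (@leb2 R).
Local Notation P := (plane R).
Local Notation Rint f := (\int[mu2]_x f x).
Variables s p W : R.
Hypothesis s01 : 0 < s < 1.
Hypothesis p2 : 2 <= p.
Hypothesis gp : gam s * (p / (p - 1)) < 2.
Hypothesis W0 : 0 < W.
Implicit Types f g h a d zeta : P -> R.
Local Notation D := (@Dom R s).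
Local Notation LP := (@LP R p).
Local Notation ben := (@ben R s).
Variables zeta0 z0 : P -> R.
Hypothesis vz : version s zeta0 z0.
Hypothesis Lz : LP z0.
Local Notation K := (inK D z0).
Local Notation KI := (KI s z0).
Local Notation Et := (Et s W).
Local Notation Sigma := (maximizers s W zeta0).
Hypothesis z0_gt0 : 0 < Rint z0.
Hypothesis Sigma_neq0 : Sigma !=set0.
Hypothesis Sigma_rearr : Sigma `<=` rearr s zeta0.

Let K_lp f : K f -> LP f. Proof. by move=> /(K_LP p2 Lz)[]. Qed.

Lemma K_version f : K f -> version s f f.
Proof. by case=> mf f0 fD _; exact: version_refl. Qed.

Lemma wclosure_version zeta : rearr_wclosure s zeta0 zeta -> exists2 f, version s zeta f & K f.
Proof.
move=> wz; have [mz zD zn _] := wz.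
have [f vf] := version_exists mz zn zD.
by exists f => //; exact: wclosure_K vz wz vf.
Qed.

(** The function 0 competes with value 0, so maximizers have finite impulse and S >= 0. If S were 0,
    then 0 would be a maximizer and hence a rearrangement of [zeta0], contradicting its positive
    mass. *)
Lemma maximum_exists : exists S, [/\ 0 < S, forall h, KI h -> Et h <= S,
  (forall h, KI h -> Et h = S -> Sigma h) &
  forall zeta f, Sigma zeta -> version s zeta f -> KI f /\ Et f = S].
Proof.
have [zs [wzs mzs]] := Sigma_neq0.
have E0 : energyW s W (fun=> 0) = 0%E.
  have v0 : version s (fun=> 0 : R) (fun=> 0) by exact: version_refl.
  have L0 : LP (fun=> 0) := K_lp (@K_zero _ _ _).
  have I0 : integ mu2 (fun x : P => x.1 * 0).
    by rewrite (_ : (fun x => _) = (fun=> 0)); [exact: integ0|apply/funext => x; rewrite mulr0].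
  rewrite (energyW_version s01 p2 gp W v0 L0 I0) /Et /imp.
  rewrite (eq_Rint _ (_ : forall x : P, x.1 * 0 = 0)); last by move=> x; rewrite mulr0.
  rewrite Rint_cst0 mulr0 subr0 /ben.
  rewrite (eq_Rint _ (_ : forall x : P, 0 * pot s (fun=> 0) x = 0)); last by move=> x; rewrite mul0r.
  by rewrite Rint_cst0 mul0r.
have w0 : rearr_wclosure s zeta0 (fun=> 0) := K_wclosure vz (@K_zero _ _ _).
have KIof zeta f : Sigma zeta -> version s zeta f -> KI f.
  move=> [wz mz] vf; have Kf := wclosure_K vz wz vf; split => //.
  apply: contrapT => nI; have := mz _ w0.
  by rewrite E0 (energyW_version_Ny s01 p2 gp W0 vf (K_lp Kf) nI).
have [fs vfs Kfs] := wclosure_version wzs.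
have [_ Ifs] := KIof _ _ (conj wzs mzs) vfs.
have Es := energyW_version s01 p2 gp W vfs (K_lp Kfs) Ifs.
have S0 : 0 <= Et fs by have := mzs _ w0; rewrite E0 Es lee_fin.
have all_le h : KI h -> Et h <= Et fs.
  move=> [Kh Ih]; have := mzs _ (K_wclosure vz Kh).
  by rewrite Es (energyW_version s01 p2 gp W (K_version Kh) (K_lp Kh) Ih) lee_fin.
have attain h : KI h -> Et h = Et fs -> Sigma h.
  move=> [Kh Ih] E; split; first exact: (K_wclosure vz Kh).
  move=> zeta' wz'; rewrite (energyW_version s01 p2 gp W (K_version Kh) (K_lp Kh) Ih) E -Es.
  exact: mzs.
exists (Et fs); split => //.
- rewrite lt_neqAle S0 andbT; apply/eqP => E.
  have Sig0 : Sigma (fun=> 0) by split => // zeta' /mzs; rewrite E0 Es -E.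
  have r0 := Sigma_rearr Sig0.
  have := rearr_Phi r0 (version_refl (f := fun=> 0) (measurable_cst _) (fun=> lexx _) (fun _ _ => erefl)) vz (lexx 0).
  rewrite -!integral_Phi0//; last by case: vz.
  rewrite integral0 EFin_Rint; last exact: LP_integ Lz.
  by move=> [E']; move: z0_gt0; rewrite -E' ltxx.
- move=> zeta f Sz vf; have Kf := KIof _ _ Sz vf; split => //; apply: le_anti.
  rewrite all_le//=; have := Sz.2 _ wzs.
  by rewrite Es (energyW_version s01 p2 gp W vf (K_lp Kf.1) Kf.2) lee_fin.
Qed.

Lemma Sigma_Phi zeta f t : Sigma zeta -> version s zeta f -> 0 <= t -> Phi (@leb2s R) f t = Phi (@leb2s R) z0 t.
Proof. by move=> /Sigma_rearr r vf t0; exact: rearr_Phi r vf vz t0. Qed.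

(** Positivity of the constant is read off from S > 0 instead of from Euler's integral: with c_s = 0
    all potentials vanish and no penalised energy is positive. *)
Lemma c_gt0 S : 0 < S -> (exists f, KI f /\ Et f = S) -> 0 < c_ s.
Proof.
move=> S0 [f [[Kf If] E]]; rewrite lt_neqAle c_ge0// andbT; apply/eqP => c0.
have Lf := K_lp Kf.
have p0 x : pot s f x <= 0 by apply: (le_trans (pot_le_nk s01 p2 gp x Lf)); rewrite -c0 mul0r.
have := ben_le_ub s01 p2 gp Lf Lf p0; rewrite mul0r => b0.
have i0 : 0 <= imp f by exact: imp_ge0 Kf.
have w0 : 0 <= W * imp f by apply: mulr_ge0 => //; exact: ltW.
by move: S0; rewrite -E /Et; move: b0 w0; move: (ben f f) (W * imp f) => u v; lra.
Qed.

End Maximizers.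

Lemma hinge_lip {R : realType} (t u v : R) : `|hinge t u - hinge t v| <= `|u - v|.
Proof.
rewrite /hinge; have [h1|h1] := leP (u - t) 0; have [h2|h2] := leP (v - t) 0.
- by rewrite subrr normr0.
- by rewrite ler_norml; have := ler_norm (u - v); have := ler_norm (- (u - v)); rewrite normrN; lra.
- by rewrite ler_norml; have := ler_norm (u - v); have := ler_norm (- (u - v)); rewrite normrN; lra.
- by have -> : u - t - (v - t) = u - v by ring.
Qed.

Lemma half_inj {R : realType} (u v : R) : u / 2 = v / 2 -> u = v.
Proof. by move/(congr1 (fun w => w * 2)); rewrite !divfK. Qed.

Lemma sum3_le {R : realType} (u v w : \bar R) (d : R) : (0 <= u)%E -> (0 <= v)%E -> (0 <= w)%E ->
  (u + v + w <= d%:E)%E -> (u <= d%:E)%E /\ (w <= d%:E)%E.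
Proof.
move=> u0 v0 w0 h; split; apply: le_trans h; first by rewrite -addeA leeDl// adde_ge0.
by rewrite leeDr// adde_ge0.
Qed.

Lemma orbit_alg {R : realType} (C W d u v r i j : R) : v <= u + 2 * (C * r) -> C * r <= C * d ->
  i <= j + W * d -> v / 2 - j - (C + W) * d <= u / 2 - i.
Proof. by rewrite mulrDl; lra. Qed.

(** * Solutions *)

Section Orbit.
Context {R : realType}.
Implicit Types x y : plane R.
Local Notation mu2 := (@leb2 R).
Local Notation P := (plane R).
Local Notation Rint f := (\int[mu2]_x f x).
Implicit Types f g h a d zeta : P -> R.

Lemma spt_ae0 f : {ae mu2, forall x, f x = 0} -> spt f = set0.
Proof.
move=> f0; rewrite /spt; apply/seteqP; split => // x; apply.
by exists setT => //; split; [exact: openT|apply: filterS f0].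
Qed.

(** The negative part of u - v is below [v] and has finite integral, so a finite total forces the
    positive part to be integrable too. In this way a bound on |I(xi0 - zeta)| yields a finite
    impulse for the initial data. *)
Lemma integ_of_finite (u v : P -> R) : measurable_fun setT u -> (forall x, 0 <= u x) -> (forall x, 0 <= v x) ->
  integ mu2 v -> (`|\int[mu2]_x (u x - v x)%:E| < +oo)%E -> integ mu2 u.
Proof.
move=> mu u0 v0 iv h; have mv := integ_meas iv.
pose w x := u x - v x.
have mw : measurable_fun setT w by exact: measurable_funB.
pose wp x := Num.max (w x) 0; pose wm x := Num.max (- w x) 0.
have mwp : measurable_fun setT wp by exact: measurable_maxr.
have mwm : measurable_fun setT wm by apply: measurable_maxr => //; exact: measurableT_comp.
have iwm : integ mu2 wm.
  apply: (ge0_integ_le _ iv) => // x; first by rewrite le_max lexx orbT.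
  by rewrite /wm /w opprB ge_max v0 andbT lerBlDr lerDl.
have Ew : (\int[mu2]_x (u x - v x)%:E = \int[mu2]_x (wp x)%:E - (Rint wm)%:E)%E.
  rewrite integralE -EFin_Rint//; congr (_ - _)%E; apply: eq_integral => x _.
    by rewrite funeposE -EFin_max.
  by rewrite funenegE -EFin_max.
have iwp : integ mu2 wp.
  apply: ge0_integ => //; first by move=> x; rewrite le_max lexx orbT.
  move: h; rewrite Ew; case: (\int[mu2]_x (wp x)%:E)%E => [r|//|//] _; exact: ltry.
apply: (ge0_integ_le _ (integD iwp iv)) => // x.
by rewrite /wp -lerBlDr le_max lexx.
Qed.

Lemma normp1_ae f g : measurable_fun setT f -> measurable_fun setT g -> {ae mu2, forall x, f x = g x} ->
  normp 1 f = (\int[mu2]_x `|g x|%:E)%E.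
Proof.
move=> mf mg fg; rewrite /normp Lnorm1; transitivity (\int[mu2]_x (`|f x|)%:E)%E => //.
by apply: ae_integral; [exact: measurableT_comp|exact: measurableT_comp|apply: filterS fg => x ->].
Qed.

Lemma normp2_ae f g : measurable_fun setT f -> measurable_fun setT g -> {ae mu2, forall x, f x = g x} ->
  normp 2 f = normp 2 g.
Proof.
move=> mf mg fg; rewrite /normp unlock /Lnorm; apply: (congr1 (fun u => (u `^ 2^-1)%E)).
have E h : (\int[mu2]_x (`|(EFin \o h) x| `^ 2) = \int[mu2]_x (`|h x| `^ 2)%:E)%E.
  by apply: eq_integral.
have mp h : measurable_fun setT h -> measurable_fun setT (fun x => `|h x| `^ 2).
  by move=> mh; apply: (measurableT_comp (measurable_powR 2)); exact: measurableT_comp.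
by rewrite !E; apply: ae_integral; [exact: mp|exact: mp|apply: filterS fg => x ->].
Qed.

Variables s p W : R.
Hypothesis s01 : 0 < s < 1.
Hypothesis p2 : 2 <= p.
Hypothesis gp : gam s * (p / (p - 1)) < 2.
Hypothesis W0 : 0 < W.
Local Notation D := (@Dom R s).
Local Notation LP := (@LP R p).
Local Notation ben := (@ben R s).
Variables zeta0 z0 : P -> R.
Hypothesis vz : version s zeta0 z0.
Hypothesis Lz : LP z0.
Local Notation K := (inK D z0).
Local Notation KI := (KI s z0).
Local Notation Et := (Et s W).
Local Notation Sigma := (maximizers s W zeta0).
Hypothesis Sigma_rearr : Sigma `<=` rearr s zeta0.
Variable S : R.
Hypothesis Smax : forall zeta f, Sigma zeta -> version s zeta f -> KI f /\ Et f = S.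

Let K_lp f : K f -> LP f. Proof. by move=> /(K_LP p2 Lz)[]. Qed.

Lemma rphi_dist f g t : LP f -> LP g -> 0 <= t -> `|rphi f t - rphi g t| <= \int[mu2]_x `|f x - g x|.
Proof.
move=> Lf Lg t0; have i1 := integ_hinge Lf t0; have i2 := integ_hinge Lg t0.
rewrite -RintB//; apply: (le_trans (le_normr_Rintegral measurableT (integB i1 i2))).
apply: le_Rint; [exact: integ_norm (integB i1 i2)|exact: integ_norm (integB (LP_integ Lf) (LP_integ Lg))|].
move=> x; exact: hinge_lip.
Qed.

Lemma version_ae zeta zeta' f : version s zeta f -> measurable_fun setT zeta' ->
  {ae mu2, forall x, zeta' x = zeta x} -> version s zeta' f.
Proof. by move=> [mz mf f0 fD zf] mz' h; split => //; apply: filterS2 h zf => x ->. Qed.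

(** The bound [M] propagates because {xi t > M} has the measure of {xi0 > M}, which is 0. Energy and
    impulse are compared with their values at time 0, where the solution coincides with [xi0] almost
    everywhere. *)
Lemma orbit_version M T xi0 xi : 0 < M -> (0 < T)%E -> Linfty_regular s T xi0 xi -> ae_nonneg xi0 ->
  (normp +oo xi0 <= M%:E)%E ->
  exists g0, [/\ version s xi0 g0, LP g0, forall x, g0 x <= M &
   forall t, 0 <= t -> (t%:E < T)%E -> exists g, [/\ version s (xi t) g, LP g /\ (forall x, g x <= M),
    ben g g = ben g0 g0, (\int[mu2]_x (x.1 * g x)%:E = \int[mu2]_x (x.1 * g0 x)%:E)%E &
    forall r, 0 <= r -> rphi g r = rphi g0 r]].
Proof.
move=> M0 T0 reg n0 nM; have M0' := ltW M0.
have [mxi0 _ fin0] := Linf_data1 reg.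
have r0 := Linf_rearr reg (lexx 0) T0; have [[m00 sD0 _] n00 _] := r0.
have init := Linf_init reg.
have supp0 : ae_supported D xi0.
  by apply: filterS2 init sD0 => x <-.
have [g00 v00] := version_exists mxi0 n0 supp0.
have v0 := version_bounded M0' v00 (normpy_ae mxi0 nM).
set g0 := (fun x => Num.min (g00 x) M) in v0.
have g0M x : g0 x <= M by rewrite ge_min lexx orbT.
have [_ mg0 g00' _ _] := v0.
have L0 : LP g0 := bounded_LP p2 mg0 g00' g0M (normp1_integ v0 fin0).
have H t : 0 <= t -> (t%:E < T)%E -> exists g, [/\ version s (xi t) g, LP g, forall x, g x <= M & 
    forall r, 0 <= r -> rphi g r = rphi g0 r].
  move=> t0 tT; have rt := Linf_rearr reg t0 tT; have [[mt sDt fint] nt dt] := rt.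
  have [h vh] := version_exists mt nt sDt.
  have hM : {ae mu2, forall x, `|xi t x| <= M}.
    have E : mu2 [set x | M < h x] = 0%E.
      rewrite -(leb2_version M vh); apply: etrans (dt M M0) _; rewrite (leb2_version M v0).
      rewrite (_ : [set x | M < g0 x] = set0) ?measure0//.
      by apply/seteqP; split => // x /=; rewrite ltNge g0M.
    have [_ mh h0 _ xh] := vh.
    have aeh : {ae mu2, forall x, h x <= M}.
      exists [set x | M < h x]; split => //.
        by rewrite -[X in measurable X]setTI; exact: (measurable_fun_ltr (measurable_cst M) mh).
      by move=> x /= /negP; rewrite -ltNge.
    by apply: filterS2 aeh xh => x hx ->; rewrite ger0_norm.
  have vg := version_bounded M0' vh hM.
  set g := (fun x => Num.min (h x) M) in vg.
  have gM x : g x <= M by rewrite ge_min lexx orbT.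
  have [_ mg gg0 _ _] := vg.
  have Lg : LP g := bounded_LP p2 mg gg0 gM (normp1_integ vg fint).
  exists g; split => // r r0'; apply: EFin_inj; rewrite -(Phi_rphi Lg r0') -(Phi_rphi L0 r0').
  exact: rearr_Phi rt vg v0 r0'.
exists g0; split => // t t0 tT; have [g [vg Lg gM hg]] := H t t0 tT.
have v00' : version s (xi 0) g0 := version_ae v0 m00 init.
exists g; split; [exact: vg|by split| | |exact: hg].
  apply: half_inj; apply: EFin_inj.
  rewrite -(energy_version s01 p2 gp vg Lg) -(energy_version s01 p2 gp v00' L0).
  exact: (Linf_energy reg t0 tT (lexx 0) T0).
rewrite -(impulse_version vg) -(impulse_version v00').
exact: (Linf_impulse reg t0 tT (lexx 0) T0).
Qed.

(** By conservation everything at time t is read at time 0, where [xi0] is within [d] of the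
    maximizer [zeta]: hinge integrals differ by the L^1 distance, impulses by assumption, and the
    energy drops by at most C1 d by [ben_le_sub], so C = C1 + W. The restriction d <= 2 bounds the
    mass, which lets [C] depend on [M] alone. *)
Lemma orbit_data M : 0 < M -> exists2 C, 0 <= C & forall T xi0 xi t (d : R) zeta,
  (0 < T)%E -> Linfty_regular s T xi0 xi -> ae_nonneg xi0 ->
  (normp +oo xi0 <= M%:E)%E -> Sigma zeta -> 0 <= d <= 2 ->
  (normp 1 (xi0 \- zeta)%R + normp 2 (xi0 \- zeta)%R + `|impulse s (xi0 \- zeta)%R| <= d%:E)%E ->
  0 < t -> (t%:E < T)%E ->
  exists g zc, [/\ version s (xi t) g, version s zeta zc,
     LP g /\ (forall x, g x <= M), integ mu2 (fun x => x.1 * g x) /\ `|imp g - imp zc| <= d &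
     (forall r, 0 <= r -> `|rphi g r - rphi z0 r| <= d) /\ S - C * d <= Et g].
Proof.
move=> M0.
pose Mp := Num.max (Rint (fun x => z0 x `^ p)) (M `^ (p - 1) * (Rint z0 + 2)).
have [C1 C10 hC] := pot_ub s01 p2 gp (Rint z0 + 2) Mp.
exists (C1 + W); first by rewrite addr_ge0// ltW.
move=> T xi0 xi t d zeta T0 reg n0 nM Sz /andP[d0 d2] hd t0 tT.
have [g0 [v0 L0 g0M /(_ t (ltW t0) tT)[g [vg [Lg gM] Eb Ei Er]]]] := orbit_version M0 T0 reg n0 nM.
have [mxi0 mg0 g00 g0D xg0] := v0.
have [[mz zD zn _] _] := Sz.
have [zc vc] := version_exists mz zn zD.
have [_ mc c0 cD zzc] := vc.
have [[Kc Ic] Ec] := Smax Sz vc; have Lc := K_lp Kc.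
have aed : {ae mu2, forall x, (xi0 \- zeta) x = g0 x - zc x} by apply: filterS2 xg0 zzc => x /= -> ->.
have md : measurable_fun setT (xi0 \- zeta) by exact: measurable_funB.
have mgc : measurable_fun setT (fun x => g0 x - zc x) by exact: measurable_funB.
have igc := integB (LP_integ L0) (LP_integ Lc).
have [hd1 hd2] := sum3_le (Lnorm_ge0 _ _ _) (Lnorm_ge0 _ _ _) (abse_ge0 _) hd.
clear reg n0 nM hd.
have l1 : \int[mu2]_x `|g0 x - zc x| <= d.
  rewrite -lee_fin -(EFin_Rint (integ_norm igc)) -(normp1_ae md mgc aed).
  exact: hd1.
have Eimp : (impulse s (xi0 \- zeta)%R = \int[mu2]_x (x.1 * g0 x - x.1 * zc x)%:E)%E.
  rewrite /impulse; transitivity (\int[mu2]_(x in D) (x.1 * g0 x - x.1 * zc x)%:E)%E.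
    apply: ae_eq_integral; first exact: measurable_Dom.
    - by apply: measurable_funTS; apply/measurable_EFinP; exact: measurable_x1f.
    - by apply: measurable_funTS; apply/measurable_EFinP; apply: measurable_funB; exact: measurable_x1f.
    - by apply: filterS aed => x -> _; rewrite mulrBr.
  by apply: integral_supported => x nD; rewrite (g0D x nD) (cD x nD) mulr0 subrr.
have x1g0 x := x1_mul_ge0 x g00 g0D.
have x1c x := x1_mul_ge0 x c0 cD.
have I0 : integ mu2 (fun x => x.1 * g0 x).
  apply: (integ_of_finite (measurable_x1f mg0) x1g0 x1c Ic).
  by rewrite -Eimp; exact: le_lt_trans hd2 (ltry _).
have [_ mg gg0 gD _] := vg.
have I1 : integ mu2 (fun x => x.1 * g x).
  apply: (ge0_integ (measurable_x1f mg) (fun x => x1_mul_ge0 x gg0 gD)).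
  rewrite Ei; exact: integ_lty I0 x1g0.
have Eig : imp g = imp g0 := congr1 fine Ei.
have himp : `|imp g0 - imp zc| <= d.
  move: hd2; rewrite Eimp EFin_Rint; last exact: integB.
  by rewrite RintB.
have rc r : 0 <= r -> rphi zc r = rphi z0 r.
  move=> r0; apply: EFin_inj; rewrite -(Phi_rphi Lc r0) -(Phi_rphi Lz r0).
  exact: (Sigma_Phi vz Sigma_rearr Sz vc r0).
exists g, zc; split; [exact: vg|exact: vc|by split|by rewrite Eig; split|].
split; first by move=> r r0; rewrite (Er r r0) -(rc r r0); exact: le_trans (rphi_dist L0 Lc r0) l1.
have -> : Et g = Et g0 by rewrite /Et Eb Eig.
have [_ M1c Mpc _ _] := K_LP p2 Lz Kc.
have potc x : pot s zc x <= C1.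
  apply: (hC _ _ Lc); first by apply: (le_trans M1c); rewrite lerDl.
  by apply: (le_trans Mpc); rewrite le_max lexx.
have R0 : Rint g0 <= Rint z0 + 2.
  have := le_trans (rphi_dist L0 Lc (lexx 0)) l1; rewrite (rc 0 (lexx 0)) (rphi0 L0) (rphi0 Lz) ler_norml => /andP[_].
  by rewrite lerBlDl => /le_trans; apply; rewrite lerD2l.
have potg x : pot s g0 x <= C1.
  apply: (hC _ _ L0 R0); rewrite le_max; apply/orP; right.
  apply: (@le_trans _ _ (Rint (fun x => M `^ (p - 1) * g0 x))).
    apply: le_Rint; [exact: LP_integp L0|by apply: integZ; exact: LP_integ L0|].
    by move=> y; exact: powR_bounded_le.
  by rewrite (RintZ _ (LP_integ L0)); exact: ler_wpM2l (powR_ge0 _ _) _ _ R0.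
have Lw : LP (fun x => Num.max (zc x - g0 x) 0).
  apply: (LP_le p2 _ Lc); first by apply: measurable_maxr; [exact: measurable_funB|exact: measurable_cst].
  by move=> x; rewrite le_max lexx orbT/= ge_max c0 andbT lerBlDr lerDl.
have b1 := ben_le_sub s01 p2 gp Lc L0 Lw potc potg.
have b2 : \int[mu2]_x Num.max (zc x - g0 x) 0 <= d.
  apply: le_trans l1; apply: le_Rint; [exact: LP_integ Lw|exact: integ_norm|].
  by move=> x; rewrite ge_max normr_ge0 andbT distrC ler_norm.
have b3 : C1 * \int[mu2]_x Num.max (zc x - g0 x) 0 <= C1 * d by exact: ler_wpM2l (ltW C10) _ _ b2.
have b4 : W * imp g0 <= W * imp zc + W * d.
  rewrite -mulrDr; apply: ler_wpM2l; first exact: ltW.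
  by move: himp; rewrite ler_norml => /andP[_]; rewrite lerBlDl.
move: Ec; rewrite /Et => <-; exact: orbit_alg b1 b3 b4.
Qed.

End Orbit.

Lemma final_alg {R : realType} (e i j k m : R) : `|i - k| <= e / 4 -> k = j -> m <= e / 8 ->
  i - j + 2 * m <= e / 2.
Proof. by rewrite ler_norml => /andP[_ h] <- h2; lra. Qed.

(** * Orbital stability *)

Section Core.
Context {R : realType}.
Implicit Types x y : plane R.
Local Notation mu2 := (@leb2 R).
Local Notation P := (plane R).
Local Notation Rint f := (\int[mu2]_x f x).
Variables s p W : R.
Hypothesis s01 : 0 < s < 1.
Hypothesis p2 : 2 <= p.
Hypothesis gp : gam s * (p / (p - 1)) < 2.
Hypothesis W0 : 0 < W.
Implicit Types f g h a d zeta : P -> R.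
Local Notation D := (@Dom R s).
Local Notation LP := (@LP R p).
Variables zeta0 z0 : P -> R.
Hypothesis vz : version s zeta0 z0.
Hypothesis Lz : LP z0.
Local Notation K := (inK D z0).
Local Notation KI := (KI s z0).
Local Notation Et := (Et s W).
Local Notation Sigma := (maximizers s W zeta0).
Hypothesis z0_gt0 : 0 < Rint z0.
Hypothesis Sigma_neq0 : Sigma !=set0.
Hypothesis Sigma_rearr : Sigma `<=` rearr s zeta0.

Let K_lp f : K f -> LP f. Proof. by move=> /(K_LP p2 Lz)[]. Qed.

(** Both conclusions of the theorem at once, the weighted one conditional on equal impulses, so that
    a single argument by contradiction serves for both. *)
Definition orbit_close (eta : R) th : Prop := exists a, [/\ Sigma a,
  (normp 1 (th \- a)%R + normp 2 (th \- a)%R <= eta%:E)%E &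
  (forall zeta1 zeta2, Sigma zeta1 -> Sigma zeta2 -> impulse s zeta1 = impulse s zeta2) ->
  (normp 1 (th \- a)%R + normp 2 (th \- a)%R + impulse s (fun x => `|th x - a x|%R) <= eta%:E)%E].

(** Translation invariance turns the estimates between the translate of [g] and [a] into estimates
    between [th] and the maximizer [a \o shift2 (- c)]. For the weight, |g - a| = (g - a) + 2 (a -
    g)_+ leaves the difference of impulses, controlled through [zc] when all maximizers share one
    impulse, and twice the one-sided integral. *)
Lemma orbit_close_shift eta th g a c zc e : 0 < eta -> 0 < e -> e <= eta / 8 -> e <= (eta / 4) ^+ 2 ->
  version s th g -> LP g -> integ mu2 (fun x => g x ^+ 2) -> integ mu2 (fun x => x.1 * g x) -> KI a ->
  Sigma (a \o shift2 (- c)) ->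
  (exists2 zeta, Sigma zeta & version s zeta zc) -> integ mu2 (fun x => x.1 * zc x) ->
  `|imp g - imp zc| <= eta / 4 ->
  \int[mu2]_x `|g (shift2 c x) - a x| <= e -> \int[mu2]_x ((g (shift2 c x) - a x) ^+ 2) <= e ->
  \int[mu2]_x (x.1 * Num.max (a x - g (shift2 c x)) 0) <= e -> orbit_close eta th.
Proof.
move=> eta0 e0 e8 esq vg Lg ig2 Ig Ka Sa [zeta Sz vzc] Izc himp h1 h2 h3.
have La := K_lp Ka.1; have [_ _ _ ia2 _] := K_LP p2 Lz Ka.1.
have [[Ka' Ia'] Eia' _] := KI_shift2 W s01 p2 gp Lz (- c) Ka.
set a' := a \o shift2 (- c) in Sa Ka' Ia' Eia'.
have La' := K_lp Ka'; have [_ _ _ ia2' _] := K_LP p2 Lz Ka'.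
have [mth mg g0 gD thg] := vg.
have ma := LP_meas La; have ma' := LP_meas La'.
have mga : measurable_fun setT (fun x => g x - a' x) by exact: measurable_funB.
have a'sh x : a' (shift2 c x) = a x by rewrite /a' /shift2 /= addrK; case: x.
have ae : {ae mu2, forall x, (th \- a') x = g x - a' x} by apply: filterS thg => x /= ->.
have mtha : measurable_fun setT (th \- a') by exact: measurable_funB.
have iga := integB (LP_integ Lg) (LP_integ La').
have n1 : (normp 1 (th \- a')%R <= (eta / 4)%:E)%E.
  rewrite (normp1_ae mtha mga ae) EFin_Rint ?lee_fin; last exact: integ_norm.
  have [_ <-] := integ_shift2 c (integ_meas (integ_norm iga)) (fun x => normr_ge0 _) (integ_norm iga).
  have -> : Rint ((fun x => `|g x - a' x|) \o shift2 c) = \int[mu2]_x `|g (shift2 c x) - a x|.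
    by apply: eq_Rint => x /=; rewrite a'sh.
  apply: (le_trans h1); apply: (le_trans e8); rewrite ler_pM2l// lef_pV2 ?posrE ?ltr0n// ler_nat//.
have iga2 : integ mu2 (fun x => (g x - a' x) ^+ 2).
  have i3 := integD ig2 ia2'.
  apply: (ge0_integ_le _ (integZ 2 i3)); first exact: measurable_funX.
    by move=> x; exact: sqr_ge0.
  by move=> x; have := sqr_ge0 (g x + a' x); rewrite sqrrD sqrrB; move: (g x) (a' x) => u v; lra.
have n2 : (normp 2 (th \- a')%R <= (eta / 4)%:E)%E.
  rewrite (normp2_ae mtha mga ae); apply: normp2_le => //; first by rewrite divr_ge0// ltW.
  have [_ <-] := integ_shift2 c (integ_meas iga2) (fun x => sqr_ge0 _) iga2.
  have -> : Rint ((fun x => (g x - a' x) ^+ 2) \o shift2 c) = \int[mu2]_x ((g (shift2 c x) - a x) ^+ 2).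
    by apply: eq_Rint => x /=; rewrite a'sh.
  exact: le_trans esq.
have n12 : (normp 1 (th \- a')%R + normp 2 (th \- a')%R <= (eta / 2)%:E)%E.
  by apply: (le_trans (leeD n1 n2)); rewrite -EFinD lee_fin; lra.
exists a'; split => //; first by apply: (le_trans n12); rewrite lee_fin; lra.
move=> same.
suff n3 : (impulse s (fun x => `|th x - a' x|%R) <= (eta / 2)%:E)%E.
  by apply: (le_trans (leeD n12 n3)); rewrite -EFinD lee_fin; lra.
have vabs : version s (fun x => `|th x - a' x|) (fun x => `|g x - a' x|).
  split => //.
  - by apply: measurableT_comp => //; exact: measurable_funB.
  - exact: measurableT_comp.
  - by move=> x nD; rewrite gD//; case: Ka' => _ _ -> //; rewrite subrr normr0.
  - by apply: filterS thg => x ->.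
have Dx1 x : D x -> 0 <= x.1 by move=> Dx; exact: ltW (Dom_gt0 Dx).
have a'D x : ~ D x -> a' x = 0 by move=> nD; case: Ka' => _ _ ->.
have I3 : integ mu2 (fun x => x.1 * `|g x - a' x|).
  apply: (integ_le _ (integD Ig Ia')).
    by apply: measurable_x1f; exact: measurableT_comp.
  move=> x; have [Dx|nDx] := pselect (D x); last by rewrite gD// a'D// subrr normr0 !mulr0 normr0 addr0.
  rewrite ger0_norm; last by apply: mulr_ge0; [exact: Dx1|].
  rewrite -mulrDr; apply: ler_wpM2l; first exact: Dx1.
  by apply: (le_trans (ler_normB _ _)); rewrite !ger0_norm// (LP_ge0 x La').
rewrite (impulse_version vabs) EFin_Rint// lee_fin.
have x13 x : 0 <= x.1 * `|g x - a' x|.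
  have [Dx|nDx] := pselect (D x); last by rewrite gD// a'D// subrr normr0 mulr0.
  by apply: mulr_ge0; [exact: Dx1|].
have [_ <-] := integ_shift2 c (integ_meas I3) x13 I3.
pose gc := g \o shift2 c.
have x1g x : 0 <= x.1 * g x.
  have [Dx|nDx] := pselect (D x); last by rewrite gD// mulr0.
  by apply: mulr_ge0; [exact: Dx1|].
have [Igc Egc] := integ_shift2 c (measurable_x1f mg) x1g Ig.
have Igc' : integ mu2 (fun x => x.1 * gc x) by [].
have Egc' : Rint (fun x => x.1 * gc x) = imp g by [].
have gcD x : ~ D x -> gc x = 0 by move=> nD; rewrite /gc /= gD// => /Dom_shift2.
have gc0 x : 0 <= gc x by exact: g0.
have mgc : measurable_fun setT gc by apply: measurableT_comp => //; exact: measurable_shift2.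
have Im : integ mu2 (fun x => x.1 * Num.max (a x - gc x) 0).
  apply: (ge0_integ_le _ Ka.2).
  - by apply: measurable_x1f; apply: measurable_maxr => //; exact: measurable_funB.
  - move=> x; have [Dx|nDx] := pselect (D x).
      by apply: mulr_ge0; [exact: Dx1|rewrite le_max lexx orbT].
    by rewrite gcD//; case: Ka.1 => _ _ -> // _; rewrite subrr max_l// mulr0.
  - move=> x; have [Dx|nDx] := pselect (D x).
      apply: ler_wpM2l; first exact: Dx1.
      by rewrite ge_max (LP_ge0 x La) andbT lerBlDr lerDl.
    by rewrite gcD//; case: Ka.1 => _ _ -> // _; rewrite subrr max_l// mulr0.
have E x : ((fun x => x.1 * `|g x - a' x|) \o shift2 c) x =
    (x.1 * gc x - x.1 * a x) + 2 * (x.1 * Num.max (a x - gc x) 0).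
  rewrite /= a'sh -[g _]/(gc x) -mulrBr mulrCA -mulrDr; congr (_ * _).
  have [h|h] := leP 0 (a x - gc x).
    by rewrite distrC ger0_norm//; ring.
  by rewrite distrC ltr0_norm//; ring.
rewrite (eq_Rint _ E) (RintD (integB Igc' Ka.2) (integZ 2 Im)) (RintB Igc' Ka.2) Egc' (RintZ _ Im).
apply: (final_alg himp); last exact: le_trans e8.
have := same _ _ Sz Sa; rewrite (impulse_version vzc) (impulse_version (K_version Ka')).
by rewrite (EFin_Rint Izc) (EFin_Rint Ia') -[\int[mu2]_x (x.1 * a' x)]/(imp a') Eia' => -[].
Qed.

Lemma orbital_stability eta M : 0 < eta -> 0 < M -> exists2 delta : R, 0 < delta &
  forall (T : \bar R) (xi0 : plane R -> R) (xi : R -> plane R -> R),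
    (0 < T)%E -> Linfty_regular s T xi0 xi -> ae_nonneg xi0 ->
    (normp +oo xi0 <= M%:E)%E ->
    (ereal_inf [set normp 1 (xi0 \- zeta)%R + normp 2 (xi0 \- zeta)%R
                    + `|impulse s (xi0 \- zeta)%R| | zeta in Sigma] <= delta%:E)%E ->
    forall t : R, 0 < t -> (t%:E < T)%E -> orbit_close eta (xi t).
Proof.
move=> eta0 M0.
have [S [S0 HS Satt Smax]] := maximum_exists s01 p2 gp W0 vz Lz z0_gt0 Sigma_neq0 Sigma_rearr.
have [C C0 hC] := orbit_data s01 p2 gp W0 vz Lz Sigma_rearr Smax M0.
have cpos : 0 < c_ s.
  have [zs Szs] := Sigma_neq0; have [fs vfs _] := wclosure_version vz Szs.1.
  by apply: (c_gt0 s01 p2 gp W0 Lz S0); exists fs; exact: Smax Szs vfs.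
apply: contrapT => nodelta.
(* Twice the failing delta 1/(n+1): the infimum need not be attained, and the room selects a
   maximizer. Also dn <= 2, as [orbit_data] requires. *)
pose dn (n : nat) : R := 2 / n.+1%:R.
(* The solution at the bad time, its representative and that of a nearby maximizer are packed into
   one function, so that a single choice gives the three sequences. *)
have bad n : exists u : P -> R * (R * R), 
    let th x := (u x).1 in let g x := (u x).2.1 in let zc x := (u x).2.2 in
    [/\ version s th g /\ (exists2 zeta, Sigma zeta & version s zeta zc),
     LP g /\ (forall x, g x <= M), integ mu2 (fun x => x.1 * g x) /\ `|imp g - imp zc| <= dn n,
     (forall r, 0 <= r -> `|rphi g r - rphi z0 r| <= dn n) /\ S - C * dn n <= Et g &
     ~ orbit_close eta th].
  apply: contrapT => nex; apply: nodelta; exists n.+1%:R^-1; first by rewrite invr_gt0.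
  move=> T xi0 xi T0 reg n0 nM hinf t t0 tT; apply: contrapT => nclose; apply: nex.
  have : (ereal_inf [set normp 1 (xi0 \- zeta)%R + normp 2 (xi0 \- zeta)%R
                    + `|impulse s (xi0 \- zeta)%R| | zeta in Sigma] < (dn n)%:E)%E.
    apply: (le_lt_trans hinf); rewrite lte_fin /dn -[ltLHS]mul1r ltr_pM2r ?invr_gt0//.
    by rewrite ltr1n.
  move=> /ereal_inf_lt[_ [zeta Sz <-] /ltW hz].
  have d02 : 0 <= dn n <= 2.
    rewrite /dn divr_ge0//= ler_pdivrMr// ler_peMr// ler1n//.
  have [g [zc [h1 h2 h3 h4 h5]]] := hC T xi0 xi t (dn n) zeta T0 reg n0 nM Sz d02 hz t0 tT.
  by exists (fun x => (xi t x, (g x, zc x))); split => //; split => //; exists zeta.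
have [u hu] := choice bad.
pose th n x := (u n x).1; pose g n x := (u n x).2.1; pose zc n x := (u n x).2.2.
have [U [UU ooU]] := ultraFilterLemma (F := \oo) _.
have Lg n : LP (g n) by have [_ []] := hu n.
have vg n : version s (th n) (g n) by have [[]] := hu n.
have dn_small e : 0 < e -> \forall n \near U, dn n <= e.
  move=> e0; apply: ooU; have e2 : 0 < e / 2 by rewrite divr_gt0.
  have := near_infty_natSinv_lt (PosNum e2); apply: filterS => n /= h.
  by rewrite /dn -ler_pdivlMl// mulrC ltW.
have Hmax a : KI a -> Et a = S ->
    Rint z0 <= Rint a /\ \int[mu2]_x (z0 x ^+ 2) <= \int[mu2]_x (a x ^+ 2).
  move=> Ka Ea; have La := K_lp Ka.1; have Sa := Satt _ Ka Ea.
  have E t := Sigma_Phi vz Sigma_rearr Sa (K_version Ka.1) (t := t).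
  have mz := LP_meas Lz; have z00 x := LP_ge0 x Lz; have ma := LP_meas La; have a0 x := LP_ge0 x La.
  split.
    by have := E 0 (lexx 0); rewrite (Phi_rphi La (lexx 0)) (Phi_rphi Lz (lexx 0)) (rphi0 La) (rphi0 Lz) => -[->].
  (* [a] and [z0] have the same hinge integrals, so [z0] lies in the class generated by [a]; the
     norm bound with the roles exchanged gives the inequality needed. *)
  have Kz : inK D a z0.
    split => //; first by case: vz.
    by move=> t t0; rewrite E// ltW.
  by have [] := K_LP p2 La Kz.
have [] := stability s01 p2 gp W0 Lz S0 HS cpos z0_gt0 Hmax UU ooU Lg (M := M).
- by move=> n x nD; have [_ _ _ h _] := vg n; exact: h.
- by move=> n x; have [_ [_ h] _ _ _] := hu n; exact: h.
- by move=> n; have [_ _ [h _] _ _] := hu n.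
- move=> e e0; apply: filterS (dn_small _ e0) => n h t t0; apply: le_trans h.
  by have [_ _ _ [h _] _] := hu n; exact: h.
- move=> e e0; have eC : 0 < e / (C + 1) by rewrite divr_gt0// ltr_wpDl.
  apply: filterS (dn_small _ eC) => n h; have [_ _ _ [_ h2] _] := hu n.
  apply: le_trans h2; rewrite lerD2l lerN2.
  apply: (le_trans (ler_wpM2l C0 h)); rewrite mulrCA ler_piMr ?(ltW e0)//.
  by rewrite ler_pdivrMr ?ltr_wpDl// mul1r lerDl.
move=> a [Ka Ea ha].
pose e := Num.min (eta / 8) ((eta / 4) ^+ 2).
have e0 : 0 < e by rewrite lt_min divr_gt0//= exprn_gt0// divr_gt0.
have eta4 : 0 < eta / 4 by rewrite divr_gt0.
have nI (X Y : set nat) : U X -> U Y -> U (X `&` Y) by exact: filterI.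
have /filter_ex[n [[c [h1 h2 h3]] hd]] := nI _ _ (ha _ e0) (dn_small _ eta4).
have [[v1 [zeta Sz vzc]] [_ gM] [Ig Ii] _ nclose] := hu n; apply: nclose.
have [Ka' _ Ea'] := KI_shift2 W s01 p2 gp Lz (- c) Ka.
apply: (orbit_close_shift (zc := zc n) eta0 e0 _ _ v1 (Lg n) _ Ig Ka _ _ _ _ h1 h2 h3).
- by rewrite ge_min lexx.
- by rewrite ge_min lexx orbT.
- have [mg g0 ig _] := Lg n.
  apply: (ge0_integ_le _ (integZ M ig)); first exact: measurable_funX.
    by move=> x; exact: sqr_ge0.
  by move=> x; rewrite expr2 ler_wpM2r// g0.
- by apply: Satt => //; rewrite Ea'.
- by exists zeta.
- by have [[_ ]] := Smax _ _ Sz vzc.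
- exact: le_trans hd.
Qed.

End Core.

Unset Implicit Arguments.

Theorem theorem4p8 (R : realType) (s : R) (q : \bar R)
    (zeta0 : plane R -> R) (W : R)
    (hs : 0 < s < 1)
    (hq_low : s <= 2^-1 -> ((Num.max 2 s^-1)%:E < q)%E)
    (hq_high : 2^-1 < s -> ((2 / (2 * s - 1))%:E < q)%E)
    (hzeta0_nonneg : ae_nonneg zeta0)
    (hzeta0_Lq : in_Lp (Dom s) q zeta0)
    (hzeta0_spt : (0 < leb2 (spt zeta0) < +oo)%E)
    (hW : 0 < W)
    (hSigma_neq0 : maximizers s W zeta0 !=set0)
    (hSigma_rearr : maximizers s W zeta0 `<=` rearr s zeta0)
    (hSigma_adm : forall zeta, maximizers s W zeta0 zeta -> admissible s zeta) :
  (forall eta M : R, 0 < eta -> 0 < M ->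
    exists2 delta : R, 0 < delta &
      forall (T : \bar R) (xi0 : plane R -> R) (xi : R -> plane R -> R),
        (0 < T)%E -> Linfty_regular s T xi0 xi -> ae_nonneg xi0 ->
        (normp +oo xi0 <= M%:E)%E ->
        (ereal_inf [set normp 1 (xi0 \- zeta)%R + normp 2 (xi0 \- zeta)%R
                        + `|impulse s (xi0 \- zeta)%R|
                   | zeta in maximizers s W zeta0] <= delta%:E)%E ->
        forall t : R, 0 < t -> (t%:E < T)%E ->
          (ereal_inf [set normp 1 (xi t \- zeta)%R + normp 2 (xi t \- zeta)%R
                     | zeta in maximizers s W zeta0] <= eta%:E)%E)
  /\
  ((forall zeta1 zeta2, maximizers s W zeta0 zeta1 ->
      maximizers s W zeta0 zeta2 -> impulse s zeta1 = impulse s zeta2) ->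
   forall eta M : R, 0 < eta -> 0 < M ->
    exists2 delta : R, 0 < delta &
      forall (T : \bar R) (xi0 : plane R -> R) (xi : R -> plane R -> R),
        (0 < T)%E -> Linfty_regular s T xi0 xi -> ae_nonneg xi0 ->
        (normp +oo xi0 <= M%:E)%E ->
        (ereal_inf [set normp 1 (xi0 \- zeta)%R + normp 2 (xi0 \- zeta)%R
                        + `|impulse s (xi0 \- zeta)%R|
                   | zeta in maximizers s W zeta0] <= delta%:E)%E ->
        forall t : R, 0 < t -> (t%:E < T)%E ->
          (ereal_inf [set normp 1 (xi t \- zeta)%R + normp 2 (xi t \- zeta)%R
                          + impulse s (fun x => `|xi t x - zeta x|%R)
                     | zeta in maximizers s W zeta0] <= eta%:E)%E).
Proof.
have [p [p2 gp hq]] := exponent_choice hs hq_low hq_high.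
have [mz0 sz0 fz0] := hzeta0_Lq.
have [z0 vz] := version_exists mz0 hzeta0_nonneg sz0.
have [mz z00 _ _] : [/\ measurable_fun setT z0, forall x, 0 <= z0 x, True & True] by case: vz.
(* A maximizer is a rearrangement of [zeta0] and lies in L^1; equality of the hinge integrals at 0
   transfers its mass to [zeta0]. *)
have iz0 : integ leb2 z0.
  have [zs Szs] := hSigma_neq0; have rs := hSigma_rearr _ Szs.
  have [[mzs sDs fins] ns _] := rs.
  have [f vf] := version_exists mzs ns sDs.
  have [_ mf f0 _ _] := vf.
  apply: ge0_integ => //.
  have E := rearr_Phi rs vf vz (lexx 0); have If := normp1_integ vf fins.
  have <- : (\int[leb2]_x (f x)%:E = \int[leb2]_x (z0 x)%:E)%E.
    by apply: etrans (integral_Phi0 (@leb2s R) f0) _; rewrite E; apply/esym; exact: (integral_Phi0 (@leb2s R) z00).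
  exact: integ_lty.
(* For q infinite the representative is cut at the essential bound, and being bounded and integrable
   it lies in L^p; otherwise p = q. *)
have [z1 [vz1 Lz1]] : exists z1, version s zeta0 z1 /\ LP p z1.
  case: hq => hq.
    have [M hM] : exists M, {ae leb2, forall x, `|zeta0 x| <= M}.
      have : normp +oo zeta0 \is a fin_num.
        by rewrite ge0_fin_numE; [move: fz0; rewrite hq|exact: Lnorm_ge0].
      by move=> /fineK E; exists (fine (normp +oo zeta0)); apply: normpy_ae => //; rewrite E.
    have hM' : {ae leb2, forall x, `|zeta0 x| <= Num.max M 0}.
      by apply: filterS hM => x h; rewrite le_max h.
    have M0 : 0 <= Num.max M 0 by rewrite le_max lexx orbT.
    have v1 := version_bounded M0 vz hM'.
    exists (fun x => Num.min (z0 x) (Num.max M 0)); split => //.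
    have [_ m1 p1 _ _] := v1.
    apply: (bounded_LP p2 m1 p1 (M := Num.max M 0)); first by move=> x; rewrite ge_min lexx orbT.
    by apply: (ge0_integ_le m1 iz0) => // x; rewrite ge_min lexx.
  exists z0; split => //; split => //.
  apply: (normp_integ _ vz); last by move: fz0; rewrite hq.
  by apply: lt_le_trans p2.
have z1_gt0 : 0 < \int[leb2]_x z1 x.
  have [_ _ _ _ zz1] := vz1.
  apply: Rint_gt0; [exact: LP_integ Lz1|by move=> x; exact: LP_ge0 Lz1|].
  move=> z10; have /spt_ae0 E : {ae leb2, forall x, zeta0 x = 0} by apply: filterS2 zz1 z10 => x -> ->.
  by move: hzeta0_spt; rewrite E measure0 ltxx.
have stab eta M (eta0 : 0 < eta) (M0 : 0 < M) :=
  orbital_stability hs p2 gp hW vz1 Lz1 z1_gt0 hSigma_neq0 hSigma_rearr eta0 M0.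
split=> [eta M eta0 M0|same eta M eta0 M0]; have [d d0 hd] := stab eta M eta0 M0; exists d => //.
  move=> T xi0 xi T0 reg n0 nM hinf t t0 tT.
  have [a [Sa h1 _]] := hd T xi0 xi T0 reg n0 nM hinf t t0 tT.
  by apply: le_trans h1; apply: ereal_inf_lbound; exists a.
move=> T xi0 xi T0 reg n0 nM hinf t t0 tT.
have [a [Sa _ h2]] := hd T xi0 xi T0 reg n0 nM hinf t t0 tT.
by apply: le_trans (h2 same); apply: ereal_inf_lbound; exists a.
Qed.
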